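(* Let $X,A,S(t),X_{-1},A_{-1},S_{-1}(t),J$ be as in the context. Let $\mathcal B\in\mathcal L(X,X_{-1})$ and put $\mathcal B_\lambda:=\lambda R(\lambda,A_{-1})\mathcal B$. Assume that for some $\mu_1,T>0$: (ds1) the domain $\{y\in X:\ (A_{-1}-\mu\mathcal B)y\in X\}$ of $(A_{-1}-\mu\mathcal B)|_X$ is independent of $\mu\in(0,\mu_1)$; (ds2) for all $u\in L^1(0,T;X)$, $\int_0^TS_{-1}(T-s)\mathcal Bu(s)\,ds\in X$; (ds3) there exists $\delta>0$ such that for every $y\in X$ and every selection $\phi(t)\in J(S(t)y)$, $t\in[0,T]$, $$\int_0^T\limsup_{\lambda\to+\infty}\mathrm{Re}\,\langle\mathcal B_\lambda S(t)y,\phi(t)\rangle\,dt\ge\delta\|S(T)y\|_X^2;$$ (ds4) there is a constant $k\ge0$ such that for all $y,z\in X$ there exists $(y^*,z^* )\in J(y)\times J(z)$ with $$\Big|\limsup_{\lambda\to+\infty}\mathrm{Re}\,\langle\mathcal B_\lambda y,y^*\rangle-\limsup_{\lambda\to+\infty}\mathrm{Re}\,\langle\mathcal B_\lambda z,z^*\rangle\Big|\le k\big(\|y\|_X+\|z\|_X\big)\|y-z\|_X .$$ Then there exists $\alpha>0$ such that for every $\mu\in(0,\alpha)$ the feedback control $v(t)=-\mu\mathbf 1_{\{t\ge0:\ \mathcal By(t)\neq0\}}$ guarantees the exponential stabilization of the bilinear system $$\dot y(t)=Ay(t)+v(t)\mathcal By(t),\qquad y(0)=y_0\in X.$$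
   Context: $X$ is a Banach space and $A:D(A)\subset X\to X$ generates a $C_0$-semigroup of contractions $S(t)$ on $X$. $X_{-1}$ is the completion of $X$ for the norm $\|x\|_{-1}=\|(A-\eta I)^{-1}x\|_X$, for some (equivalently any) $\eta\in\rho(A)$. $S_{-1}(t)$ is the extension of $S(t)$ to a $C_0$-semigroup on $X_{-1}$, with generator $A_{-1}:X\subset X_{-1}\to X_{-1}$, which extends $A$. $R(\lambda,A_{-1})=(\lambda I-A_{-1})^{-1}$ maps $X_{-1}$ into $X$. For an operator $K$ with values in $X_{-1}$, $K|_X$ denotes its part in $X$. Duality map: for $y\in X$, $J(y)$ is the nonempty set of all $\phi\in X^*$ with $\langle y,\phi\rangle=\|y\|_X^2=\|\phi\|^2$. Closed-loop system: since $v(t)\mathcal By(t)=-\mu\mathcal By(t)$ for the given feedback, the closed-loop system is $\dot y=A_{-1}y-\mu\mathcal By$, $y(0)=y_0$. Exponential stabilization means that $(A_{-1}-\mu\mathcal B)|_X$, with domain $\{y\in X:(A_{-1}-\mu\mathcal B)y\in X\}$, generates a $C_0$-semigroup $(\mathcal T_\mu(t))_{t\ge0}$ on $X$ (the closed-loop mild solution being $y(t)=\mathcal T_\mu(t)y_0$) and there are constants $M',\sigma>0$ with $\|\mathcal T_\mu(t)y_0\|_X\le M'e^{-\sigma t}\|y_0\|_X$ for all $t\ge0$ and $y_0\in X$. Convention on integrals involving selections of $J$: the inequality is required for every selection $\phi$; if the integrand is not measurable, the integral is read as the upper Lebesgue integral (infimum of $\int g$ over integrable $g$ dominating the integrand a.e.).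 *)

(* Defs.v *)
From HB Require Import structures.
From mathcomp Require Import all_boot all_order all_algebra.
From mathcomp Require Import complex.
From mathcomp Require Import all_classical all_reals all_analysis.
From mathcomp Require Import measurable_realfun.
Set Implicit Arguments.
Unset Strict Implicit.
Unset Printing Implicit Defensive.
Import Order.TTheory GRing.Theory Num.Theory.
Import numFieldNormedType.Exports.
Local Open Scope classical_set_scope.
Local Open Scope ring_scope.

(* Real and complex Banach spaces are treated at once: the scalar field is R
   or R[i], according to k. *)
Variant scalar_kind := RealScalars | ComplexScalars.

Definition scalars (R : realType) (k : scalar_kind) : numFieldType :=
  match k with
  | RealScalars => R
  | ComplexScalars => R[i]
  end.

Definition re (R : realType) (k : scalar_kind) : scalars R k -> R :=
  match k with
  | RealScalars => fun z : R => z
  | ComplexScalars => fun z : R[i] => complex.Re z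
  end.

Definition ofR (R : realType) (k : scalar_kind) : R -> scalars R k :=
  match k with
  | RealScalars => fun x : R => x
  | ComplexScalars => fun x : R => real_complex R x
  end.
Arguments ofR {R} k x.

(* The norm of a normed module over [scalars R k] takes its values in
   [scalars R k]; [nrm] is the same norm as an element of [R]. *)
Definition nrm (R : realType) (k : scalar_kind)
  (Y : normedModType (scalars R k)) (y : Y) : R := re `|y|.

(* An unbounded operator from Y to Z, given by its graph. *)
Definition operator (Y Z : Type) := set (Y * Z).

Definition dom (Y Z : Type) (L : operator Y Z) : set Y :=
  [set y | exists z, L (y, z)].

Section semigroups.
Context (R : realType) (k : scalar_kind).
Notation K := (scalars R k).
Context (Y : normedModType K).

(* Only the values S t with 0 <= t are relevant. *)
Definition C0_semigroup (S : R -> Y -> Y) : Prop :=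
  [/\ forall t, 0 <= t -> linear (S t) /\ continuous (S t),
      forall y, S 0 y = y,
      forall s t, 0 <= s -> 0 <= t -> forall y, S (s + t) y = S s (S t y) &
      forall y, S t y @[t --> 0^'+] --> y].

Definition contractive (S : R -> Y -> Y) : Prop :=
  forall t y, 0 <= t -> nrm (S t y) <= nrm y.

Definition generator (S : R -> Y -> Y) : operator Y Y :=
  [set p | (ofR k h^-1 *: (S h p.1 - p.1)) @[h --> 0^'+] --> p.2].

Definition generates (A : operator Y Y) (S : R -> Y -> Y) : Prop :=
  C0_semigroup S /\ A = generator S.

Definition exponentially_stable (S : R -> Y -> Y) : Prop :=
  exists M sigma : R, [/\ 0 < M, 0 < sigma &
    forall t y, 0 <= t -> nrm (S t y) <= M * expR (- sigma * t) * nrm y].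

Definition resolvent_set (A : operator Y Y) : set K :=
  [set eta | (forall f, exists! y, A (y, eta *: y - f)) /\
     exists M : R, forall y z, A (y, z) -> nrm y <= M * nrm (eta *: y - z)].

(* (eta I - A)^-1 f for eta in the resolvent set of A, and 0 if
   (eta I - A) y = f has no solution. *)
Definition resolvent (A : operator Y Y) (eta : K) (f : Y) : Y :=
  xget 0 [set y | A (y, eta *: y - f)].

Definition dual_norm (phi : {linear Y -> K^o}) : R :=
  sup [set re `|phi y| | y in [set y : Y | nrm y <= 1]].

Definition duality_map (y : Y) : set {linear Y -> K^o} :=
  [set phi : {linear Y -> K^o} | [/\ continuous phi, phi y = ofR k (nrm y ^+ 2) &
                 nrm y ^+ 2 = dual_norm phi ^+ 2]].

End semigroups.

(* The completion is determined up to isometric isomorphism only: Xm1 is a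
   Banach space in which X embeds densely through j, the norm induced on X
   being |(A - eta I)^-1 x|. *)
Definition is_extrapolation_space (R : realType) (k : scalar_kind)
    (X Xm1 : completeNormedModType (scalars R k))
    (A : operator X X) (eta : scalars R k) (j : {linear X -> Xm1}) : Prop :=
  (forall x, nrm (j x) = nrm (- resolvent A eta x)) /\
  closure (range j) = setT.

Definition extends_semigroup (R : realType) (k : scalar_kind)
    (X Xm1 : normedModType (scalars R k)) (j : {linear X -> Xm1})
    (S : R -> X -> X) (Sm1 : R -> Xm1 -> Xm1) : Prop :=
  forall t x, 0 <= t -> Sm1 t (j x) = j (S t x).

Section control.
Context (R : realType) (k : scalar_kind).
Notation K := (scalars R k).
Context (X Xm1 : normedModType K) (j : {linear X -> Xm1}).

(* The element of X that j identifies with z, when z is in the range of j. *)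
Definition preim_X (z : Xm1) : X := xget 0 [set x | j x = z].

Definition part_in_X (L : operator X Xm1) : operator X X :=
  [set p | L (p.1, j p.2)].

Context (Am1 : operator Xm1 Xm1) (B : X -> Xm1).

(* A_{-1} + v B, for a scalar feedback law v depending on the state. *)
Definition closed_loop (v : X -> K) : operator X Xm1 :=
  [set p | Am1 (j p.1, p.2 - v p.1 *: B p.1)].

(* A_{-1} - mu B *)
Definition perturbed (mu : R) : operator X Xm1 :=
  [set p | Am1 (j p.1, p.2 + ofR k mu *: B p.1)].

Definition feedback (mu : R) (y : X) : K :=
  if B y == 0 then 0 else - ofR k mu.

Lemma closed_loop_feedback (mu : R) :
  closed_loop (feedback mu) = perturbed mu.
Proof.
rewrite /closed_loop /perturbed /feedback; apply/seteqP; split => -[y z] /=;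
  by have [->|_] := eqVneq (B y) 0; rewrite ?scaler0 ?scaleNr ?subr0 ?opprK ?addr0.
Qed.

Definition exponentially_stabilizes (v : X -> K) : Prop :=
  exists Tv : R -> X -> X,
    generates (part_in_X (closed_loop v)) Tv /\ exponentially_stable Tv.

(* lam R(lam, A_{-1}) B y, which belongs to X for lam > 0 when A_{-1} is the
   extrapolation of the generator of a contraction semigroup. *)
Definition B_ (lam : R) (y : X) : X :=
  ofR k lam *: preim_X (resolvent Am1 (ofR k lam) (B y)).

(* Extended-real valued: B_ lam y need not stay bounded in X. *)
Definition limsup_pairing (y : X) (phi : {linear X -> K^o}) : \bar R :=
  limf_esup (fun lam : R => (re (phi (B_ lam y)))%:E) (pinfty_nbhs R).

End control.

Section integrals.
Context (R : realType) d (T : measurableType d)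
  (mu : {measure set T -> \bar R}).

(* The upper Lebesgue integral: the infimum of the empty set is +oo. *)
Definition upper_integral (D : set T) (f : T -> \bar R) : \bar R :=
  ereal_inf [set (\int[mu]_(t in D) g t)%E | g in
    [set g : T -> \bar R | mu.-integrable D g /\
       {ae mu, forall t, D t -> (f t <= g t)%E}]].

Definition integral_or_upper (D : set T) (f : T -> \bar R) : \bar R :=
  if pselect (measurable_fun D f)
  then (\int[mu]_(t in D) f t)%E else upper_integral D f.

Context (k : scalar_kind) (Y : normedModType (scalars R k)).

(* sum_i 1_(piece i) value_i, the pieces being allowed to overlap *)
Record simple_fun := SimpleFun {
  npieces : nat;
  piece : 'I_npieces -> set T;
  value : 'I_npieces -> Y;
  piece_measurable : forall i, measurable (piece i);
  piece_finite : forall i, (mu (piece i) < +oo)%E }.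
Arguments piece : clear implicits.
Arguments value : clear implicits.

Definition simple_eval (s : simple_fun) (t : T) : Y :=
  \sum_(i < npieces s | t \in piece s i) value s i.

Definition simple_integral (D : set T) (s : simple_fun) : Y :=
  \sum_(i < npieces s) ofR k (fine (mu (piece s i `&` D))) *: value s i.

Definition ae_approx (D : set T) (f : T -> Y) (s : nat -> simple_fun) : Prop :=
  {ae mu, forall t, D t -> simple_eval (s n) t @[n --> \oo] --> f t}.

Definition bochner_L1 (D : set T) (f : T -> Y) : Prop :=
  (exists s, ae_approx D f s) /\
  (\int[mu]_(t in D) (nrm (f t))%:E < +oo)%E.

(* The Bochner integral; 0 if f is not Bochner integrable on D. *)
Definition bochner_integral (D : set T) (f : T -> Y) : Y :=
  xget 0 [set v | exists s, [/\ ae_approx D f s,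
    (\int[mu]_(t in D) (nrm (f t - simple_eval (s n) t))%:E)%E
      @[n --> \oo] --> 0%E &
    simple_integral D (s n) @[n --> \oo] --> v]].

End integrals.

(* Main.v *)
Require Import Defs.
From HB Require Import structures.
From mathcomp Require Import all_boot all_order all_algebra.
From mathcomp Require Import complex ring lra.
From mathcomp Require Import all_classical all_reals all_analysis.
From mathcomp Require Import measurable_realfun.
Set Implicit Arguments.
Unset Strict Implicit.
Unset Printing Implicit Defensive.
Import Order.TTheory GRing.Theory Num.Theory.
Import numFieldNormedType.Exports.
Local Open Scope classical_set_scope.
Local Open Scope ring_scope.

(** The proof replaces the extrapolation space by bounded operators on X, shows
   that the closed-loop operator is a generator, and then compares the energy
   of the closed-loop trajectories with the observation along the free ones.

   Reduction to X.  The resolvent (eta - A)^-1 extends to an isometry P from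
   X_{-1} into X that intertwines S_{-1} and S.  With b = P B and d = eta b, both
   bounded on X, one has B = d - A_{-1} b; the part of A_{-1} - mu B in X relates
   y to z when A relates y + mu b y to z + mu d y ([perturbed_part]), and B_l is
   given on X by [yosida_input] ([approximate_input]).  All estimates use only
   real linear functionals, so a complex space is regarded as a real one.  The
   functionals norming the vectors come from the duality map, which is
   nonempty.

   Favard estimate.  The admissibility hypothesis implies
   |S(t) b x - b x| <= K t |x| ([admissible_favard]).  Otherwise a gliding hump
   produces an integrable input that steers 0 to a state outside X.
   Consequently the operators B_l are bounded uniformly in l > 0.

   Generation.  By the same estimate the input map
   V(h) x = \int_0^h S(s) d x ds - (S(h) b x - b x), which is the integral of
   S_{-1}(s) B x over [0, h], is O(h) as an operator on X.  The steps S(h) - mu V(h),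
   iterated over dyadic subdivisions, converge to a semigroup U of type (1, w),
   with w = O(mu), at distance O(mu t) from S for bounded t.  The resolvent
   equation of A_{-1} - mu B is solved by a contraction argument, which identifies
   its part in X with the generator of U ([perturbed_semigroup]).

   Energy.  If y is in the domain of A_{-1} - mu B and phi is in J(y), the
   dissipativity of A gives
     Re <(A_{-1} - mu B) y, phi> <= - mu limsup Re <B_l y, phi>
   ([energy_rate]).  Half the squared norm has every such phi as a subgradient;
   the backward differences of the energy are therefore controlled with any
   selection of J along the trajectory.  The selections provided by the
   continuity hypothesis are compared with selections along S(t) y, at a cost
   O(mu) |y|^2, and for those the observability inequality applies.  Together
   with |U(T) y - S(T) y| = O(mu) |y| this yields
     (1 + mu delta) |U(T) y|^2 <= (1 + Z mu^2) |y|^2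
   ([contraction_factor]): for small mu the norm contracts over each period T,
   which gives the exponential decay ([small_gain_stability]). *)

(** * Real and complex scalars *)

Section scalar_theory.
Context (R : realType) (k : scalar_kind).
Notation K := (scalars R k).
Implicit Types (a b : R) (z w : K).

Lemma reK a : re (ofR k a) = a. Proof. by case: k. Qed.
Lemma reD z w : re (z + w) = re z + re w. Proof. by case: k z w => // -[a b] [c d]. Qed.
Lemma re_ofRM a z : re (ofR k a * z) = a * re z.
Proof. by case: k z => // -[c d] /=; rewrite mul0r subr0. Qed.
Lemma ofRD a b : ofR k (a + b) = ofR k a + ofR k b.
Proof. by case: k => //; rewrite /ofR rmorphD. Qed.
Lemma ofRM a b : ofR k (a * b) = ofR k a * ofR k b.
Proof. by case: k => //; rewrite /ofR rmorphM. Qed.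
Lemma ofR1 : ofR k (1 : R) = 1. Proof. by case: k => //; rewrite /ofR rmorph1. Qed.
Lemma ofR0 : ofR k (0 : R) = 0. Proof. by case: k => //; rewrite /ofR rmorph0. Qed.
Lemma ofRN a : ofR k (- a) = - ofR k a. Proof. by case: k => //; rewrite /ofR rmorphN. Qed.
Lemma ler_ofR a b : (ofR k a <= ofR k b) = (a <= b).
Proof. by case: k => //=; rewrite lecR. Qed.
Lemma ltr_ofR a b : (ofR k a < ofR k b) = (a < b).
Proof. by case: k => //=; rewrite ltcR. Qed.
Lemma normr_ofR a : `|ofR k a| = ofR k `|a|.
Proof.
have [a0|a0] := leP 0 a; first by rewrite !ger0_norm// -ofR0 ler_ofR.
by rewrite !ltr0_norm ?ofRN// -ofR0 ltr_ofR.
Qed.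
Lemma ofR_re z : 0 <= z -> ofR k (re z) = z.
Proof.
case: k z => //= -[a b]; rewrite lecE/= => /andP[/eqP -> _].
by [].
Qed.
Lemma re_norm z : `|re z| <= re `|z|.
Proof.
case: k z => //= -[a b].
suff: `|a| <= complex.Re (Num.norm (Complex a b : R[i])) by [].
by rewrite normc_def/= -sqrtr_sqr ler_wsqrtr// lerDl sqr_ge0.
Qed.

End scalar_theory.

Section nrm_theory.
Context (R : realType) (k : scalar_kind).
Context (Y : normedModType (scalars R k)).
Implicit Types (x y : Y).

Lemma ofR_nrm y : ofR k (nrm y) = `|y|.
Proof. exact: ofR_re. Qed.

Lemma nrmZ z y : nrm (z *: y) = re `|z| * nrm y.
Proof. by rewrite /nrm normrZ -{1}[`|z|]ofR_re// re_ofRM. Qed.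

End nrm_theory.

(** The real Banach space underlying Y, with the same uniform structure:
   limits and completeness do not notice the change of scalars, so that all
   the semigroup theory can be done over R. *)
Definition realify (R : realType) (k : scalar_kind)
  (Y : normedModType (scalars R k)) : Type := Y.

Section realification.
Context (R : realType) (k : scalar_kind).
Context (Y : normedModType (scalars R k)).
Notation Yr := (realify Y).

HB.instance Definition _ := GRing.Zmodule.on Yr.
HB.instance Definition _ := PointedUniform.on Yr.

Let scaleR (a : R) (y : Yr) : Yr := ofR k a *: (y : Y).

Let scaleRA a b v : scaleR a (scaleR b v) = scaleR (a * b) v.
Proof. by rewrite /scaleR scalerA ofRM. Qed.
Let scale1R : left_id 1 scaleR.
Proof. by move=> v; rewrite /scaleR ofR1 scale1r. Qed.
Let scaleRDr : right_distributive scaleR +%R.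
Proof. by move=> a u v; rewrite /scaleR scalerDr. Qed.
Let scaleRDl v : {morph scaleR^~ v : a b / a + b}.
Proof. by move=> a b; rewrite /scaleR ofRD scalerDl. Qed.

HB.instance Definition _ := GRing.Zmodule_isLmodule.Build R Yr
  scaleRA scale1R scaleRDr scaleRDl.

Let nrmr (y : Yr) : R := nrm (y : Y).

Let nrmrD x y : nrmr (x + y) <= nrmr x + nrmr y.
Proof. by rewrite -(ler_ofR k) ofRD !ofR_nrm ler_normD. Qed.
Let nrmr0_eq0 x : nrmr x = 0 -> x = 0.
Proof. by move=> x0; apply/eqP; rewrite -(normr_eq0 (x : Y)) -ofR_nrm [nrm _]x0 ofR0. Qed.
Let nrmrMn x n : nrmr (x *+ n) = nrmr x *+ n.
Proof.
rewrite /nrmr /nrm [`|_|]normrMn -(ofR_re (normr_ge0 (x : Y))).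
elim: n => [|n ih]; first by rewrite !mulr0n -ofR0 reK.
by rewrite !mulrS reD ih reK.
Qed.
Let nrmrN x : nrmr (- x) = nrmr x.
Proof. by rewrite /nrmr /nrm [`|_|]normrN. Qed.

HB.instance Definition _ := Num.Zmodule_isNormed.Build R Yr
  nrmrD nrmr0_eq0 nrmrMn nrmrN.

Let ballr (x : Yr) (e : R) : set Yr := ball_ (fun y : Yr => `|y|) x e.

Let ballr_center x (e : R) : 0 < e -> ballr x e x.
Proof. by move=> e0; rewrite /ballr /ball_ /= subrr normr0. Qed.
Let ballr_sym x y (e : R) : ballr x e y -> ballr y e x.
Proof. by rewrite /ballr /ball_ /= distrC. Qed.
Let ballr_triangle x y z e1 e2 :
  ballr x e1 y -> ballr y e2 z -> ballr x (e1 + e2) z.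
Proof.
rewrite /ballr /ball_ /= => h1 h2; rewrite -(subrKA y).
exact: le_lt_trans (ler_normD _ _) (ltrD h1 h2).
Qed.
(* The two families of balls are cofinal because a positive scalar of K is
   [ofR k] of a positive real. *)
Let entourager : entourage = entourage_ ballr.
Proof.
rewrite [LHS](_ : _ = @entourage Y)//.
rewrite -entourage_ballE; apply/seteqP; split => U [e /= e0 h].
  exists (re e) => /=; first by rewrite -(ltr_ofR k) ofR0 ofR_re// ltW.
  move=> [x y] /= xy; apply: h => /=; rewrite -ball_normE /ball_/=.
  by rewrite -ofR_nrm -(ofR_re (ltW e0)) ltr_ofR.
exists (ofR k e) => /=; first by rewrite -ofR0 ltr_ofR.
move=> [x y] /= xy; apply: h => /=; move: xy; rewrite -ball_normE /ball_/=.
by rewrite -ofR_nrm ltr_ofR.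
Qed.

HB.instance Definition _ := Uniform_isPseudoMetric.Build R Yr
  ballr_center ballr_sym ballr_triangle entourager.
HB.instance Definition _ := NormedZmod_PseudoMetric_eq.Build R Yr erefl.

Let nrmrZ (l : R) (x : Yr) : `| l *: x | = `| l | * `| x |.
Proof. by rewrite [LHS]nrmZ normr_ofR reK. Qed.

HB.instance Definition _ :=
  PseudoMetricNormedZmod_Lmodule_isNormedModule.Build R Yr nrmrZ.

End realification.

HB.instance Definition _ (R : realType) (k : scalar_kind)
  (Y : completeNormedModType (scalars R k)) := Complete.on (realify Y).

Lemma cauchy_seq_cvg (R : realType) (V : completeNormedModType R) (u : nat -> V) :
  (forall e, 0 < e -> exists N, forall m n, (N <= m)%N -> (N <= n)%N ->
    `|u m - u n| <= e) ->
  exists l : V, u n @[n --> \oo] --> l.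
Proof.
move=> h; have : cvg (u n @[n --> \oo]).
  apply: cauchy_cvg; apply: cauchy_exP => _/posnumP[e].
  have [|N hN] := h (e%:num / 2); first by rewrite divr_gt0.
  exists (u N), N => // n /= Nn; rewrite -ball_normE /ball_ /=.
  by apply: le_lt_trans (hN N n _ Nn) _ => //; rewrite gtr_pMr// invf_lt1// ltr1n.
by move=> cu; exists (lim (u n @[n --> \oo])).
Qed.

(** * Completed Lebesgue measure and primitives *)

Section completed_measure.
Context (R : realType).
Notation cmu := (@completed_lebesgue_measure R).
Notation mu := (@lebesgue_measure R).
Notation cT := (caratheodory_type (wlength (@idfun R))^*%mu).

Lemma completed_measurable (D : set R) :
  measurable (D : set (measurableTypeR R)) -> measurable (D : set cT).
Proof. by move=> mD; apply: sub_caratheodory. Qed.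

Let idm : cT -> measurableTypeR R := idfun.
Let midm : measurable_fun setT idm.
Proof. by move=> _ D mD; rewrite setTI; exact: completed_measurable. Qed.

Lemma completed_measurable_fun d (T : measurableType d) (D : set R) (f : R -> T) :
  measurable_fun (D : set (measurableTypeR R)) f ->
  measurable (D : set (measurableTypeR R)) -> measurable_fun (D : set cT) f.
Proof. by move=> mf mD _ E mE; apply: completed_measurable; exact: mf. Qed.

Let completed_integral_ge0 (D : set R) (f : R -> \bar R) :
  measurable (D : set (measurableTypeR R)) ->
  measurable_fun (D : set (measurableTypeR R)) f ->
  (forall x, 0 <= f x)%E ->
  (\int[cmu]_(x in D) f x = \int[mu]_(x in D) f x)%E.
Proof.
move=> mD mf f0.
have := ge0_integral_pushforward midm cmu mD mf (fun x _ => f0 x).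
rewrite preimage_id => <-.
by apply: eq_measure_integral => A mA _.
Qed.

(** The completed measure extends the Lebesgue measure, which is its image
   under the identity seen as a measurable map. *)
Lemma completed_integral (D : set R) (f : R -> \bar R) :
  measurable (D : set (measurableTypeR R)) ->
  measurable_fun (D : set (measurableTypeR R)) f ->
  (\int[cmu]_(x in D) f x = \int[mu]_(x in D) f x)%E.
Proof.
move=> mD mf; rewrite integralE [RHS]integralE.
rewrite !completed_integral_ge0//.
  exact: measurable_funeneg.
exact: measurable_funepos.
Qed.

Lemma completed_integrable (D : set R) (f : R -> \bar R) :
  measurable (D : set (measurableTypeR R)) ->
  mu.-integrable D f -> cmu.-integrable D f.
Proof.
move=> mD /integrableP[mf foo]; apply/integrableP; split.
  exact: completed_measurable_fun.
by rewrite completed_integral//; exact: measurableT_comp.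
Qed.

Lemma completed_itv (i : interval R) :
  (cmu [set` i] = if i.1 < i.2 then (i.2 : \bar R) - i.1 else 0)%E.
Proof. exact: lebesgue_measure_itv. Qed.

(** The fundamental theorem of calculus on a half line: the primitive is
   x |-> \int_a^x f, and its values at the two end points of a segment give the
   integral for the completed measure too. *)
Lemma continuous_primitive (f : R -> R) (a : R) : continuous f ->
  exists F : R -> R, (forall x, a < x -> is_derive x 1 F (f x)) /\
    forall x y, a < x -> x <= y ->
      (\int[cmu]_(t in `[x, y]) (f t)%:E = (F y - F x)%:E)%E.
Proof.
move=> cf; pose F x := (\int[mu]_(t in `[a, x]) (f t))%R.
have itg u v : mu.-integrable `[u, v] (EFin \o f).
  by apply: continuous_compact_integrable;
    [exact: segment_compact | exact: continuous_subspaceT].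
have dF x : a < x -> is_derive x 1 F (f x).
  move=> ax.
  have xx1 : x < x + 1 by rewrite ltrDl.
  have [dF Ff] := @continuous_FTC1_closed R f a x (x + 1) xx1
    (itg _ _) ax (cf x).
  by apply: DeriveDef; [exact: dF|rewrite -derive1E; exact: Ff].
exists F; split => // x y ax xy.
rewrite completed_integral//; last by have /integrableP[] := itg x y.
move: xy; rewrite le_eqVlt => /predU1P[->|xy].
  by rewrite set_itv1 integral_set1 subrr.
rewrite EFinB; apply: continuous_FTC2 => //.
- exact: continuous_subspaceT.
- have cF z : a < z -> {for z, continuous F}.
    by move=> /dF[dFz _]; apply: differentiable_continuous; exact/derivable1_diffP.
  split.
  + by move=> z /[!in_itv]/= /andP[xz _]; have [] := dF z (lt_trans ax xz).
  + by apply: cvg_at_right_filter; exact: cF.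
  + by apply: cvg_at_left_filter; apply: cF; exact: lt_trans xy.
- move=> z /[!in_itv]/= /andP[xz _]; rewrite derive1E.
  by apply: derive_val; apply: dF; exact: lt_trans xz.
Qed.

Lemma continuous_measurable_EFin (f : R -> R) (D : set R) : continuous f ->
  measurable_fun (D : set (measurableTypeR R)) (fun x => (f x)%:E).
Proof.
by move=> cf; apply/measurable_EFinP/measurable_funTS; exact: continuous_measurable_fun.
Qed.

Lemma completed_integral_oo (f : R -> R) (x y : R) : continuous f ->
  (\int[cmu]_(t in `]x, y[) (f t)%:E = \int[cmu]_(t in `[x, y]) (f t)%:E)%E.
Proof.
move=> cf; have mf D : measurable_fun (D : set (measurableTypeR R)) (EFin \o f).
  by apply/measurable_EFinP/measurable_funTS; exact: continuous_measurable_fun.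
rewrite !completed_integral// integral_itv_bndo_bndc; last exact: mf.
by rewrite integral_itv_obnd_cbnd//; exact: mf.
Qed.

Lemma completed_integral_co (f : R -> R) (x y : R) : continuous f ->
  (\int[cmu]_(t in `[x, y[) (f t)%:E = \int[cmu]_(t in `[x, y]) (f t)%:E)%E.
Proof.
move=> cf; have mf D : measurable_fun (D : set (measurableTypeR R)) (EFin \o f).
  by apply/measurable_EFinP/measurable_funTS; exact: continuous_measurable_fun.
by rewrite !completed_integral// integral_itv_bndo_bndc//; exact: mf.
Qed.

End completed_measure.

Section primitives.
Context (R : realType).

(** The mean value inequality; the slack of 1 around [0, t] makes the end points
   interior, so that two-sided derivatives can be used throughout. *)
Lemma increment_le_itv (H h : R -> R) (t m : R) : 0 <= t ->
  (forall s : R, - 1 < s < t + 1 -> is_derive s 1 H (h s)) ->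
  (forall s, 0 <= s <= t -> h s <= m) -> H t - H 0 <= t * m.
Proof.
move=> t0 dH hm.
have itv s : 0 <= s <= t -> - 1 < s < t + 1 by move=> ?; lra.
have [s||c] := @MVT_segment R H h 0 t t0.
- by rewrite in_itv/= => /andP[s0 st]; apply: dH; apply: itv; rewrite !ltW.
- apply: continuous_in_subspaceT => s; rewrite inE/= in_itv/= => /itv/dH[dHs _].
  by apply: differentiable_continuous; exact/derivable1_diffP.
by rewrite in_itv/= subr0 => /hm hc ->; rewrite mulrC ler_wpM2l.
Qed.

Lemma increment_le (H h : R -> R) (t m : R) : 0 <= t ->
  (forall s : R, - 1 < s -> is_derive s 1 H (h s)) ->
  (forall s, 0 <= s <= t -> h s <= m) -> H t - H 0 <= t * m.
Proof.
by move=> t0 dH; apply: increment_le_itv => // s /andP[s1 _]; exact: dH.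
Qed.

Lemma increment_eq (F G f g : R -> R) (t : R) : 0 <= t ->
  (forall s : R, - 1 < s -> is_derive s 1 F (f s)) ->
  (forall s : R, - 1 < s -> is_derive s 1 G (g s)) ->
  (forall s, 0 <= s -> f s = g s) -> F t - F 0 = G t - G 0.
Proof.
have aux (P Q p q : R -> R) : 0 <= t ->
    (forall s : R, - 1 < s -> is_derive s 1 P (p s)) ->
    (forall s : R, - 1 < s -> is_derive s 1 Q (q s)) ->
    (forall s, 0 <= s -> p s = q s) -> P t - P 0 <= Q t - Q 0.
  move=> t0 dP dQ pq; have : (P - Q) t - (P - Q) 0 <= t * 0.
    apply: (increment_le (h := fun s => p s - q s)) => // [s s1|s /andP[s0 _]].
      by apply: is_deriveB; [exact: dP|exact: dQ].
    by rewrite pq// subrr.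
  by rewrite !fctE mulr0; lra.
move=> t0 dF dG fg; apply/eqP; rewrite eq_le !(aux _ _ _ _ t0 dF dG, aux _ _ _ _ t0 dG dF)//
  => s s0.
by rewrite fg.
Qed.

Lemma is_derive_shiftr (H : R -> R) (a s d : R) :
  is_derive (a + s) 1 H d -> is_derive s 1 (fun s => H (a + s)) d.
Proof.
move=> dH; have -> : (fun s => H (a + s)) = H \o shift a.
  by apply/funext => u /=; rewrite addrC.
rewrite -[d]mulr1; apply: is_derive1_comp; last exact: is_derive_shift.
by rewrite /= addrC.
Qed.

Lemma is_derive_reflect (H : R -> R) (a s d : R) :
  is_derive (a - s) 1 H d -> is_derive s 1 (fun s => H (a - s)) (- d).
Proof.
move=> dH; have -> : (fun s => H (a - s)) = H \o (cst a - id) by [].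
have -> : - d = d * (0 - 1) by rewrite sub0r mulrN1.
by apply: is_derive1_comp; apply: is_deriveB.
Qed.

End primitives.

(** * Norming functionals and the Bochner integral *)

Section functionals.
Context (R : realType) (V : normedModType R).

Definition unit_functional (psi : V -> R) : Prop :=
  (forall a x y, psi (a *: x + y) = a * psi x + psi y) /\
  (forall x, `|psi x| <= `|x|).

(** What the Hahn--Banach theorem would give; here it comes from the duality
   map being nonempty. *)
Definition has_norming_functionals : Prop :=
  forall x, exists2 psi, unit_functional psi & psi x = `|x|.

Variable psi : V -> R.
Hypothesis hpsi : unit_functional psi.

Lemma functional_le x : psi x <= `|x|.
Proof. exact: le_trans (ler_norm _) (hpsi.2 x). Qed.
Lemma functional0 : psi 0 = 0.
Proof. by apply/eqP; rewrite -normr_le0; have := hpsi.2 0; rewrite normr0. Qed.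
Lemma functionalD x y : psi (x + y) = psi x + psi y.
Proof. by rewrite -[x in LHS]scale1r hpsi.1 mul1r. Qed.
Lemma functionalZ a x : psi (a *: x) = a * psi x.
Proof. by rewrite -[a *: x]addr0 hpsi.1 functional0 addr0. Qed.
Lemma functionalN x : psi (- x) = - psi x.
Proof. by rewrite -scaleN1r functionalZ mulN1r. Qed.
Lemma functionalB x y : psi (x - y) = psi x - psi y.
Proof. by rewrite functionalD functionalN. Qed.
Lemma functional_sum (I : Type) (r : seq I) (P : pred I) (F : I -> V) :
  psi (\sum_(i <- r | P i) F i) = \sum_(i <- r | P i) psi (F i).
Proof. by apply: big_morph; [exact: functionalD | exact: functional0]. Qed.

Lemma functional_cvg (T : Type) (F : set_system T) (FF : Filter F)
  (f : T -> V) (l : V) : f x @[x --> F] --> l -> psi (f x) @[x --> F] --> psi l.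
Proof.
move=> /cvgrPdist_lt fl; apply/cvgrPdist_lt => e e0.
have := fl e e0; apply: filterS => x; apply: le_lt_trans.
by rewrite -functionalB; exact: hpsi.2.
Qed.

End functionals.

Lemma norming_eq (R : realType) (V : normedModType R) (x y : V) :
  has_norming_functionals V ->
  (forall psi : V -> R, unit_functional psi -> psi x = psi y) -> x = y.
Proof.
move=> nV h; apply/eqP; rewrite -subr_eq0 -normr_eq0; apply/eqP.
have [psi psiu <-] := nV (x - y).
by rewrite (functionalB psiu) h// subrr.
Qed.

Lemma norming_le (R : realType) (V : normedModType R) (x : V) (c : R) :
  has_norming_functionals V ->
  (forall psi : V -> R, unit_functional psi -> psi x <= c) -> `|x| <= c.
Proof. by move=> nV h; have [psi psiu <-] := nV x; exact: h. Qed.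

Section bochner.
Context (R : realType) d (T : measurableType d)
  (mu : {measure set T -> \bar R}).
Context (k : scalar_kind) (Y : normedModType (scalars R k)).
Notation Yr := (realify Y).
Notation simple := (simple_fun mu Y).
Implicit Types (s : simple) (D : set T) (f : T -> Y).

Let atom s (I : {set 'I_(npieces s)}) : set T :=
  \big[setI/setT]_(i < npieces s)
    (if i \in I then piece i else ~` piece i).

Let pieces_at s t : {set 'I_(npieces s)} := [set i | t \in piece i]%SET.

Let atomP s I t : atom I t <-> pieces_at s t = I.
Proof.
rewrite /atom -bigcap_seq; split=> [h|<- i _ /=].
  apply/setP => i; rewrite inE; have := h i (mem_index_enum i).
  by case: (i \in I) => /= hi; [rewrite mem_set | rewrite memNset].
by rewrite inE; case: (boolP (t \in piece i)) => /= [|/negP ni hi];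
  [rewrite inE | apply: ni; rewrite inE].
Qed.

Let measurable_atom s I : measurable (@atom s I).
Proof.
apply: bigsetI_measurable => i _; case: ifP => _; last apply: measurableC;
exact: piece_measurable.
Qed.

Lemma simple_evalE s t : simple_eval s t = \sum_(i in pieces_at s t) value i.
Proof. by apply: eq_bigl => i; rewrite inE. Qed.

(** A simple function factors through a finite set. *)
Lemma measurable_simple_eval s D (h : Y -> R) :
  measurable_fun D (fun t => h (simple_eval s t)).
Proof.
pose g t := \sum_(I : {set 'I_(npieces s)})
  h (\sum_(i in I) value i) * \1_(@atom s I) t.
rewrite (_ : (fun t => _) = g); last first.
  apply/funext => t; rewrite /g (bigD1 (pieces_at s t))//= [X in _ + X]big1 ?addr0 => [|I It].
    rewrite indicE mem_set; last exact/atomP.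
    by rewrite [LHS]/= simple_evalE mulr1.
  rewrite indicE memNset ?mulr0// => /atomP tI.
  by rewrite tI eqxx in It.
by apply: measurable_sum => I; exact: measurable_funM.
Qed.

Lemma functional_simple_eval s (psi : Yr -> R) : unit_functional psi ->
  (fun t => psi (simple_eval s t)) =
  fun t => \sum_(i < npieces s) psi (value i : Yr) * \1_(piece i) t.
Proof.
move=> hpsi; apply/funext => t; rewrite (functional_sum hpsi) big_mkcond.
by apply: eq_bigr => i _; rewrite indicE; case: ifP; rewrite ?mulr1 ?mulr0.
Qed.

Lemma integrable_functional_simple s D (psi : Yr -> R) :
  measurable D -> unit_functional psi ->
  mu.-integrable D (fun t => (psi (simple_eval s t))%:E).
Proof.
move=> mD hpsi; have -> : (fun t => (psi (simple_eval s t))%:E) =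
    fun t => (\sum_(i < npieces s) (psi (value i : Yr))%:E * (\1_(piece i) t)%:E)%E.
  apply/funext => t; have /(congr1 (@^~ t)) /= -> := functional_simple_eval s hpsi.
  by rewrite -sumEFin.
apply: integrable_sum => // i _; apply: integrableZl => //.
apply: (integrableS measurableT) => //.
apply/integrableP; split; first exact/measurable_EFinP/measurable_indic/piece_measurable.
under eq_integral do rewrite gee0_abs ?lee_fin//.
by rewrite integral_indic ?setIT ?piece_finite//; exact: piece_measurable.
Qed.

Lemma integral_functional_simple s D (psi : Yr -> R) :
  measurable D -> unit_functional psi ->
  (\int[mu]_(t in D) (psi (simple_eval s t))%:E =
   (psi (simple_integral D s : Yr))%:E)%E.
Proof.
move=> mD hpsi; have -> : (fun t => (psi (simple_eval s t))%:E) =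
    fun t => (\sum_(i < npieces s) (psi (value i : Yr))%:E * (\1_(piece i) t)%:E)%E.
  apply/funext => t; have /(congr1 (@^~ t)) /= -> := functional_simple_eval s hpsi.
  by rewrite -sumEFin.
have int1 i : mu.-integrable D (fun t => (\1_(@piece _ _ _ _ _ _ s i) t)%:E).
  apply: (integrableS measurableT) => //.
  apply/integrableP; split; first exact/measurable_EFinP/measurable_indic/piece_measurable.
  under eq_integral do rewrite gee0_abs ?lee_fin//.
  by rewrite integral_indic ?setIT ?piece_finite//; exact: piece_measurable.
rewrite integral_sum//; last by move=> i; exact: integrableZl.
rewrite (functional_sum hpsi) -sumEFin; apply: eq_bigr => i _.
rewrite integralZl// integral_indic//; last exact: piece_measurable.
rewrite (functionalZ hpsi) mulrC EFinM fineK// ge0_fin_numE//.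
apply: (le_lt_trans _ (piece_finite i)).
by apply: le_measure => //; rewrite ?inE//; [apply: measurableI => //|]; exact: piece_measurable.
Qed.

Definition simple_sub (s s' : simple) : simple :=
  @SimpleFun _ _ _ mu _ Y (npieces s + npieces s')
    (fun i => match fintype.split i with inl i => piece i | inr i => piece i end)
    (fun i => match fintype.split i with inl i => value i | inr i => - value i end)
    (fun i => match fintype.split i as u
        return measurable (match u with inl i => piece i | inr i => piece i end) with
      inl i => piece_measurable i | inr i => piece_measurable i end)
    (fun i => match fintype.split i as u
        return (mu (match u with inl i => piece i | inr i => piece i end) < +oo)%E with
      inl i => piece_finite i | inr i => piece_finite i end).

Lemma simple_eval_sub s s' t :
  simple_eval (simple_sub s s') t = simple_eval s t - simple_eval s' t.
Proof.
rewrite /simple_eval/= big_mkcond big_split_ord/= [in RHS]big_mkcond -sumrN.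
rewrite [X in _ = _ + X]big_mkcond/=; congr (_ + _); apply: eq_bigr => i _.
  by rewrite -[lshift _ i]/(unsplit (inl i)) unsplitK.
by rewrite -[rshift _ i]/(unsplit (inr i)) unsplitK; case: ifP; rewrite ?oppr0.
Qed.

Lemma simple_integral_sub s s' D :
  simple_integral D (simple_sub s s') = simple_integral D s - simple_integral D s'.
Proof.
rewrite /simple_integral/= big_split_ord/= -sumrN; congr (_ + _); apply: eq_bigr => i _.
  by rewrite -[lshift _ i]/(unsplit (inl i)) unsplitK.
by rewrite -[rshift _ i]/(unsplit (inr i)) unsplitK scalerN.
Qed.

(** No pairing of the pieces is needed: a norming functional turns the vector
   inequality into the triangle inequality for a scalar integral. *)
Lemma simple_integral_le s D : measurable D -> has_norming_functionals Yr ->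
  ((`|simple_integral D s : Yr|)%:E <=
   \int[mu]_(t in D) (nrm (simple_eval s t))%:E)%E.
Proof.
move=> mD nY; have [psi hpsi <-] := nY (simple_integral D s : Yr).
rewrite -integral_functional_simple//; apply: le_trans (lee_abs _) _.
apply: le_trans (le_abse_integral _ mD _) _.
  by have /integrableP[] := @integrable_functional_simple s D psi mD hpsi.
apply: ge0_le_integral => //.
- by apply: measurableT_comp => //; exact/measurable_EFinP/measurable_simple_eval.
- exact/measurable_EFinP/measurable_simple_eval.
- by move=> t _; rewrite lee_fin; exact: hpsi.2.
Qed.

(** Everywhere approximation by simple functions is stable under the change of
   null sets and yields measurability without appealing to the completeness
   of the measure. *)
Definition simple_approx (s : nat -> simple) D f : Prop :=
  forall t, D t -> (simple_eval (s n) t : Yr) @[n --> \oo] --> (f t : Yr).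

Lemma approx_measurable D f (s : nat -> simple) s' : simple_approx s D f ->
  measurable_fun D (fun t => nrm (f t - simple_eval s' t)).
Proof.
move=> fs; apply: (@measurable_fun_cvg _ _ _ D
    (fun n t => nrm (simple_eval (simple_sub (s n) s') t))) => [n|t Dt].
  exact: measurable_simple_eval.
apply: (@cvg_norm _ Yr); under eq_fun do rewrite simple_eval_sub.
by apply: (@cvgB _ Yr) => //; [exact: fs | exact: cvg_cst].
Qed.

Lemma approx_measurable_nrm D f (s : nat -> simple) : simple_approx s D f ->
  measurable_fun D (fun t => nrm (f t)).
Proof.
move=> fs; apply: (@measurable_fun_cvg _ _ _ D
    (fun n t => nrm (simple_eval (s n) t))) => [n|t Dt].
  exact: measurable_simple_eval.
by apply: (@cvg_norm _ Yr); exact: fs.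
Qed.

Lemma approx_measurable_functional D f (s : nat -> simple) (psi : Yr -> R) : unit_functional psi ->
  simple_approx s D f -> measurable_fun D (fun t => psi (f t : Yr)).
Proof.
move=> hpsi fs; apply: (@measurable_fun_cvg _ _ _ D
    (fun n t => psi (simple_eval (s n) t))) => [n|t Dt].
  exact: measurable_simple_eval.
by apply: (functional_cvg hpsi); exact: fs.
Qed.

(** [s] cut off where it exceeds twice [f]. *)
Section truncation.
Variables (D : set T) (f : T -> Y) (s : simple).
Hypothesis mf : measurable_fun D (fun t => nrm (f t)).
Hypothesis mD : measurable D.

Let small : set T :=
  D `&` [set t | 0 <= 2 * nrm (f t) - nrm (simple_eval s t)].

Let msmall : measurable small.
Proof.
have mg : measurable_fun D (fun t => 2 * nrm (f t) - nrm (simple_eval s t)).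
  by apply: measurable_funB; [exact: measurable_funM|exact: measurable_simple_eval].
have := mg mD _ (measurable_itv `[0, +oo[).
congr (measurable (_ `&` _)).
by apply/seteqP; split => t /=; rewrite in_itv/= andbT.
Qed.

Definition truncate : simple :=
  @SimpleFun _ _ _ mu _ Y (npieces s) (fun i => piece i `&` small) (@value _ _ _ _ _ _ s)
    (fun i => measurableI _ _ (piece_measurable i) msmall)
    (fun i => le_lt_trans (le_measure mu
       (mem_set (measurableI _ _ (piece_measurable i) msmall))
       (mem_set (piece_measurable i)) (@subIsetl _ _ _)) (piece_finite i)).

Lemma truncateE t : D t -> simple_eval truncate t =
  if nrm (simple_eval s t) <= 2 * nrm (f t) then simple_eval s t else 0.
Proof.
move=> Dt; rewrite -subr_ge0; case: ifPn => h.
  by apply: eq_bigl => i /=; rewrite in_setI andb_idr// => _; rewrite mem_set.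
rewrite /simple_eval big1// => i /=; rewrite in_setI => /andP[_].
by rewrite inE => -[_ /= h']; rewrite h' in h.
Qed.

End truncation.

(** The relation that [bochner_integral] selects a value of. *)
Definition is_bochner D f (v : Y) : Prop := exists s : nat -> simple, [/\ ae_approx D f s,
  (\int[mu]_(t in D) (nrm (f t - simple_eval (s n) t))%:E)%E
    @[n --> \oo] --> 0%E &
  simple_integral D (s n) @[n --> \oo] --> v].

Lemma bochner_integralP D f : (exists v, is_bochner D f v) ->
  is_bochner D f (bochner_integral mu D f).
Proof. by move=> [v hv]; rewrite /bochner_integral; case: xgetP => [w -> //|/(_ v)]. Qed.

(** Bounded functionals commute with the Bochner integral, since they do so on
   simple functions and the error is bounded by the L^1 distance.  As the
   functionals separate points, this is the only property of the integral used
   below. *)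
Lemma is_bochner_functional D f (s : nat -> simple) v (psi : Yr -> R) :
  measurable D -> simple_approx s D f ->
  (\int[mu]_(t in D) (nrm (f t))%:E < +oo)%E -> is_bochner D f v ->
  unit_functional psi ->
  mu.-integrable D (fun t => (psi (f t : Yr))%:E) /\
  (\int[mu]_(t in D) (psi (f t : Yr))%:E = (psi (v : Yr))%:E)%E.
Proof.
move=> mD fs foo [s' [_ s'f s'v]] hpsi.
have mpsif := approx_measurable_functional hpsi fs.
have intf : mu.-integrable D (fun t => (psi (f t : Yr))%:E).
  apply/integrableP; split; first exact/measurable_EFinP.
  apply: le_lt_trans foo; apply: ge0_le_integral => //.
  - by apply: measurableT_comp => //; exact/measurable_EFinP.
  - exact/measurable_EFinP/(approx_measurable_nrm fs).
  - by move=> t _; rewrite lee_fin; exact: hpsi.2.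
split => //.
set u := (\int[mu]_(t in D) _)%E; have ufin : u \is a fin_num.
  exact: integrable_fin_num.
have le_u n : (`|u - (psi (simple_integral D (s' n) : Yr))%:E| <=
    \int[mu]_(t in D) (nrm (f t - simple_eval (s' n) t))%:E)%E.
  rewrite -integral_functional_simple// -integralB//; last first.
    exact: integrable_functional_simple.
  apply: le_trans (le_abse_integral _ mD _) _.
    apply: emeasurable_funB; first by have /integrableP[] := intf.
    by have /integrableP[] := @integrable_functional_simple (s' n) D psi mD hpsi.
  apply: ge0_le_integral => //.
  - apply: measurableT_comp => //; apply: emeasurable_funB.
      by have /integrableP[] := intf.
    by have /integrableP[] := @integrable_functional_simple (s' n) D psi mD hpsi.
  - by apply/measurable_EFinP; exact: approx_measurable fs.
  - move=> t _ /=; rewrite lee_fin -(functionalB hpsi); exact: hpsi.2.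
have : (psi (simple_integral D (s' n) : Yr))%:E @[n --> \oo] --> u.
  apply: (sube_cvg0 _ _).1 => //; apply/cvg_abse0P.
  apply: squeeze_cvge (cvg_cst 0%E) s'f; apply: nearW => n.
  rewrite abse_ge0/=; have := le_u n.
  by rewrite -(fineK ufin) /= distrC.
have : (psi (simple_integral D (s' n) : Yr))%:E @[n --> \oo] --> (psi (v : Yr))%:E.
  apply: cvg_EFin; first exact: nearW.
  exact: (@functional_cvg _ Yr psi hpsi _ _ _
    (fun n => simple_integral D (s' n) : Yr) v s'v).
move=> /cvg_lim <- // /cvg_lim <- //.
Qed.

End bochner.

Section bochner_existence.
Context (R : realType) d (T : measurableType d)
  (mu : {measure set T -> \bar R}).
Context (k : scalar_kind) (Y : completeNormedModType (scalars R k)).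
Notation Yr := (realify Y).
Notation simple := (simple_fun mu Y).

(** Strongly measurable functions with integrable norm have a Bochner
   integral: cutting the approximants off at twice the function makes them
   dominated, and dominated convergence applies. *)
Lemma bochner_exists (D : set T) (f : T -> Y) (s : nat -> simple) :
  has_norming_functionals Yr ->
  measurable D -> simple_approx s D f ->
  (\int[mu]_(t in D) (nrm (f t))%:E < +oo)%E ->
  exists v, is_bochner mu D f v.
Proof.
move=> nY mD fs foo.
have mf := approx_measurable_nrm fs.
pose s' n := truncate (s n) mf mD.
have s'E n t : D t -> simple_eval (s' n) t =
    if nrm (simple_eval (s n) t) <= 2 * nrm (f t) then simple_eval (s n) t else 0.
  exact: truncateE.
have fs' : simple_approx s' D f.
  move=> t Dt; have [f0|f0] := eqVneq (f t) 0.
    apply/(@cvgrPdist_lt R Yr) => e e0; apply: nearW => n.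
    rewrite s'E// f0; case: ifPn => [|_]; last by rewrite subrr normr0.
    by rewrite [nrm 0](@normr0 R Yr) mulr0 (@normr_le0 R Yr) => /eqP ->; rewrite subrr normr0.
  apply: (@cvg_trans _ (simple_eval (s n) t @[n --> \oo])); last exact: fs.
  apply: near_eq_cvg.
  have nf0 : 0 < nrm (f t) by rewrite (@normr_gt0 R Yr).
  have : nrm (simple_eval (s n) t) @[n --> \oo] --> nrm (f t).
    by apply: (@cvg_norm _ Yr); exact: fs.
  move=> /cvgr_lt /(_ (2 * nrm (f t))) H.
  have /H : nrm (f t) < 2 * nrm (f t) by lra.
  by apply: filterS => n /ltW h; rewrite s'E// h.
have s'f n t : D t -> nrm (f t - simple_eval (s' n) t) <= 3 * nrm (f t).
  move=> Dt; apply: le_trans (@ler_normB R Yr _ _) _.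
  have -> : 3 * nrm (f t) = nrm (f t) + 2 * nrm (f t) by ring.
  rewrite lerD2l s'E//; case: ifP => // _.
  by rewrite (@normr0 R Yr) mulr_ge0//; exact: (@normr_ge0 R Yr).
have nf_int : mu.-integrable D (fun t => (nrm (f t))%:E).
  apply/integrableP; split; first exact/measurable_EFinP.
  apply: le_lt_trans foo; apply: ge0_le_integral => //.
  - by apply: measurableT_comp => //; exact/measurable_EFinP.
  - exact/measurable_EFinP.
  - by move=> t _; rewrite gee0_abs// lee_fin; exact: (@normr_ge0 R Yr).
have L1 : (\int[mu]_(t in D) (nrm (f t - simple_eval (s' n) t))%:E)%E
    @[n --> \oo] --> 0%E.
  have [] := @dominated_convergence _ _ _ mu D mD
    (fun n t => (nrm (f t - simple_eval (s' n) t))%:E) (cst 0%E)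
    (fun t => 3%:E * (nrm (f t))%:E)%E.
  - by move=> n; apply/measurable_EFinP; exact: approx_measurable fs.
  - exact: measurable_cst.
  - apply: aeW => t Dt.
    have : nrm (f t - simple_eval (s' n) t) @[n --> \oo] --> nrm (f t - f t).
      by apply: (@cvg_norm _ Yr); apply: (@cvgB _ Yr); [exact: cvg_cst|exact: fs'].
    rewrite subrr [nrm 0](@normr0 R Yr) => h.
    by apply: cvg_EFin; [exact: nearW|exact: h].
  - exact: integrableZl.
  - apply: aeW => t Dt n; rewrite -EFinM gee0_abs ?lee_fin ?s'f//.
    exact: (@normr_ge0 R Yr).
  by move=> _ _; rewrite integral0.
have [v hv] : exists v : Yr, simple_integral D (s' n) @[n --> \oo] --> v.
  apply: cauchy_seq_cvg => e e0.
  have e2 : (0 < (e / 2)%:E)%E by rewrite lte_fin divr_gt0.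
  have [N _ hN] : \forall n \near \oo,
      (\int[mu]_(t in D) (nrm (f t - simple_eval (s' n) t))%:E < (e / 2)%:E)%E.
    exact: L1 _ (open_ereal_lt' e2).
  exists N => m n Nm Nn.
  rewrite -lee_fin -[X in `|X|]simple_integral_sub.
  apply: le_trans (simple_integral_le _ mD nY) _.
  apply: (@le_trans _ _ (\int[mu]_(t in D) ((nrm (f t - simple_eval (s' m) t))%:E
    + (nrm (f t - simple_eval (s' n) t))%:E))%E).
    apply: ge0_le_integral => //.
    - by move=> t _; rewrite lee_fin; exact: (@normr_ge0 R Yr).
    - exact/measurable_EFinP/measurable_simple_eval.
    - by apply: emeasurable_funD; apply/measurable_EFinP; exact: approx_measurable fs.
    - move=> t Dt; rewrite -EFinD lee_fin simple_eval_sub.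
      have -> : simple_eval (s' m) t - simple_eval (s' n) t =
        (f t - simple_eval (s' n) t) - (f t - simple_eval (s' m) t).
        by rewrite opprB [RHS]addrC subrKA.
      by rewrite [leRHS]addrC; exact: (@ler_normB R Yr).
  rewrite ge0_integralD//.
  - by rewrite [e]splitr EFinD; apply: leeD; apply/ltW/hN.
  - by move=> t _; rewrite lee_fin; exact: (@normr_ge0 R Yr).
  - by apply/measurable_EFinP; exact: approx_measurable fs.
  - by move=> t _; rewrite lee_fin; exact: (@normr_ge0 R Yr).
  - by apply/measurable_EFinP; exact: approx_measurable fs.
exists v, s'; split => //.
by exists set0; split => // t /= /not_implyP[Dt]; case; exact: fs'.
Qed.

End bochner_existence.

Section right_continuous.
Context (R : realType) (k : scalar_kind) (Y : normedModType (scalars R k)).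
Notation cmu := (@completed_lebesgue_measure R).

Section steps.
Variables (T : R) (f : R -> Y) (n : nat).

Let node (i : nat) : R := T * i%:R / n.+1%:R.

Let measurable_step (i : 'I_n.+1) :
  measurable (`[node i, node i.+1[%classic : set (caratheodory_type (wlength (@idfun R))^*%mu)).
Proof. by apply: completed_measurable; exact: measurable_itv. Qed.

Let finite_step (i : 'I_n.+1) : (cmu `[node i, node i.+1[%classic < +oo)%E.
Proof. by rewrite completed_itv/=; case: ifP => _ //; rewrite -EFinB ltry. Qed.

(** The value is taken at the right end point: right continuity is what makes
   these step functions converge. *)
Definition step_fun : simple_fun cmu Y :=
  SimpleFun (fun i => f (node i.+1)) measurable_step finite_step.

Lemma step_funE t : 0 < T -> 0 <= t < T ->
  simple_eval step_fun t = f (node (Num.truncn (t * n.+1%:R / T)).+1).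
Proof.
move=> T0 /andP[t0 tT]; set m := Num.truncn _.
have n0 : 0 < n.+1%:R :> R by rewrite ltr0n.
have x0 : 0 <= t * n.+1%:R / T by rewrite !mulr_ge0// invr_ge0 ltW.
have /andP[mx xm] := truncn_itv x0.
have inP (i : nat) : (node i <= t < node i.+1) = (i == m).
  rewrite /node ler_pdivrMr// ltr_pdivlMr// mulrC [T * _.+1%:R]mulrC.
  rewrite -ler_pdivlMr// -ltr_pdivrMr// -/m.
  apply/idP/eqP => [/andP[i1 i2]|->]; last exact/andP.
  by apply/eqP; rewrite eqn_leq -[(i <= m)%N]ltnS -[(m <= i)%N]ltnS
    -!(ltr_nat R) (le_lt_trans i1 xm) (le_lt_trans mx i2).
have mn : (m < n.+1)%N.
  by rewrite -(ltr_nat R); apply: le_lt_trans mx _; rewrite ltr_pdivrMr// mulrC ltr_pM2l.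
rewrite /simple_eval (big_pred1 (Ordinal mn))// => i /=.
by rewrite mem_setE/= in_itv/= inP.
Qed.

End steps.

(** At any t, the right end points of the cells containing t decrease to t. *)
Lemma right_continuous_approx (T : R) (f : R -> Y) : 0 < T ->
  (forall s, 0 < s < T -> f r @[r --> s^'+] --> f s) ->
  exists s : nat -> simple_fun cmu Y, simple_approx s `]0, T[%classic f.
Proof.
move=> T0 cf; exists (step_fun T f) => t /=; rewrite in_itv/= => tT.
have /andP[t0 t1] := tT.
pose r n := T * (Num.truncn (t * n.+1%:R / T)).+1%:R / n.+1%:R.
have n0 n : 0 < n.+1%:R :> R by rewrite ltr0n.
have rP n : t < r n <= t + T / n.+1%:R.
  have x0 : 0 <= t * n.+1%:R / T by rewrite !mulr_ge0// ?invr_ge0 ltW.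
  have /andP[mx xm] := truncn_itv x0.
  rewrite /r ltr_pdivlMr// mulrC [T * _]mulrC -ltr_pdivrMr// mulrC xm/=.
  rewrite ler_pdivrMr// mulrDl divfK ?gt_eqF// -ler_pdivlMr// mulrDl divff ?gt_eqF//.
  by rewrite -natr1 lerD2r.
have cr : r n @[n --> \oo] --> t.
  have h : t + T * n.+1%:R^-1 @[n --> \oo] --> t.
    rewrite -[X in _ --> X]addr0 -[X in _ --> _ + X](mulr0 T).
    by apply: cvgD; [exact: cvg_cst|apply: cvgM; [exact: cvg_cst|exact: cvg_harmonic]].
  apply: (squeeze_cvgr _ (cvg_cst t) h).
  by apply: nearW => n; have /andP[/ltW-> ->] := rP n.
have -> : (fun n => simple_eval (step_fun T f n) t) = f \o r.
  by apply/funext => n; rewrite step_funE ?(ltW t0)//=.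
move=> A /(cf t tT) fA.
have H : \forall n \near \oo, t < r n -> A (f (r n)) := cr _ fA.
have : \forall n \near \oo, A (f (r n)).
  by apply: filterS H => n; apply; have /andP[] := rP n.
by [].
Qed.

End right_continuous.

(** * Contraction semigroups and orbit integrals *)

Section at_zero.
Context (R : realType) (V : normedModType R).

Lemma cvg_at0P (f : R -> V) (l : V) : f h @[h --> 0^'+] --> l <->
  forall e, 0 < e -> exists d, 0 < d /\ forall h, 0 < h < d -> `|f h - l| <= e.
Proof.
split=> [/cvgrPdist_le fl e e0|fl].
  have [d /= d0 hd] := fl e e0; exists d; split => // h /andP[h0 hd'].
  rewrite distrC; apply: hd => //=.
  by rewrite distrC subr0 gtr0_norm.
apply/cvgrPdist_le => e e0; have [d [d0 hd]] := fl e e0.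
exists d => //= h /=; rewrite distrC subr0 => hd' h0.
by rewrite distrC; apply: hd; rewrite h0 -[h]gtr0_norm.
Qed.

Lemma cvg_at0_unique (f : R -> V) (l m : V) :
  f h @[h --> 0^'+] --> l -> f h @[h --> 0^'+] --> m -> l = m.
Proof. exact: cvg_unique. Qed.

Lemma cvg_at0_eq (f g : R -> V) (l : V) : (forall h, 0 < h -> f h = g h) ->
  f h @[h --> 0^'+] --> l -> g h @[h --> 0^'+] --> l.
Proof.
move=> fg /cvg_at0P fl; apply/cvg_at0P => e /fl [d [d0 hd]].
by exists d; split => // h /[dup] /andP[h0 _] /hd; rewrite fg.
Qed.

Lemma ler_eps (a b c : R) : 0 <= c ->
  (forall e, 0 < e -> a <= b + c * e) -> a <= b.
Proof.
move=> c0 h; rewrite leNgt; apply/negP => ba.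
have c1 : 0 < c + 1 by lra.
have := h ((a - b) / (2 * (c + 1))); rewrite divr_gt0 ?subr_gt0//; last by lra.
move=> /(_ isT); rewrite -lerBlDl => H.
have : c * ((a - b) / (2 * (c + 1))) <= (a - b) / 2.
  rewrite mulrCA ler_wpM2l ?subr_ge0 ?(ltW ba)// ler_pdivrMr; last by lra.
  by rewrite [2^-1 * _]mulrA mulVf// mul1r; lra.
lra.
Qed.

End at_zero.

Section exponential.
Context (R : realType).
Implicit Types l : R.

Lemma cvg_expR_at0 l : expR (l * h) @[h --> 0^'+] --> (1 : R).
Proof.
have c : {for 0, continuous (fun h : R => expR (l * h))}.
  apply: continuous_comp; last exact: continuous_expR.
  by apply: cvgM; [exact: cvg_cst|exact: cvg_id].
by move: c; rewrite /prop_for /continuous_at /= mulr0 expR0; exact: cvg_at_right_filter.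
Qed.

Lemma cvg_expR_slope l : h^-1 * (expR (l * h) - 1) @[h --> 0^'+] --> l.
Proof.
have up : l * expR (l * h) @[h --> 0^'+] --> l.
  by rewrite -[X in _ --> X]mulr1; apply: cvgM; [exact: cvg_cst|exact: cvg_expR_at0].
apply: (squeeze_cvgr _ (cvg_cst l) up).
exists 1 => //= h _ h0; rewrite ler_pdivlMl// ler_pdivrMl//.
have := expR_ge1Dx (l * h); have := expR_ge1Dx (- (l * h)).
have : expR (l * h) * expR (- (l * h)) = 1 by rewrite -expRD subrr expR0.
have := expR_gt0 (l * h).
set a := expR (l * h); set b := expR (- _) => a0 ab h1 h2.
apply/andP; split; first lra.
have : a * (1 - l * h) <= 1 by rewrite -[leRHS]ab ler_wpM2l// ltW.
by rewrite mulrBr mulr1; nra.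
Qed.

End exponential.

Section semigroup.
Context (R : realType) (X : completeNormedModType R).

Definition real_linear (V W : normedModType R) (f : V -> W) : Prop :=
  forall a x y, f (a *: x + y) = a *: f x + f y.

Lemma real_linear0 (V W : normedModType R) (f : V -> W) :
  real_linear f -> f 0 = 0.
Proof.
move=> lf; have /eqP := lf 1 0 0.
by rewrite !scale1r addr0 -subr_eq0 opprD addrA subrr sub0r oppr_eq0 => /eqP.
Qed.
Lemma real_linearD (V W : normedModType R) (f : V -> W) x y :
  real_linear f -> f (x + y) = f x + f y.
Proof. by move=> lf; rewrite -[x in LHS]scale1r lf scale1r. Qed.
Lemma real_linearZ (V W : normedModType R) (f : V -> W) a x :
  real_linear f -> f (a *: x) = a *: f x.
Proof. by move=> lf; rewrite -[a *: x]addr0 lf real_linear0// addr0. Qed.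
Lemma real_linearN (V W : normedModType R) (f : V -> W) x :
  real_linear f -> f (- x) = - f x.
Proof. by move=> lf; rewrite -scaleN1r real_linearZ// scaleN1r. Qed.
Lemma real_linearB (V W : normedModType R) (f : V -> W) x y :
  real_linear f -> f (x - y) = f x - f y.
Proof. by move=> lf; rewrite real_linearD// real_linearN. Qed.

Record contraction_semigroup (S : R -> X -> X) : Prop := {
  csg_linear : forall t, 0 <= t -> real_linear (S t);
  csg_contr : forall t x, 0 <= t -> `|S t x| <= `|x|;
  csg0 : forall x, S 0 x = x;
  csgD : forall s t x, 0 <= s -> 0 <= t -> S (s + t) x = S s (S t x);
  csg_cvg0 : forall x, S t x @[t --> 0^'+] --> x
}.

Definition gen (S : R -> X -> X) (y z : X) : Prop :=
  h^-1 *: (S h y - y) @[h --> 0^'+] --> z.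

Lemma gen_unique S y z z' : gen S y z -> gen S y z' -> z = z'.
Proof. exact: cvg_at0_unique. Qed.

Lemma gen_linear S a y z y' z' : (forall t, 0 <= t -> real_linear (S t)) ->
  gen S y z -> gen S y' z' -> gen S (a *: y + y') (a *: z + z').
Proof.
move=> lS yz yz'; apply: (@cvg_trans _ (a *: (h^-1 *: (S h y - y)) +
  h^-1 *: (S h y' - y') @[h --> 0^'+])).
  2: exact: (cvgD (cvgZ (cvg_cst a) yz) yz').
apply: near_eq_cvg; exists 1 => //= h _ h0.
rewrite scalerA [a * _]mulrC -scalerA -scalerDr; congr (_ *: _).
by rewrite lS ?(ltW h0)// scalerBr opprD addrACA.
Qed.

Section fixed_semigroup.
Variable S : R -> X -> X.
Hypothesis hS : contraction_semigroup S.
Let lS := csg_linear hS.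
Let SB t x y (t0 : 0 <= t) : S t (x - y) = S t x - S t y := real_linearB x y (lS t0).

(** For contractions, the continuity of an orbit at 0 is uniform along the
   orbit. *)
Lemma csg_modulus x e : 0 < e ->
  exists d, 0 < d /\ forall h, 0 <= h < d -> `|S h x - x| <= e.
Proof.
move=> e0; have [d [d0 hd]] := (cvg_at0P _ _).1 (@csg_cvg0 _ hS x) e e0.
exists d; split => // h; rewrite le_eqVlt => /andP[/predU1P[<-|h0] hd'].
  by rewrite csg0// subrr normr0 ltW.
by apply: hd; rewrite h0.
Qed.

Lemma csg_dist x s t : 0 <= s -> 0 <= t ->
  `|S s x - S t x| <= `|S `|s - t| x - x|.
Proof.
wlog st : s t / s <= t => [hw s0 t0|s0 t0].
  have [st|/ltW ts] := leP s t; first exact: hw.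
  by rewrite distrC [`|s - t|]distrC; exact: hw.
have ts : 0 <= t - s by rewrite subr_ge0.
rewrite distrC [`|s - t|]distrC (ger0_norm ts).
have -> : S t x = S s (S (t - s) x) by rewrite -(csgD hS)// addrC subrK.
by rewrite -SB//; exact: csg_contr.
Qed.

Lemma orbit_continuous x : continuous (fun s : R => S `|s| x).
Proof.
move=> s; apply/cvgrPdist_le => e e0.
have [d [d0 hd]] := csg_modulus x e0.
exists d => //= t std; apply: le_trans (csg_dist _ _ _) _ => //.
by apply: hd; rewrite normr_ge0/=; exact: le_lt_trans (ler_dist_dist _ _) _.
Qed.

Lemma functional_continuous (psi : X -> R) (f : R -> X) :
  unit_functional psi -> continuous f -> continuous (fun s => psi (f s)).
Proof. by move=> hpsi cf s; apply: (functional_cvg hpsi); exact: cf. Qed.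

Lemma functional_csg (psi : X -> R) t : 0 <= t ->
  unit_functional psi -> unit_functional (psi \o S t).
Proof.
move=> t0 hpsi; split=> [a x y|x] /=.
  by rewrite lS// hpsi.1.
exact: le_trans (hpsi.2 _) (csg_contr hS _ t0).
Qed.

Hypothesis nX : has_norming_functionals X.

Lemma orbit_integral_exists (t : R) (x : X) : exists v, 0 <= t ->
  forall psi : X -> R, unit_functional psi ->
  (\int[@completed_lebesgue_measure R]_(s in `[0%R, t]) (psi (S `|s : R| x))%:E
   = (psi v)%:E)%E.
Proof.
have cpsi (psi : X -> R) : unit_functional psi ->
    continuous (fun s : R => psi (S `|s| x)).
  by move=> h; exact: functional_continuous h (@orbit_continuous x).
have [->|t0] := eqVneq t 0.
  exists 0 => _ psi hpsi; rewrite completed_integral//.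
    by rewrite set_itv1 integral_set1 functional0.
  exact: (continuous_measurable_EFin (cpsi _ hpsi)).
have [{}t0|tn] := ltP 0 t; last first.
  by exists 0 => t0'; move: t0; rewrite eq_le tn t0'.
pose f (s : R) : X := S `|s| x.
have cf : continuous f by exact: orbit_continuous.
have [s sf] := @right_continuous_approx R RealScalars X t f t0
  (fun u _ => cvg_at_right_filter (cf u)).
have mD : measurable (`]0, t[%classic : set (caratheodory_type (wlength (@idfun R))^*%mu)).
  by apply: completed_measurable; exact: measurable_itv.
have foo : (\int[@completed_lebesgue_measure R]_(s in `]0%R, t[)
    (nrm (k := RealScalars) (f s : X))%:E < +oo)%E.
  apply: (@le_lt_trans _ _ (\int[@completed_lebesgue_measure R]_(s in `]0%R, t[)
    (cst (`|x|%:E) s)))%E.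
    apply: ge0_le_integral => //.
    - by move=> u _; rewrite lee_fin; exact: normr_ge0.
    - exact/measurable_EFinP/(approx_measurable_nrm sf).
    - by move=> u _; rewrite lee_fin; exact: csg_contr.
  rewrite integral_cst// [X in (_ * X)%E](completed_itv `]0, t[)/=; case: ifP => _; last by rewrite mule0.
  by rewrite -EFinB -EFinM ltry.
have [v hv] := @bochner_exists R _ _ _ RealScalars X _ _ _ nX mD sf foo.
exists v => _ psi hpsi.
have [_ <-] := is_bochner_functional mD sf foo hv hpsi.
by rewrite completed_integral_oo//; exact: cpsi.
Qed.

(** The integral of s |-> S s x over [0, t], obtained as a Bochner integral and
   known through its functionals only; arbitrary for negative t. *)
Definition orbit_integral t x : X := projT1 (cid (orbit_integral_exists t x)).
Local Notation W := orbit_integral.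

(** Through a functional, the orbit integral is the increment of a primitive,
   and identities between orbit integrals become identities between
   derivatives. *)
Lemma orbit_primitive x (psi : X -> R) : unit_functional psi ->
  exists F : R -> R,
    (forall s : R, - 1 < s -> is_derive s 1 F (psi (S `|s| x))) /\
    forall t, 0 <= t -> psi (W t x) = F t - F 0.
Proof.
move=> hpsi.
have cf := functional_continuous hpsi (orbit_continuous (x := x)).
have [F [dF FE]] := continuous_primitive (-1) cf.
exists F; split => // t t0; rewrite /orbit_integral; case: cid => v /= /(_ t0 _ hpsi).
by rewrite FE ?ltrN10// => -[].
Qed.

Lemma orbit_integral_linear t : 0 <= t -> real_linear (W t).
Proof.
move=> t0 a x y; apply: norming_eq => // psi hpsi.
have [F1 [dF1 F1E]] := orbit_primitive (a *: x + y) hpsi.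
have [F2 [dF2 F2E]] := orbit_primitive x hpsi.
have [F3 [dF3 F3E]] := orbit_primitive y hpsi.
have dG (s : R) : - 1 < s ->
    is_derive s 1 (a \*: F2 + F3) (a *: psi (S `|s| x) + psi (S `|s| y)).
  by move=> s1; apply: is_deriveD; [apply: is_deriveZ; exact: dF2|exact: dF3].
rewrite hpsi.1 F1E// F2E// F3E// (increment_eq t0 dF1 dG).
  by rewrite !fctE /= /GRing.scale/=; ring.
by move=> s _; rewrite lS// hpsi.1.
Qed.

Lemma orbit_integral_dist t x y e : 0 <= t ->
  (forall s, 0 <= s <= t -> `|S s x - y| <= e) -> `|W t x - t *: y| <= t * e.
Proof.
move=> t0 h; apply: norming_le => // psi hpsi.
have [F [dF FE]] := orbit_primitive x hpsi.
rewrite functionalB// functionalZ// FE//.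
rewrite [leLHS](_ : _ = (F - (psi y \*: id)) t - (F - (psi y \*: id)) 0); last first.
  by rewrite !fctE /= /GRing.scale/=; ring.
apply: (increment_le (h := fun s => psi (S `|s| x) - psi y *: 1)) => //.
- by move=> s s1; apply: is_deriveB; exact: dF.
- move=> s /andP[s0 st]; rewrite [_ *: _]mulr1 -functionalB//.
  by apply: le_trans (functional_le hpsi _) _; rewrite ger0_norm// h// s0.
Qed.

Lemma orbit_integral_le t x : 0 <= t -> `|W t x| <= t * `|x|.
Proof.
move=> t0; rewrite -[W t x]subr0 -[X in _ - X](scaler0 _ t).
by apply: orbit_integral_dist => // s /andP[s0 _]; rewrite subr0 csg_contr.
Qed.

(* Both sides integrate psi (S s x) over [v, v + u]. *)
Lemma orbit_primitive_shift x (psi : X -> R) (F : R -> R) (u v : R) :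
  unit_functional psi ->
  (forall s : R, - 1 < s -> is_derive s 1 F (psi (S `|s| x))) ->
  0 <= u -> 0 <= v ->
  psi (W u (S v x)) = F (v + u) - F v /\ psi (S v (W u x)) = F (v + u) - F v.
Proof.
move=> hpsi dF u0 v0.
have dF' (s : R) : - 1 < s -> is_derive s 1 (fun s => F (v + s)) (psi (S `|v + s| x)).
  by move=> s1; apply: is_derive_shiftr; apply: dF; lra.
have E : F (v + u) - F v = F (v + u) - F (v + 0) by rewrite addr0.
rewrite E.
have [F1 [dF1 F1E]] := orbit_primitive (S v x) hpsi.
have [F2 [dF2 F2E]] := orbit_primitive x (functional_csg v0 hpsi).
split.
  rewrite F1E//; apply: (increment_eq u0 dF1 dF') => s s0.
  by rewrite !ger0_norm ?addr_ge0// [v + s]addrC (csgD hS).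
rewrite -[LHS]/((psi \o S v) _) F2E//; apply: (increment_eq u0 dF2 dF') => s s0.
by rewrite /= !ger0_norm ?addr_ge0// (csgD hS).
Qed.

Lemma orbit_integralC u v x : 0 <= u -> 0 <= v -> W u (S v x) = S v (W u x).
Proof.
move=> u0 v0; apply: norming_eq => // psi hpsi.
have [F [dF _]] := orbit_primitive x hpsi.
by have [-> ->] := orbit_primitive_shift hpsi dF u0 v0.
Qed.

(** The orbit integral inherits the symmetries of the semigroup. *)
Lemma orbit_integral_commute (C : X -> X) t x : real_linear C ->
  (forall x, `|C x| <= `|x|) -> (forall t x, 0 <= t -> C (S t x) = S t (C x)) ->
  0 <= t -> C (W t x) = W t (C x).
Proof.
move=> lC cC SC t0; apply: norming_eq => // psi hpsi.
have hpsiC : unit_functional (psi \o C).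
  split=> [a u v|u] /=; first by rewrite lC hpsi.1.
  exact: le_trans (hpsi.2 _) (cC u).
have [F [dF FE]] := orbit_primitive x hpsiC.
have [F1 [dF1 F1E]] := orbit_primitive (C x) hpsi.
rewrite F1E// -[LHS]/((psi \o C) _) FE//; apply: (increment_eq t0 dF dF1) => s s0.
by rewrite /= SC.
Qed.

Lemma orbit_integralD u v x : 0 <= u -> 0 <= v ->
  W (v + u) x = W v x + S v (W u x).
Proof.
move=> u0 v0; apply: norming_eq => // psi hpsi.
have [F [dF FE]] := orbit_primitive x hpsi.
rewrite functionalD// (orbit_primitive_shift hpsi dF u0 v0).2 !FE ?addr_ge0//.
by ring.
Qed.

Lemma orbit_integral_swap r h x : 0 <= r -> 0 <= h ->
  W r (S h x - x) = S r (W h x) - W h x.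
Proof.
move=> r0 h0; rewrite real_linearB; last exact: orbit_integral_linear.
rewrite orbit_integralC//; apply/eqP; rewrite subr_eq addrAC eq_sym subr_eq.
by rewrite [_ + W r x]addrC [_ + W h x]addrC -!orbit_integralD// addrC.
Qed.

End fixed_semigroup.
End semigroup.

(** * Generators *)

Section generator_theory.
Context (R : realType) (X : completeNormedModType R).
Hypothesis nX : has_norming_functionals X.
Implicit Types S : R -> X -> X.

Section fixed_semigroup.
Variable S : R -> X -> X.
Hypothesis hS : contraction_semigroup S.
Local Notation W := (orbit_integral hS nX).
Let lS := csg_linear hS.
Let SB t x y : 0 <= t -> S t (x - y) = S t x - S t y.
Proof. by move=> t0; exact: real_linearB (lS t0). Qed.
Let SZ t a x : 0 <= t -> S t (a *: x) = a *: S t x.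
Proof. by move=> t0; exact: real_linearZ (lS t0). Qed.
Let lW (t : R) (t0 : 0 <= t) := orbit_integral_linear hS nX t0.

Lemma csg_continuous t (u : nat -> X) l : 0 <= t ->
  u n @[n --> \oo] --> l -> S t (u n) @[n --> \oo] --> S t l.
Proof.
move=> t0 /cvgrPdist_lt ul; apply/cvgrPdist_lt => e e0.
apply: filterS (ul e e0) => n; apply: le_lt_trans.
by rewrite -real_linearB ?csg_contr//; exact: lS.
Qed.

Lemma orbit_integral_at0 x : h^-1 *: W h x @[h --> 0^'+] --> x.
Proof.
apply/cvg_at0P => e e0; have [d [d0 hd]] := csg_modulus hS x e0.
exists d; split => // h /andP[h0 hd'].
have -> : h^-1 *: W h x - x = h^-1 *: (W h x - h *: x).
  by rewrite scalerBr scalerA mulVf ?gt_eqF// scale1r.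
rewrite normrZ gtr0_norm ?invr_gt0// ler_pdivrMl//.
apply: orbit_integral_dist; first exact: ltW.
by move=> s /andP[s0 sh]; apply: hd; rewrite s0 (le_lt_trans sh).
Qed.

(** The difference quotient of W t x is W h (S t x - x) / h, by exchanging the
   two increments. *)
Lemma gen_orbit_integral t x : 0 <= t -> gen S (W t x) (S t x - x).
Proof.
move=> t0; apply: cvg_at0_eq (@orbit_integral_at0 (S t x - x)) => h h0.
by rewrite orbit_integral_swap// ltW.
Qed.

(** The fundamental theorem of calculus for orbits in the domain. *)
Lemma gen_increment y z t : gen S y z -> 0 <= t -> S t y - y = W t z.
Proof.
move=> yz t0; apply: (@cvg_at0_unique _ _ (fun h => h^-1 *: W t (S h y - y))).
  have H1 : S t (h^-1 *: W h y) - h^-1 *: W h y @[h --> 0^'+] --> S t y - y.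
    apply: cvgB; last exact: orbit_integral_at0.
    apply/cvg_at0P => e e0.
    have [d [d0 hd]] := (cvg_at0P _ _).1 (@orbit_integral_at0 y) e e0.
    exists d; split => // h /hd; apply: le_trans.
    by rewrite -real_linearB ?csg_contr//; exact: lS.
  apply: cvg_at0_eq H1 => h h0.
  rewrite orbit_integral_swap// ?ltW// scalerBr real_linearZ//; exact: lS.
apply/cvg_at0P => e e0.
have [|d [d0 hd]] := (cvg_at0P _ _).1 yz (e / (t + 1)).
  by rewrite divr_gt0// ltr_wpDl.
exists d; split => // h /hd hh.
rewrite -real_linearZ -?real_linearB; [|exact: lW..].
apply: le_trans (orbit_integral_le _ _ _ t0) _.
apply: le_trans (ler_wpM2l t0 hh) _.
by rewrite mulrCA ler_piMr ?(ltW e0)// ler_pdivrMr ?mul1r ?lerDl// ltr_wpDl.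
Qed.

(** The integrated form of the generator: it turns limits of difference
   quotients into identities between bounded operators, which are stable under
   limits. *)
Lemma genP y z : gen S y z <-> (forall t, 0 <= t -> S t y - y = W t z).
Proof.
split=> [yz t t0|h]; first exact: gen_increment.
apply: cvg_at0_eq (@orbit_integral_at0 z) => t t0.
by rewrite h// ltW.
Qed.

Lemma gen_closed (u v : nat -> X) y z : (forall n, gen S (u n) (v n)) ->
  u n @[n --> \oo] --> y -> v n @[n --> \oo] --> z -> gen S y z.
Proof.
move=> uv uy vz; apply/genP => t t0.
have H1 : S t (u n) - u n @[n --> \oo] --> S t y - y.
  by apply: cvgB => //; exact: csg_continuous.
have H2 : W t (v n) @[n --> \oo] --> W t z.
  apply/cvgrPdist_le => e e0.
  move/cvgrPdist_le : vz => /(_ (e / (t + 1))).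
  rewrite divr_gt0 ?ltr_wpDl// => /(_ isT); apply: filterS => n hn.
  rewrite -real_linearB; last exact: lW.
  apply: le_trans (orbit_integral_le _ _ _ t0) _.
  apply: le_trans (ler_wpM2l t0 hn) _.
  by rewrite mulrCA ler_piMr ?(ltW e0)// ler_pdivrMr ?mul1r ?lerDl// ltr_wpDl.
move: H1; rewrite (_ : (fun n => _) = (fun n => W t (v n))); last first.
  by apply/funext => n; exact: gen_increment.
by move=> H1; exact: cvg_unique H1 H2.
Qed.

Lemma gen_dense x e : 0 < e -> exists y z, gen S y z /\ `|y - x| <= e.
Proof.
move=> e0; have [d [d0 hd]] := (cvg_at0P _ _).1 (@orbit_integral_at0 x) e e0.
have d2 : 0 < d / 2 by rewrite divr_gt0.
exists ((d / 2)^-1 *: W (d / 2) x), ((d / 2)^-1 *: (S (d / 2) x - x)); split.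
  have := @gen_linear _ _ S (d / 2)^-1 _ _ _ _ lS (@gen_orbit_integral _ x (ltW d2))
    (@gen_orbit_integral _ x (lexx 0)).
  rewrite (csg0 hS) subrr addr0; congr (gen _ _ _).
  apply/eqP; rewrite -subr_eq0 addrAC subrr add0r -normr_le0.
  by apply: le_trans (orbit_integral_le _ _ _ (lexx 0)) _; rewrite mul0r.
by apply: hd; rewrite d2 ltr_pdivrMr// mulr2n mulrDr mulr1 ltrDl.
Qed.

(** Contractivity gives psi (S h y) <= |y| = psi y: the difference quotients
   are nonpositive at a functional norming y. *)
Lemma gen_functional_le0 y z psi : gen S y z -> unit_functional psi ->
  psi y = `|y| -> psi z <= 0.
Proof.
move=> /cvg_at0P yz hpsi psiy; apply: (@ler_eps _ _ _ 1) => // e e0.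
have [d [d0 hd]] := yz e e0.
have d2 : 0 < d / 2 by rewrite divr_gt0.
set a := (d / 2)^-1 *: (S (d / 2) y - y).
have a0 : psi a <= 0.
  rewrite functionalZ// functionalB// psiy pmulr_rle0 ?invr_gt0// subr_le0.
  by apply: le_trans (functional_le hpsi _) _; rewrite (csg_contr hS)// ltW.
have ae : `|a - z| <= e.
  by apply: hd; rewrite d2 ltr_pdivrMr// mulr2n mulrDr mulr1 ltrDl.
have za : psi z - psi a <= `|a - z|.
  by rewrite -functionalB// distrC; exact: functional_le.
by rewrite add0r mul1r; lra.
Qed.

Lemma gen_dissipative y z a : gen S y z -> a * `|y| <= `|a *: y - z|.
Proof.
move=> yz; have [psi hpsi psiy] := nX y.
apply: le_trans (functional_le hpsi _).
by rewrite functionalB// functionalZ// psiy lerDl oppr_ge0; exact: gen_functional_le0 yz _ _.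
Qed.

Lemma gen0 : gen S 0 0.
Proof.
have := @gen_orbit_integral _ 0 (lexx 0); rewrite (csg0 hS) subrr.
by rewrite (real_linear0 (lW (lexx 0))).
Qed.

End fixed_semigroup.

Section rescaling.
Variables (w : R) (T : R -> X -> X).

(** Semigroups of type (1, w), and their rescaling to contractions. *)
Record growth_semigroup : Prop := {
  gsg_linear : forall t, 0 <= t -> real_linear (T t);
  gsg_le : forall t x, 0 <= t -> `|T t x| <= expR (w * t) * `|x|;
  gsg0 : forall x, T 0 x = x;
  gsgD : forall s t x, 0 <= s -> 0 <= t -> T (s + t) x = T s (T t x);
  gsg_cvg0 : forall x, T t x @[t --> 0^'+] --> x
}.

Definition rescale t x := expR (- (w * t)) *: T t x.

Hypothesis hT : growth_semigroup.

Lemma rescale_contraction : contraction_semigroup rescale.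
Proof.
split=> [t t0 a x y|t x t0|x|s t x s0 t0|x].
- by rewrite /rescale (gsg_linear hT)// scalerDr !scalerA mulrC.
- rewrite /rescale normrZ gtr0_norm ?expR_gt0//.
  apply: le_trans (ler_wpM2l (expR_ge0 _) (gsg_le hT x t0)) _.
  by rewrite mulrA -expRD addNr expR0 mul1r.
- by rewrite /rescale (gsg0 hT) mulr0 oppr0 expR0 scale1r.
- rewrite /rescale (gsgD hT)// (real_linearZ _ _ (gsg_linear hT s0)) scalerA -expRD.
  by rewrite mulrDr opprD.
- rewrite /rescale -[X in _ --> X]scale1r; apply: cvgZ; last exact: (@gsg_cvg0 hT).
  by under eq_fun do rewrite -mulNr; exact: cvg_expR_at0.
Qed.

(** The derivative of the exponential factor shifts the generator by w. *)
Lemma gen_rescale y z : gen rescale y z -> gen T y (z + w *: y).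
Proof.
move=> yz.
have H : (expR (w * h)) *: (h^-1 *: (rescale h y - y)) + (h^-1 * (expR (w * h) - 1)) *: y
    @[h --> 0^'+] --> (1 : R) *: z + w *: y.
  apply: cvgD; first by apply: cvgZ => //; exact: cvg_expR_at0.
  by apply: cvgZ; [exact: cvg_expR_slope|exact: cvg_cst].
rewrite scale1r in H; apply: cvg_at0_eq H => h h0.
rewrite scalerA [_ * h^-1]mulrC -!scalerA -scalerDr; congr (_ *: _).
by rewrite /rescale scalerBr scalerA -expRD subrr expR0 scale1r scalerBl scale1r addrA subrK.
Qed.

Lemma gsg_gen t y z : 0 <= t -> gen T y z -> gen T (T t y) (T t z).
Proof.
move=> t0 /cvg_at0P yz; apply/cvg_at0P => e e0.
have lT := gsg_linear hT t0.
have [|d [d0 hd]] := yz (e / expR (w * t)); first by rewrite divr_gt0// expR_gt0.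
exists d; split => // h /[dup] /andP[/ltW h0 _] /hd hh.
rewrite -(gsgD hT)// [h + t]addrC (gsgD hT)//.
rewrite -(real_linearB _ _ lT) -(real_linearZ _ _ lT) -(real_linearB _ _ lT).
apply: le_trans (gsg_le hT _ t0) _.
by rewrite mulrC -ler_pdivlMr// expR_gt0.
Qed.

Lemma gsg_dense x e : 0 < e -> exists y z, gen T y z /\ `|y - x| <= e.
Proof.
move=> e0; have [y [z [yz yx]]] := gen_dense rescale_contraction x e0.
by exists y, (z + w *: y); split => //; exact: gen_rescale.
Qed.

Lemma gsg_orbit_continuous x : continuous (fun s : R => T `|s| x).
Proof.
have -> : (fun s : R => T `|s| x) = (fun s : R => expR (w * `|s|) *: rescale `|s| x).
  by apply/funext => s; rewrite /rescale scalerA -expRD subrr expR0 scale1r.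
move=> s; apply: (@cvgZ _ _ _ _ _ (fun s : R => expR (w * `|s|)) (fun s : R => rescale `|s| x)).
  apply: (@continuous_comp _ _ _ (fun s : R => w * `|s|) expR); last exact: continuous_expR.
  by apply: cvgM; [exact: cvg_cst|exact: norm_continuous].
exact: orbit_continuous rescale_contraction x s.
Qed.

End rescaling.

Section resolvent.
Variables (S : R -> X -> X) (l : R).
Hypothesis hS : contraction_semigroup S.
Hypothesis l0 : 0 < l.

Let growthS : growth_semigroup l S.
Proof.
split=> [t t0|t x t0|x|s t x s0 t0|x].
- exact: csg_linear hS _ t0.
- apply: le_trans (csg_contr hS _ t0) _; rewrite ler_peMl//.
  by rewrite -[leLHS]expR0 ler_expR mulr_ge0// ltW.
- exact: csg0.
- exact: csgD.
- exact: (@csg_cvg0 _ _ _ hS).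
Qed.

(** The Laplace transform of the orbit, truncated at time n, solves the equation
   up to exp (- l n) S(n) x, which tends to 0; dissipativity makes the
   truncations a Cauchy sequence, and the generator is closed. *)
Lemma resolvent_exists x : exists y, gen S y (l *: y - x).
Proof.
pose y n : X := orbit_integral (rescale_contraction growthS) nX n%:R x.
pose e n : X := expR (- (l * n%:R)) *: S n%:R x.
have yE n : gen S (y n) (e n - x + l *: y n).
  exact/gen_rescale/gen_orbit_integral.
have e0 : e n @[n --> \oo] --> (0 : X).
  apply/cvgrPdist_le => d d0.
  have cN : expR (- (l * n%:R)) * (`|x| + 1) @[n --> \oo] --> (0 : R).
    rewrite -(mul0r (`|x| + 1)); apply: cvgM; [|exact: cvg_cst].
    have h : l * n%:R @[n --> \oo] --> +oo.
      exact: (cvg_comp _ _ (@cvgr_idn R) (gt0_cvgMry l0 (@cvg_id _ +oo%R))).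
    exact: (cvg_comp _ _ h (@cvgr_expR R)).
  move/cvgrPdist_le : cN => /(_ _ d0); apply: filterS => n.
  rewrite !sub0r !normrN; apply: le_trans.
  rewrite /e normrZ normrM ler_wpM2l// [leRHS]ger0_norm ?addr_ge0//.
  by apply: le_trans (csg_contr hS _ _) _ => //; rewrite lerDl.
have [yl hy] : exists yl : X, y n @[n --> \oo] --> yl.
  apply: cauchy_seq_cvg => d d0.
  have ld : 0 < l * d / 2 by rewrite !(mulr_gt0, divr_gt0).
  move/cvgrPdist_le : e0 => /(_ _ ld) [N _ hN].
  exists N => m n Nm Nn; rewrite -(ler_pM2l l0).
  have yB : gen S (y m - y n) (e m - x + l *: y m - (e n - x + l *: y n)).
    have := @gen_linear _ _ S (-1) _ _ _ _ (csg_linear hS) (yE n) (yE m).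
    by rewrite !scaleN1r ![- _ + _]addrC.
  apply: le_trans (gen_dissipative hS l yB) _.
  have -> : l *: (y m - y n) - (e m - x + l *: y m - (e n - x + l *: y n))
     = e n - e m.
    have aux (p q a b : X) : p - q - (a + p - (b + q)) = b - a.
      by rewrite (opprD b q) addrACA opprD addrCA subrr addr0 opprB.
    by rewrite scalerBr aux opprB addrA subrK.
  apply: le_trans (ler_normB _ _) _.
  have := hN _ Nm; have := hN _ Nn; rewrite /= !sub0r !normrN; lra.
exists yl; apply: (gen_closed hS yE hy).
rewrite addrC -[X in _ --> X + _]add0r.
by apply: cvgD; [apply: cvgB => //; exact: cvg_cst|apply: cvgZ => //; exact: cvg_cst].
Qed.

End resolvent.
End generator_theory.

(** * Resolvents *)

Section resolvent_theory.
Context (R : realType) (X : completeNormedModType R).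
Hypothesis nX : has_norming_functionals X.
Variable S : R -> X -> X.
Hypothesis hS : contraction_semigroup S.

Definition res (l : R) (x : X) : X := xget 0 [set y | gen S y (l *: y - x)].

Lemma resP l x : 0 < l -> gen S (res l x) (l *: res l x - x).
Proof.
move=> l0; rewrite /res; case: xgetP => [y -> //|h].
by have [y /h] := resolvent_exists nX hS l0 x.
Qed.

Lemma res_unique l x y : 0 < l -> gen S y (l *: y - x) -> y = res l x.
Proof.
move=> l0 hy; apply/eqP; rewrite -subr_eq0 -normr_le0 -(ler_pM2l l0) mulr0.
have := @gen_linear _ _ S (-1) _ _ _ _ (csg_linear hS) (@resP _ x l0) hy.
rewrite !scaleN1r => /(gen_dissipative nX hS l); rewrite [- _ + y]addrC.
move=> /le_trans; apply; rewrite scalerBr.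
have aux (p q : X) : p - q - (- (q - x) + (p - x)) = 0.
  by rewrite (opprB q) [x - q + _]addrC subrKA subrr.
by rewrite aux normr0.
Qed.

Lemma res_le l x : 0 < l -> l * `|res l x| <= `|x|.
Proof.
move=> l0; apply: le_trans (gen_dissipative nX hS l (@resP _ x l0)) _.
by rewrite opprB addrC subrK.
Qed.

Lemma res_linear l : 0 < l -> real_linear (res l).
Proof.
move=> l0 a x y; apply/esym/res_unique => //.
have := @gen_linear _ _ S a _ _ _ _ (csg_linear hS) (@resP _ x l0) (@resP _ y l0).
by rewrite scalerBr addrACA -opprD scalerDr !scalerA [l * a]mulrC.
Qed.

Lemma res_gen l y z : 0 < l -> gen S y z -> l *: res l y - y = res l z.
Proof.
move=> l0 yz; have lr := res_linear l0.
have yE : y = res l (l *: y - z).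
  by apply: res_unique => //; rewrite opprB addrC subrK.
by rewrite {2}yE (real_linearB _ _ lr) (real_linearZ _ _ lr) opprB addrC subrK.
Qed.

(** On the domain l R(l) y - y = R(l) z is O(1 / l); the domain is dense and the
   operators l R(l) are contractions. *)
Lemma res_cvg x e : 0 < e ->
  exists L, 0 < L /\ forall l, L <= l -> `|l *: res l x - x| <= e.
Proof.
move=> e0; have e4 : 0 < e / 4 by rewrite divr_gt0.
have [y [z [yz yx]]] := gen_dense nX hS x e4.
exists (2 * (`|z| + 1) / e); split.
  by rewrite divr_gt0// mulr_gt0// ltr_wpDl.
move=> l hl; have l0 : 0 < l.
  by apply: lt_le_trans hl; rewrite divr_gt0// mulr_gt0// ltr_wpDl.
have lr := res_linear l0.
have -> : l *: res l x - x = l *: res l (x - y) + (l *: res l y - y) - (x - y).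
  by rewrite (real_linearB _ _ lr) scalerBr addrA subrK opprB addrA subrK.
apply: le_trans (ler_normB _ _) _; apply: le_trans (lerD (ler_normD _ _) (lexx _)) _.
have h1 : `|l *: res l (x - y)| <= `|x - y|.
  by rewrite normrZ (gtr0_norm l0) res_le.
have h2 : `|l *: res l y - y| <= e / 2.
  rewrite (res_gen l0 yz) -(ler_pM2l l0); apply: le_trans (res_le _ l0) _.
  by move: hl; rewrite ler_pdivrMr// => hl; have := normr_ge0 z; lra.
by move: h1; rewrite (distrC x); lra.
Qed.

(** A Lipschitz orbit has bounded Yosida approximants.  With q = l R(l) w - w, the
   vector l q is the derivative of the orbit of l R(l) w = w + q; a functional
   norming q is nonpositive on the increments of the orbit of q, which leaves
   the increments of the orbit of w. *)
Lemma favard_res w c l : 0 < l ->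
  (forall t, 0 <= t -> `|S t w - w| <= c * t) -> l * `|l *: res l w - w| <= c.
Proof.
move=> l0 hw; set q := l *: res l w - w.
have [psi hpsi psiq] := nX q.
apply: (@ler_eps _ _ _ 1) => // e e0; rewrite mul1r.
have vq : gen S (res l w) q by exact: resP.
have := @gen_linear _ _ S l _ _ _ _ (csg_linear hS) vq (gen0 nX hS).
rewrite !addr0 => /cvg_at0P /(_ _ e0) [d [d0 hd]].
have h0 : 0 < d / 2 by rewrite divr_gt0.
have := hd (d / 2); rewrite h0 ltr_pdivrMr// mulr2n mulrDr mulr1 ltrDl => /(_ d0).
set h := d / 2 in h0 *; set v := l *: res l w.
have -> : S h v - v = (S h w - w) + (S h q - q).
  have -> : v = w + q by rewrite /q addrC subrK.
  by rewrite (real_linearD _ _ (csg_linear hS (ltW h0))) opprD addrACA.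
rewrite scalerDr => H.
have p1 : psi (h^-1 *: (S h w - w)) <= c.
  apply: le_trans (functional_le hpsi _) _.
  by rewrite normrZ gtr0_norm ?invr_gt0// ler_pdivrMl// mulrC hw// ltW.
have p2 : psi (h^-1 *: (S h q - q)) <= 0.
  rewrite functionalZ// functionalB// psiq pmulr_rle0 ?invr_gt0// subr_le0.
  by apply: le_trans (functional_le hpsi _) _; rewrite (csg_contr hS)// ltW.
have p3 : psi (l *: q) - psi (h^-1 *: (S h w - w) + h^-1 *: (S h q - q)) <= e.
  by rewrite -functionalB//; apply: le_trans (functional_le hpsi _) _; rewrite distrC.
move: p3; rewrite functionalD// functionalZ// psiq; lra.
Qed.

End resolvent_theory.

(** * Limits of dyadic schemes *)

Section dyadic.
Context (R : realType).
Implicit Types t s : R.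

Definition step (n : nat) : R := 2^-1 ^+ n.
Definition nsteps (t : R) (n : nat) : nat := Num.truncn (t * 2 ^+ n).

Lemma step_gt0 n : 0 < step n. Proof. by rewrite exprn_gt0// invr_gt0. Qed.
Lemma step_ge0 n : 0 <= step n. Proof. exact/ltW/step_gt0. Qed.
Lemma stepS n : step n = step n.+1 + step n.+1.
Proof. by rewrite /step exprS -mulrDl -[X in (X + X) * _]div1r -splitr mul1r. Qed.
Lemma stepK n : step n * 2 ^+ n = 1.
Proof. by rewrite -exprMn mulVf// expr1n. Qed.
Lemma step_le1 n : step n <= 1.
Proof. by rewrite exprn_ile1 ?invr_ge0// invf_le1// ler1n. Qed.

Lemma cvg_step : step n @[n --> \oo] --> (0 : R).
Proof. by apply: cvg_expr; rewrite ger0_norm ?invr_ge0// invf_lt1// ltr1n. Qed.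

Lemma nsteps_itv t n : 0 <= t ->
  (nsteps t n)%:R * step n <= t < (nsteps t n)%:R * step n + step n.
Proof.
move=> t0; have /truncn_itv/andP[h1 h2] : 0 <= t * 2 ^+ n by rewrite mulr_ge0// exprn_ge0.
have E : t = t * 2 ^+ n * step n by rewrite -mulrA [_ * step n]mulrC stepK mulr1.
rewrite {2 3}E ler_wpM2r ?step_ge0//=.
by rewrite -[X in _ + X]mul1r -mulrDl natr1 ltr_pM2r ?step_gt0.
Qed.

Lemma nsteps0 n : nsteps 0 n = 0%N.
Proof. by rewrite /nsteps mul0r truncn0. Qed.

Lemma nsteps_eq t n m : 0 <= t -> m%:R * step n <= t < m%:R * step n + step n ->
  nsteps t n = m.
Proof.
move=> t0 /andP[h1 h2]; have /andP[h3 h4] := nsteps_itv n t0.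
have s0 := step_gt0 n.
have lt1 : m%:R < (nsteps t n)%:R + 1 :> R.
  by rewrite -(ltr_pM2r s0) mulrDl mul1r; apply: le_lt_trans h4.
have lt2 : (nsteps t n)%:R < m%:R + 1 :> R.
  by rewrite -(ltr_pM2r s0) mulrDl mul1r; apply: le_lt_trans h2.
by move: lt1 lt2; rewrite !natr1 !ltr_nat !ltnS => h h'; apply/eqP; rewrite eqn_leq h h'.
Qed.

Lemma nstepsS t n : 0 <= t ->
  nsteps t n.+1 = (nsteps t n).*2 \/ nsteps t n.+1 = (nsteps t n).*2.+1.
Proof.
move=> t0; have /andP[h1 h2] := nsteps_itv n t0; rewrite stepS in h1 h2.
have [h|h] := ltP t ((nsteps t n).*2%:R * step n.+1 + step n.+1); [left|right];
  apply: nsteps_eq => //; rewrite -?natr1 -muln2 natrM in h *; apply/andP; split; lra.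
Qed.

(** Truncation loses at most one step. *)
Lemma nstepsD s t n : 0 <= s -> 0 <= t ->
  nsteps (s + t) n = (nsteps s n + nsteps t n)%N \/
  nsteps (s + t) n = (nsteps s n + nsteps t n).+1.
Proof.
move=> s0 t0; have /andP[h1 h2] := nsteps_itv n t0; have /andP[h3 h4] := nsteps_itv n s0.
have [h|h] := ltP (s + t) ((nsteps s n + nsteps t n)%:R * step n + step n); [left|right];
  apply: nsteps_eq; rewrite ?addr_ge0// -?natr1 natrD in h *; apply/andP; split; lra.
Qed.

Lemma cvg_nsteps t : 0 <= t -> (nsteps t n)%:R * step n @[n --> \oo] --> t.
Proof.
move=> t0; have h : t - step n @[n --> \oo] --> t.
  by rewrite -[X in _ --> X]subr0; apply: cvgB; [exact: cvg_cst|exact: cvg_step].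
apply: (squeeze_cvgr _ h (cvg_cst t)); apply: nearW => n.
by have /andP[-> h'] := nsteps_itv n t0; rewrite andbT lerBlDr ltW.
Qed.

End dyadic.

Section scheme.
Context (R : realType) (X : completeNormedModType R).
Variables (E : R -> X -> X) (w : R).
Hypothesis w0 : 0 <= w.
Hypothesis lE : forall h, 0 <= h -> real_linear (E h).
Hypothesis bE : forall h x, 0 <= h -> `|E h x| <= expR (w * h) * `|x|.
Hypothesis dE : forall h x, 0 <= h ->
  `|E (h + h) x - E h (E h x)| <= w * h * `|E h x - x|.
Hypothesis cE : forall x e, 0 < e ->
  exists y L, `|y - x| <= e /\ forall h, 0 <= h -> `|E h y - y| <= h * L.

Lemma iter_scheme_linear h k : 0 <= h -> real_linear (iter k (E h)).
Proof.
move=> h0 a x y; elim: k => //= k ->; exact: lE.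
Qed.

Lemma iter_scheme_le h k x : 0 <= h ->
  `|iter k (E h) x| <= expR (w * (k%:R * h)) * `|x|.
Proof.
move=> h0; elim: k => [|k ih] /=; first by rewrite mul0r mulr0 expR0 mul1r.
apply: le_trans (bE _ h0) _; apply: le_trans (ler_wpM2l (expR_ge0 _) ih) _.
by rewrite mulrA -expRD -mulrDr -[X in w * (X + _)]mul1r -mulrDl nat1r.
Qed.

Let ler_exp (s t : R) : s <= t -> expR (w * s) <= expR (w * t).
Proof. by move=> st; rewrite ler_expR ler_wpM2l. Qed.

(** E^k x - x is the sum of the E^i (E x - x) for i < k. *)
Lemma iter_scheme_incr h k x : 0 <= h ->
  `|iter k (E h) x - x| <= k%:R * expR (w * (k%:R * h)) * `|E h x - x|.
Proof.
move=> h0; elim: k => [|k ih] /=; first by rewrite subrr normr0 !mul0r.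
rewrite -iterS iterSr -[iter k _ _](subrK (iter k (E h) x)) -addrA.
rewrite -(real_linearB _ _ (iter_scheme_linear k h0)).
apply: le_trans (ler_normD _ _) _.
have H1 := iter_scheme_le k (E h x - x) h0.
have le1 : expR (w * (k%:R * h)) <= expR (w * (k.+1%:R * h)).
  by apply: ler_exp; rewrite ler_wpM2r// ler_nat.
have H2 : expR (w * (k%:R * h)) * `|E h x - x| <= expR (w * (k.+1%:R * h)) * `|E h x - x|.
  by rewrite ler_wpM2r.
have H3 : k%:R * expR (w * (k%:R * h)) * `|E h x - x| <=
    k%:R * expR (w * (k.+1%:R * h)) * `|E h x - x|.
  by rewrite -[leLHS]mulrA -[leRHS]mulrA ler_wpM2l.
move: ih H1 H2 H3; set e1 := expR _; set e2 := expR _.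
rewrite -[k.+1%:R](natr1 k) !mulrDl mul1r; lra.
Qed.

(** Halving the step changes k steps by O(k h^2) on orbits with Lipschitz
   start. *)
Lemma iter_scheme_halve h k x L : 0 <= h -> `|E h x - x| <= h * L ->
  `|iter k (E (h + h)) x - iter k.*2 (E h) x| <=
  k%:R * (w * h * (h * L)) * expR (w * (k%:R * (h + h))).
Proof.
move=> h0 xL; have hh0 : 0 <= h + h by rewrite addr_ge0.
elim: k => [|k ih] /=; first by rewrite subrr normr0 !mul0r.
set p := iter k _ x; set q := iter _ _ x.
have -> : E (h + h) p - E h (E h q) =
    E (h + h) (p - q) + (E (h + h) q - E h (E h q)).
  by rewrite (real_linearB _ _ (lE hh0)) addrA subrK.
apply: le_trans (ler_normD _ _) _.
have e1 : expR (w * (k%:R * (h + h))) <= expR (w * (k.+1%:R * (h + h))).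
  by apply: ler_exp; rewrite ler_wpM2r// ler_nat.
have L0 : 0 <= h * L := le_trans (normr_ge0 _) xL.
have H1 : `|E (h + h) (p - q)| <=
    k%:R * (w * h * (h * L)) * expR (w * (k.+1%:R * (h + h))).
  apply: le_trans (bE _ hh0) _.
  apply: le_trans (ler_wpM2l (expR_ge0 _) ih) _.
  rewrite mulrCA -expRD -mulrDr -[X in w * (X + _)]mul1r -mulrDl nat1r.
  by [].
have H2 : `|E (h + h) q - E h (E h q)| <=
    w * h * (h * L) * expR (w * (k.+1%:R * (h + h))).
  apply: le_trans (dE q h0) _.
  rewrite -[_ * expR _]mulrA; apply: ler_wpM2l; first exact: mulr_ge0.
  have -> : E h q = iter k.*2.+1 (E h) x by [].
  rewrite iterSr -(real_linearB _ _ (iter_scheme_linear _ h0)).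
  apply: le_trans (iter_scheme_le _ _ h0) _; rewrite mulrC.
  apply: ler_pM => //.
  by apply: ler_exp; rewrite -muln2 natrM -natr1; nra.
rewrite -natr1 !mulrDl mul1r; move: H1 H2; rewrite -natr1 !mulrDl !mul1r; lra.
Qed.

Definition discrete (n : nat) (t : R) (x : X) : X :=
  iter (nsteps t n) (E (step R n)) x.
Local Notation D := discrete.

Let st0 n : 0 <= step R n := step_ge0 R n.

Lemma discrete_linear n t : real_linear (D n t).
Proof. exact: iter_scheme_linear. Qed.

Lemma discrete_le n t x : 0 <= t -> `|D n t x| <= expR (w * t) * `|x|.
Proof.
move=> t0; apply: le_trans (iter_scheme_le _ _ (st0 n)) _.
by rewrite ler_wpM2r// ler_exp//; have /andP[] := nsteps_itv n t0.
Qed.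

Lemma discrete_incr n t y L : 0 <= t -> (forall h, 0 <= h -> `|E h y - y| <= h * L) ->
  `|D n t y - y| <= t * L * expR (w * t).
Proof.
move=> t0 yL; apply: le_trans (iter_scheme_incr _ _ (st0 n)) _.
have /andP[h1 _] := nsteps_itv n t0.
have L0 : 0 <= L.
  by have := le_trans (normr_ge0 _) (yL 1 ler01); rewrite mul1r.
set k := (nsteps t n)%:R in h1 *; set h := step R n in h1 *.
have e1 : expR (w * (k * h)) <= expR (w * t) by exact: ler_exp.
apply: le_trans (ler_wpM2l _ (yL _ (st0 n))) _; first by rewrite mulr_ge0.
have -> : k * expR (w * (k * h)) * (h * L) = k * h * L * expR (w * (k * h)) by ring.
have k0 : 0 <= k by [].
have h0 : 0 <= h := st0 n.
by apply: ler_pM => //; [rewrite !mulr_ge0|rewrite ler_wpM2r].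
Qed.

Lemma discreteS_dist n t y L : 0 <= t -> (forall h, 0 <= h -> `|E h y - y| <= h * L) ->
  `|D n.+1 t y - D n t y| <= step R n.+1 * (expR (w * t) * L * (w * t + 1)).
Proof.
move=> t0 yL; have /andP[kt _] := nsteps_itv n t0.
have L0 : 0 <= L.
  by have := le_trans (normr_ge0 _) (yL 1 ler01); rewrite mul1r.
have h0 := st0 n.+1; rewrite /D stepS in kt *.
set k := nsteps t n in kt *; set h := step R n.+1 in h0 kt *.
have e1 : expR (w * (k%:R * (h + h))) <= expR (w * t) by exact: ler_exp.
have H1 : `|iter k.*2 (E h) y - iter k (E (h + h)) y| <= h * (expR (w * t) * L * (w * t)).
  rewrite distrC; apply: le_trans (iter_scheme_halve k h0 (yL _ h0)) _.
  have -> : h * (expR (w * t) * L * (w * t)) = t * (w * h * L) * expR (w * t) by ring.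
  apply: ler_pM => //; first by rewrite !mulr_ge0.
  have -> : k%:R * (w * h * (h * L)) = (k%:R * h) * (w * h * L) by ring.
  rewrite ler_wpM2r ?mulr_ge0//; apply: le_trans kt.
  by rewrite ler_wpM2l// lerDl.
have [->|->] := nstepsS n t0; rewrite -/k.
  apply: le_trans H1 _; rewrite ler_wpM2l// mulrDr mulr1 lerDl mulr_ge0//.
rewrite -(subrKA (iter k.*2 (E h) y)).
apply: le_trans (ler_normD _ _) _.
rewrite iterSr -(real_linearB _ _ (iter_scheme_linear _ h0)).
have H2 : `|iter k.*2 (E h) (E h y - y)| <= h * (expR (w * t) * L).
  apply: le_trans (iter_scheme_le _ _ h0) _.
  have -> : h * (expR (w * t) * L) = expR (w * t) * (h * L) by ring.
  apply: ler_pM => //; last exact: yL.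
  apply: le_trans e1; apply: ler_exp; rewrite -muln2 natrM; lra.
by rewrite mulrDr mulr1 mulrDr addrC lerD.
Qed.

Lemma discrete_dist n m t y L : 0 <= t -> (forall h, 0 <= h -> `|E h y - y| <= h * L) ->
  (n <= m)%N ->
  `|D m t y - D n t y| <= step R n * (expR (w * t) * L * (w * t + 1)).
Proof.
move=> t0 yL nm; set c := expR _ * _ * _.
have L0 : 0 <= L.
  by have := le_trans (normr_ge0 _) (yL 1 ler01); rewrite mul1r.
have c0 : 0 <= c by rewrite !mulr_ge0// addr_ge0// mulr_ge0.
suff : `|D m t y - D n t y| <= (step R n - step R m) * c.
  by move=> h; apply: le_trans h _; rewrite ler_wpM2r// gerBl.
elim: m nm => [|m ih]; first by rewrite leqn0 => /eqP ->; rewrite !subrr normr0 mul0r.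
rewrite leq_eqVlt ltnS => /predU1P[->|nm]; first by rewrite !subrr normr0 mul0r.
rewrite -(subrKA (D m t y)); apply: le_trans (ler_normD _ _) _.
apply: le_trans (lerD (discreteS_dist m t0 yL) (ih nm)) _.
by rewrite -/c (stepS _ m) le_eqVlt; apply/orP; left; apply/eqP; ring.
Qed.

(** The discretizations with steps h and h / 2 differ by O(h) on the vectors with
   Lipschitz first increments; over dyadic steps these errors sum up, and such
   vectors are dense. *)
Lemma discrete_cvg_ex t x : 0 <= t -> exists l : X, D n t x @[n --> \oo] --> l.
Proof.
move=> t0; apply: cauchy_seq_cvg => e e0.
set a := expR (w * t); have a0 : 0 < a := expR_gt0 _.
have [|y [L [yx yL]]] := cE x (e := e / (4 * a)).
  by rewrite divr_gt0// mulr_gt0.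
have L0 : 0 <= L.
  by have := le_trans (normr_ge0 _) (yL 1 ler01); rewrite mul1r.
set c := a * L * (w * t + 1).
have c0 : 0 <= c by rewrite !mulr_ge0// ?addr_ge0// ?mulr_ge0// ltW.
have [N _ hN] : \forall n \near \oo, step R n * c <= e / 4.
  have : step R n * c @[n --> \oo] --> 0 * c.
    by apply: cvgM; [exact: cvg_step|exact: cvg_cst].
  rewrite mul0r => /cvgrPdist_le /(_ (e / 4)); rewrite divr_gt0// => /(_ isT).
  by apply: filterS => n; rewrite sub0r normrN => /(le_trans (ler_norm _)).
have near_y n : `|D n t x - D n t y| <= e / 4.
  rewrite -(real_linearB _ _ (discrete_linear n t)).
  apply: le_trans (discrete_le _ _ t0) _; rewrite -/a distrC mulrC -ler_pdivlMr//.
  apply: le_trans yx _; rewrite invfM mulrA; lra.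
have aux m n : (N <= n)%N -> (n <= m)%N -> `|D m t x - D n t x| <= e.
  move=> Nn nm; have H := discrete_dist t0 yL nm; have H' := hN n Nn.
  have H1 := near_y m; have H2 := near_y n.
  rewrite -(subrKA (D m t y)) -(subrKA (D n t y) (D m t y)).
  apply: le_trans (ler_normD _ _) _.
  apply: le_trans (lerD (lexx _) (ler_normD _ _)) _.
  move: H2; rewrite distrC; move: (le_trans H H'); rewrite -/a; lra.
exists N => m n Nm Nn; have [nm|/ltnW mn] := leqP n m; first exact: aux.
by rewrite distrC; exact: aux.
Qed.

Definition flow (t : R) (x : X) : X := lim (D n t x @[n --> \oo]).
Local Notation T := flow.

Lemma discrete_cvg t x : 0 <= t -> D n t x @[n --> \oo] --> T t x.
Proof. by move=> t0; apply/cvg_ex; exact: discrete_cvg_ex. Qed.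

Lemma flow_unique t x l : 0 <= t -> D n t x @[n --> \oo] --> l -> T t x = l.
Proof. by move=> t0 h; exact: cvg_unique (@discrete_cvg t x t0) h. Qed.

(* Bounds that hold for all discretizations pass to the limit. *)
Lemma flow_dist_le t x y c : 0 <= t -> (\forall n \near \oo, `|D n t x - y| <= c) ->
  `|T t x - y| <= c.
Proof.
move=> t0 h; have : `|D n t x - y| @[n --> \oo] --> `|T t x - y|.
  by apply: cvg_norm; apply: cvgB; [exact: discrete_cvg|exact: cvg_cst].
by move=> /cvgr_to_le; apply.
Qed.

Lemma flow_linear t : 0 <= t -> real_linear (T t).
Proof.
move=> t0 a x y; apply: flow_unique => //.
under eq_fun do rewrite discrete_linear.
by apply: cvgD; [apply: cvgZ; [exact: cvg_cst|]|]; exact: discrete_cvg.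
Qed.

Lemma flow_le t x : 0 <= t -> `|T t x| <= expR (w * t) * `|x|.
Proof.
move=> t0; rewrite -[T t x]subr0; apply: flow_dist_le => //.
by apply: nearW => n; rewrite subr0 discrete_le.
Qed.

(** The flow inherits the symmetries of the scheme. *)
Lemma flow_commute (C : X -> X) t x : real_linear C -> (forall x, `|C x| <= `|x|) ->
  (forall h x, 0 <= h -> C (E h x) = E h (C x)) -> 0 <= t -> C (T t x) = T t (C x).
Proof.
move=> lC cC EC t0; apply/esym/flow_unique => //.
have DC n : D n t (C x) = C (D n t x).
  by rewrite /D; elim: (nsteps t n) => //= m ->; rewrite EC ?step_ge0.
under eq_fun do rewrite DC.
apply/cvgrPdist_le => e e0; have /cvgrPdist_le /(_ _ e0) := @discrete_cvg t x t0.
by apply: filterS => n; rewrite -(real_linearB _ _ lC); exact/le_trans/cC.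
Qed.

Lemma flow0 x : T 0 x = x.
Proof.
apply: flow_unique => //; rewrite /D.
by under eq_fun do rewrite nsteps0; exact: cvg_cst.
Qed.

(* Uniform in the discretization, hence usable before passing to the limit. *)
Lemma discrete_at0 x e : 0 < e -> exists r, 0 < r /\
  forall t n, 0 <= t <= r -> `|D n t x - x| <= e.
Proof.
move=> e0; set a := expR w; have a0 : 0 < a := expR_gt0 _.
have [|y [L [yx yL]]] := cE x (e := e / (2 * (a + 1))).
  by rewrite divr_gt0// mulr_gt0// addr_gt0.
have L0 : 0 <= L.
  by have := le_trans (normr_ge0 _) (yL 1 ler01); rewrite mul1r.
have c0 : 0 < 2 * (L + 1) * a by rewrite !mulr_gt0// ltr_wpDl.
exists (Num.min 1 (e / (2 * (L + 1) * a))); split.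
  by rewrite lt_min ltr01 divr_gt0.
move=> t n /andP[t0]; rewrite le_min ler_pdivlMr// => /andP[t1 te].
have at1 : expR (w * t) <= a by rewrite ler_expR ler_piMr.
have H1 : `|D n t x - D n t y| <= a * `|y - x|.
  rewrite -(real_linearB _ _ (discrete_linear n t)) distrC.
  by apply: le_trans (discrete_le _ _ t0) _; rewrite ler_wpM2r.
have H2 : `|D n t y - y| <= t * L * a.
  by apply: le_trans (discrete_incr n t0 yL) _; rewrite ler_wpM2l// mulr_ge0.
have H3 : (a + 1) * `|y - x| <= e / 2.
  rewrite mulrC -ler_pdivlMr ?addr_gt0//; apply: le_trans yx _.
  by rewrite invfM mulrA.
rewrite -(subrKA (D n t y)) -(subrKA y (D n t y)).
apply: le_trans (ler_normD _ _) _.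
apply: le_trans (lerD (lexx _) (ler_normD _ _)) _.
have : t * L * a <= e / 2.
  have : t * a >= 0 by rewrite mulr_ge0// ltW.
  by move: te; rewrite !mulrDr mulr1 !mulrDl; lra.
by move: H3; rewrite mulrDl mul1r; lra.
Qed.

Lemma flow_cvg0 x : T t x @[t --> 0^'+] --> x.
Proof.
apply/cvg_at0P => e e0; have [r [r0 hr]] := discrete_at0 x e0.
exists r; split => // t /andP[/ltW t0 /ltW tr]; apply: flow_dist_le => //.
by apply: nearW => n; apply: hr; rewrite t0.
Qed.

(** A single step, being of vanishing length, moves nothing in the limit. *)
Lemma scheme_cvg0 x : E (step R n) x @[n --> \oo] --> x.
Proof.
apply/cvgrPdist_le => e e0.
set a := expR w; have a0 : 0 < a := expR_gt0 _.
have [|y [L [yx yL]]] := cE x (e := e / (2 * (a + 1))).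
  by rewrite divr_gt0// mulr_gt0// addr_gt0.
have cL : step R n * L @[n --> \oo] --> (0 : R).
  by rewrite -(mul0r L); apply: cvgM; [exact: cvg_step|exact: cvg_cst].
move/cvgrPdist_le : cL => /(_ (e / 2)); rewrite divr_gt0// => /(_ isT).
apply: filterS => n; rewrite sub0r normrN => /(le_trans (ler_norm _)) hL.
rewrite distrC -(subrKA (E (step R n) y)) -(subrKA y (E (step R n) y)).
apply: le_trans (ler_normD _ _) _.
apply: le_trans (lerD (lexx _) (ler_normD _ _)) _.
have H1 : `|E (step R n) x - E (step R n) y| <= a * `|y - x|.
  rewrite -(real_linearB _ _ (lE (st0 n))) distrC; apply: le_trans (bE _ (st0 n)) _.
  by rewrite ler_wpM2r// ler_expR ler_piMr// step_le1.
have H3 : (a + 1) * `|y - x| <= e / 2.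
  rewrite mulrC -ler_pdivlMr ?addr_gt0//; apply: le_trans yx _.
  by rewrite invfM mulrA.
have := yL _ (st0 n); move: H3; rewrite mulrDl mul1r; lra.
Qed.

(** The numbers of steps for s, t and s + t agree up to one step. *)
Lemma flowD s t x : 0 <= s -> 0 <= t -> T (s + t) x = T s (T t x).
Proof.
move=> s0 t0; apply: flow_unique; first exact: addr_ge0.
apply/cvgrPdist_le => e e0.
set a := expR (w * s); have a0 : 0 < a := expR_gt0 _.
set a' := expR (w * (s + t)); have a'0 : 0 < a' := expR_gt0 _.
have /cvgrPdist_le h1 := @discrete_cvg s (T t x) s0.
have /cvgrPdist_le h2 := @discrete_cvg t x t0.
have /cvgrPdist_le h3 := @scheme_cvg0 x.
have {}h1 := h1 (e / 3) (divr_gt0 e0 (ltr0n _ 3)).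
have {}h2 := h2 (e / 3 / a) (divr_gt0 (divr_gt0 e0 (ltr0n _ 3)) a0).
have {}h3 := h3 (e / 3 / a') (divr_gt0 (divr_gt0 e0 (ltr0n _ 3)) a'0).
apply: filterS3 h1 h2 h3 => n h1 h2 h3.
have H2 : `|D n s (T t x) - D n s (D n t x)| <= e / 3.
  rewrite -(real_linearB _ _ (discrete_linear n s)).
  apply: le_trans (discrete_le _ _ s0) _.
  by rewrite mulrC -ler_pdivlMr.
have H3 : `|D n s (D n t x) - D n (s + t) x| <= e / 3.
  rewrite /D -iterD; have [->|->] := nstepsD n s0 t0.
    by rewrite subrr normr0 divr_ge0// ltW.
  rewrite iterSr -(real_linearB _ _ (iter_scheme_linear _ (st0 n))).
  apply: le_trans (iter_scheme_le _ _ (st0 n)) _.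
  rewrite mulrC; apply: le_trans (_ : `|x - E (step R n) x| * a' <= _); last first.
    by rewrite -ler_pdivlMr.
  rewrite ler_wpM2l// ler_exp// natrD mulrDl.
  have /andP[? _] := nsteps_itv n s0; have /andP[? _] := nsteps_itv n t0; lra.
rewrite -(subrKA (D n s (T t x))) -(subrKA (D n s (D n t x)) (D n s (T t x))).
apply: le_trans (ler_normD _ _) _.
apply: le_trans (lerD (lexx _) (ler_normD _ _)) _.
by lra.
Qed.

(** Consistency of the scheme at y identifies the generator of the limit. *)
Lemma flow_gen y z :
  (forall e, 0 < e -> exists r, 0 < r /\
    forall h, 0 < h < r -> `|E h y - y - h *: z| <= h * e) ->
  gen T y z.
Proof.
move=> yz; apply/cvg_at0P => e e0.
set a := expR w; have a0 : 0 < a := expR_gt0 _.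
have [r1 [r10 hr1]] := discrete_at0 z (divr_gt0 e0 (ltr0n R 4)).
exists (Num.min 1 r1); split; first by rewrite lt_min ltr01.
move=> t /andP[t0]; rewrite lt_min => /andP[t1 tr].
have [r2 [r20 hr2]] := yz (e / 4 / a) (divr_gt0 (divr_gt0 e0 (ltr0n _ 4)) a0).
have -> : t^-1 *: (T t y - y) - z = t^-1 *: (T t y - (y + t *: z)).
  by rewrite opprD addrA [in RHS]scalerBr scalerA mulVf ?gt_eqF// scale1r.
rewrite normrZ gtr0_norm ?invr_gt0// ler_pdivrMl//.
apply: flow_dist_le; first exact: ltW.
have near1 : \forall n \near \oo, step R n < r2.
  have /cvgrPdist_lt /(_ _ r20) := @cvg_step R.
  by apply: filterS => n; rewrite sub0r normrN ger0_norm.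
have near2 : \forall n \near \oo,
    `|(t - (nsteps t n)%:R * step R n) *: z| <= t * (e / 4).
  have h : (t - (nsteps t n)%:R * step R n) *: z @[n --> \oo] --> (t - t) *: z.
    apply: cvgZ; last exact: cvg_cst.
    by apply: cvgB; [exact: cvg_cst|apply: cvg_nsteps; exact: ltW].
  rewrite subrr scale0r in h; move/cvgrPdist_le : h => /(_ (t * (e / 4))).
  rewrite mulr_gt0 ?divr_gt0// => /(_ isT); apply: filterS => n.
  by rewrite sub0r normrN.
apply: filterS2 near1 near2 => n n1 n2.
have h0 := step_gt0 R n.
have /andP[kt _] := nsteps_itv n (ltW t0).
have key k : (k <= nsteps t n)%N ->
  `|iter k (E (step R n)) y - y - (k%:R * step R n) *: z| <= k%:R * step R n * (e / 2).
  elim: k => [|k ih] kn; first by rewrite /= subrr sub0r mul0r scale0r normrN normr0 mul0r.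
  set h := step R n in n1 h0 kt ih *.
  have -> : iter k.+1 (E h) y - y - (k.+1%:R * h) *: z =
    iter k (E h) (E h y - y - h *: z) + h *: (iter k (E h) z - z) +
    (iter k (E h) y - y - (k%:R * h) *: z).
    have lI := iter_scheme_linear k (ltW h0).
    rewrite iterSr !(real_linearB _ _ lI) (real_linearZ _ _ lI).
    rewrite -natr1 mulrDl mul1r scalerDl scalerBr.
    set A := iter k _ (E h y); set B := iter k _ y; set C := h *: iter k _ z.
    set F := h *: z; set G := (_ * h) *: z.
    rewrite [A - B - C + _]addrA subrK opprD [- G - F]addrC addrA.
    by rewrite [A - B - F + _]addrAC [A - B + _]addrA [A - B + _]addrA subrK
      -[in RHS]addrA [- G - F]addrC addrA.
  have kh : 0 <= k%:R * h <= t.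
    apply/andP; split; first exact: mulr_ge0 (ler0n _ _) (ltW h0).
    apply: le_trans kt; rewrite ler_wpM2r ?(ltW h0)//.
    by rewrite ler_nat ltnW.
  have H1 : `|iter k (E h) (E h y - y - h *: z)| <= h * (e / 4).
    apply: le_trans (iter_scheme_le _ _ (ltW h0)) _.
    have ea : expR (w * (k%:R * h)) <= a.
      by rewrite ler_expR ler_piMr//; have /andP[_] := kh; lra.
    have := hr2 h; rewrite h0 n1 => /(_ isT) hyz.
    apply: le_trans (ler_pM (expR_ge0 _) (normr_ge0 _) ea hyz) _.
    by rewrite mulrCA ler_wpM2l ?(ltW h0)// mulrC divfK ?gt_eqF.
  have H2 : `|h *: (iter k (E h) z - z)| <= h * (e / 4).
    rewrite normrZ (gtr0_norm h0) ler_wpM2l ?(ltW h0)//.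
    have <- : D n (k%:R * h) z = iter k (E h) z.
      rewrite /D (@nsteps_eq _ _ n k)//; first by have /andP[] := kh.
      by rewrite lexx/= ltrDl.
    apply: hr1; have /andP[-> /= kht] := kh.
    exact: le_trans kht (ltW tr).
  have H3 := ih (ltnW kn).
  apply: le_trans (ler_normD _ _) _.
  apply: le_trans (lerD (ler_normD _ _) (lexx _)) _.
  by rewrite -natr1; set A := k%:R * h in H3 *; rewrite mulrDl mul1r -/A; lra.
have := key _ (leqnn _); rewrite -/(D n t y); set k := (nsteps t n)%:R in n2 kt *.
move=> H; have -> : D n t y - (y + t *: z) =
   D n t y - y - (k * step R n) *: z - (t - k * step R n) *: z.
  by rewrite scalerBl opprB addrA subrK opprD addrA.
apply: le_trans (ler_normB _ _) _.
have : k * step R n * (e / 2) <= t * (e / 2) by rewrite ler_wpM2r// divr_ge0// ltW.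
have : 0 <= t * e by rewrite mulr_ge0// ltW.
lra.
Qed.

(** The local errors, each at most w h |x| because S is contractive, add up to
   w t |x| times the growth of the scheme. *)
Lemma flow_dist (S : R -> X -> X) t x : contraction_semigroup S ->
  (forall h x, 0 <= h -> `|E h x - S h x| <= w * h * `|x|) -> 0 <= t ->
  `|T t x - S t x| <= w * t * expR (w * t) * `|x|.
Proof.
move=> hS ES t0.
have cS : S ((nsteps t n)%:R * step R n) x @[n --> \oo] --> S t x.
  have kh0 n : 0 <= (nsteps t n)%:R * step R n by rewrite mulr_ge0.
  have H := cvg_comp _ _ (cvg_nsteps t0) (@orbit_continuous _ _ _ hS x t).
  rewrite -{2}(ger0_norm t0).
  have -> : (fun n => S ((nsteps t n)%:R * step R n) x) =
      (fun s : R => S `|s| x) \o (fun n => (nsteps t n)%:R * step R n).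
    by apply/funext => n /=; rewrite (ger0_norm (kh0 n)).
  exact: H.
have : `|D n t x - S ((nsteps t n)%:R * step R n) x| @[n --> \oo] --> `|T t x - S t x|.
  by apply: cvg_norm; apply: cvgB => //; exact: discrete_cvg.
move=> /cvgr_to_le; apply; apply: nearW => n.
have /andP[kt _] := nsteps_itv n t0; rewrite /D.
set h := step R n in kt *; have h0 : 0 <= h := st0 n.
suff key k : `|iter k (E h) x - S (k%:R * h) x| <=
    k%:R * (w * h) * expR (w * (k%:R * h)) * `|x|.
  apply: le_trans (key _) _; rewrite ler_wpM2r// mulrCA.
  by apply: ler_pM; rewrite ?mulr_ge0// ?ler_wpM2l// ler_exp.
elim: k => [|k ih]; first by rewrite /= mul0r (csg0 hS) subrr normr0 !mul0r.
have kS : k.+1%:R * h = h + k%:R * h by rewrite -natr1 mulrDl mul1r addrC.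
rewrite [iter _ _ _]/= kS.
have kh0 : 0 <= k%:R * h by rewrite mulr_ge0.
rewrite (csgD hS)// -(subrKA (E h (S (k%:R * h) x))) -(real_linearB _ _ (lE h0)).
apply: le_trans (ler_normD _ _) _.
have H1 : `|E h (iter k (E h) x - S (k%:R * h) x)| <=
    k%:R * (w * h) * expR (w * (h + k%:R * h)) * `|x|.
  apply: le_trans (bE _ h0) _; apply: le_trans (ler_wpM2l (expR_ge0 _) ih) _.
  by rewrite [w * (h + _)]mulrDr expRD le_eqVlt; apply/orP; left; apply/eqP; ring.
have H2 : `|E h (S (k%:R * h) x) - S h (S (k%:R * h) x)| <=
    (w * h) * expR (w * (h + k%:R * h)) * `|x|.
  apply: le_trans (ES _ _ h0) _; rewrite -[leRHS]mulrA ler_wpM2l ?mulr_ge0//.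
  apply: le_trans (csg_contr hS _ kh0) _; apply: ler_peMl => //.
  by rewrite -[leLHS]expR0 ler_expR; apply: mulr_ge0 => //; exact: addr_ge0.
by rewrite -natr1 !mulrDl mul1r; lra.
Qed.

End scheme.

(** * Bounded perturbations in the extrapolated Favard class *)

Lemma contraction_fixed_point (R : realType) (V : completeNormedModType R)
  (f : V -> V) (q : R) : 0 <= q < 1 ->
  (forall x y, `|f x - f y| <= q * `|x - y|) -> exists p, p = f p.
Proof.
move=> /andP[q0 q1] fq.
have ctr : is_contraction (totalfun f).
  by exists (NngNum q0); split => // -[x y] _; exact: fq.
have [||p _ pE] := banach_fixed_point ctr; first exact: closedT.
  by exists 0.
by exists p.
Qed.

Section perturbation.
Context (R : realType) (X : completeNormedModType R).
Hypothesis nX : has_norming_functionals X.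
Variable S : R -> X -> X.
Hypothesis hS : contraction_semigroup S.
Variables (b d : X -> X) (K M mu : R).
Hypothesis lb : real_linear b.
Hypothesis ld : real_linear d.
Hypotheses (K0 : 0 <= K) (M0 : 0 <= M) (mu0 : 0 <= mu).
Hypothesis bK : forall t x, 0 <= t -> `|S t (b x) - b x| <= K * t * `|x|.
Hypothesis dM : forall x, `|d x| <= M * `|x|.
Local Notation W := (orbit_integral hS nX).

Let lS := csg_linear hS.
Let lW (t : R) (t0 : 0 <= t) := orbit_integral_linear hS nX t0.
Let SD t x y : 0 <= t -> S t (x + y) = S t x + S t y.
Proof. by move=> t0; exact: real_linearD (lS t0). Qed.
Let SB t x y : 0 <= t -> S t (x - y) = S t x - S t y.
Proof. by move=> t0; exact: real_linearB (lS t0). Qed.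
Let SZ t a x : 0 <= t -> S t (a *: x) = a *: S t x.
Proof. by move=> t0; exact: real_linearZ (lS t0). Qed.

(** The integral of S_{-1}(s) B x over [0, h], where B = d - A_{-1} b. *)
Definition input_map h x : X := W h (d x) - (S h (b x) - b x).
Local Notation V := input_map.
(** The state after one step under a constant feedback; mu V is the first order
   term of the variation of constants formula for the perturbation - mu B. *)
Definition euler h x : X := S h x - mu *: V h x.
Local Notation E := euler.
Definition growth : R := mu * (M + K).
Local Notation w := growth.

Lemma growth_ge0 : 0 <= w. Proof. by rewrite mulr_ge0// addr_ge0. Qed.
Let w0 := growth_ge0.

Lemma input_map_linear h : 0 <= h -> real_linear (V h).
Proof.
move=> h0 a x y; rewrite /V ld (lW h0) lb (lS h0).
rewrite scalerBr [in RHS]addrACA -opprD; congr (_ - _).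
by rewrite scalerBr opprD [in RHS]addrACA.
Qed.

Lemma input_map_le h x : 0 <= h -> `|V h x| <= (M + K) * h * `|x|.
Proof.
move=> h0; apply: le_trans (ler_normB _ _) _.
have H1 : `|W h (d x)| <= h * (M * `|x|).
  by apply: le_trans (orbit_integral_le hS nX _ h0) _; rewrite ler_wpM2l.
by have H2 := bK x h0; rewrite mulrDl mulrDl; lra.
Qed.

(** The cocycle identity of the input map: the effect of a constant input
   over two successive intervals. *)
Lemma input_mapD h x : 0 <= h -> V (h + h) x = V h x + S h (V h x).
Proof.
move=> h0; rewrite /V (orbit_integralD hS nX _ h0 h0) !SB// (csgD hS)//.
have aux (p q r s t : X) : p + q - (r - s) = p - (t - s) + (q - (r - t)).
  by rewrite addrACA -opprD addrC [t - s + _]addrC subrKA addrC.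
exact: aux.
Qed.

Lemma euler_linear h : 0 <= h -> real_linear (E h).
Proof.
move=> h0 a x y; rewrite /E (lS h0) (input_map_linear h0).
by rewrite [in RHS]scalerBr [in LHS]scalerDr opprD addrACA !scalerA [mu * a]mulrC.
Qed.

Lemma euler_le h x : 0 <= h -> `|E h x| <= expR (w * h) * `|x|.
Proof.
move=> h0; apply: le_trans (ler_normB _ _) _.
have H1 := csg_contr hS x h0.
have H2 : `|mu *: V h x| <= w * h * `|x|.
  by rewrite normrZ ger0_norm// /w -!mulrA ler_wpM2l// mulrA input_map_le.
apply: le_trans (lerD H1 H2) _; rewrite -{1}[`|x|]mul1r -mulrDl ler_wpM2r//.
exact: expR_ge1Dx.
Qed.

(** One step of size 2h against two steps of size h: the error is again of
   the form of a perturbation, applied to a small increment. *)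
Lemma euler_double h x : 0 <= h ->
  E (h + h) x - E h (E h x) = mu *: V h (E h x - x).
Proof.
move=> h0; have lV := input_map_linear h0.
rewrite -[E h (E h x)]/(S h (E h x) - mu *: V h (E h x)).
rewrite -[E (h + h) x]/(S (h + h) x - mu *: V (h + h) x) input_mapD// (csgD hS)//.
have -> : S h (E h x) = S h (S h x) - mu *: S h (V h x) by rewrite /E SB// SZ.
rewrite (real_linearB (E h x) x lV) scalerDr [in RHS]scalerBr.
have aux (p q r s : X) : p - (q + r) - (p - r - s) = s - q.
  rewrite (opprB (p - r)) addrC -addrA; congr (s + _).
  by rewrite opprB subrKA opprD addrCA subrr addr0.
exact: aux.
Qed.

Lemma euler_double_le h x : 0 <= h ->
  `|E (h + h) x - E h (E h x)| <= w * h * `|E h x - x|.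
Proof.
move=> h0; rewrite euler_double// normrZ ger0_norm//.
by rewrite /w -!mulrA ler_wpM2l// mulrA input_map_le.
Qed.

Lemma euler_dist h x : 0 <= h -> `|E h x - S h x| <= w * h * `|x|.
Proof.
move=> h0; rewrite /E addrC addrA addNr sub0r normrN normrZ ger0_norm//.
by rewrite /w -!mulrA ler_wpM2l// mulrA input_map_le.
Qed.

(** The domain of the generator of S is dense, and there both S h - 1 and V h are
   O(h). *)
Lemma euler_lipschitz x e : 0 < e ->
  exists y L, `|y - x| <= e /\ forall h, 0 <= h -> `|E h y - y| <= h * L.
Proof.
move=> e0; have [y [z [yz yx]]] := gen_dense nX hS x e0.
exists y, (`|z| + w * `|y|); split => // h h0.
rewrite -(subrKA (S h y)); apply: le_trans (ler_normD _ _) _.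
rewrite addrC mulrDr; apply: lerD.
  by rewrite (gen_increment nX hS yz h0); exact: orbit_integral_le.
by rewrite mulrCA mulrA euler_dist.
Qed.

(** The graph of A_{-1} - mu B, where B = d - A_{-1} b: the equation
   A_{-1} y - mu (d y - A_{-1} b y) = z with z in X means that y + mu b y is in the
   domain of A and is mapped to z + mu d y. *)
Definition perturbed_gen y z := gen S (y + mu *: b y) (z + mu *: d y).

Local Notation T := (flow E).

Lemma perturbed_flow y z : perturbed_gen y z -> gen T y z.
Proof.
move=> yz; apply: (flow_gen growth_ge0 euler_linear euler_le euler_double_le
  euler_lipschitz) => e e0.
have H : h^-1 *: (S h (y + mu *: b y) - (y + mu *: b y)) - mu *: (h^-1 *: W h (d y))
    @[h --> 0^'+] --> z + mu *: d y - mu *: d y.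
  by apply: cvgB => //; apply: cvgZ; [exact: cvg_cst|exact: orbit_integral_at0].
rewrite addrK in H.
have [r [r0 hr]] := (cvg_at0P _ _).1 H e e0.
exists r; split => // h /[dup] /andP[h0 _] /hr.
rewrite -(ler_pM2l h0) -{1}(gtr0_norm h0) -normrZ; congr (`|_| <= _).
have hK (x : X) : h *: (h^-1 *: x) = x by rewrite scalerA divff ?gt_eqF// scale1r.
rewrite !scalerBr ![h *: (mu *: _)]scalerA [h * mu]mulrC -![(mu * h) *: _]scalerA.
rewrite -[in LHS]scalerBr !hK; congr (_ - _).
rewrite SD ?SZ ?(ltW h0)// /E /V !scalerBr.
by rewrite !hK opprB opprD !addrA [LHS](ACl (1*2*4*5*3)).
Qed.

(** The operator B_l = l R(l, A_{-1}) B. *)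
Definition yosida_input l x := l *: res S l (d x) - l *: (l *: res S l (b x) - b x).
Local Notation BL := yosida_input.

Lemma yosida_input_linear l : 0 < l -> real_linear (BL l).
Proof.
move=> l0 a x y; have lr := res_linear nX hS l0.
rewrite /BL ld lb !lr.
have aux (p q r s p' q' r' s' : X) :
    p + p' - (q + q' - (r + r')) = p - (q - r) + (p' - (q' - r')).
  by rewrite [in RHS]addrACA -opprD [in RHS]addrACA -opprD.
have sw (c : R) (u : X) : c *: (a *: u) = a *: (c *: u) by rewrite !scalerA mulrC.
by rewrite !scalerBr !scalerDr !sw aux.
Qed.

Lemma yosida_input_le l x : 0 < l -> `|BL l x| <= (M + K) * `|x|.
Proof.
move=> l0; apply: le_trans (ler_normB _ _) _; rewrite mulrDl; apply: lerD.
  rewrite normrZ gtr0_norm//; apply: le_trans (res_le nX hS _ l0) _; exact: dM.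
rewrite normrZ gtr0_norm//; apply: favard_res => // t t0.
by rewrite mulrAC; exact: bK.
Qed.

(** The resolvent equation reads y = R(l) f - (mu / l) B_l y, where B_l is bounded by
   M + K: a contraction for l > w. *)
Lemma perturbed_gen_surj l f : 0 < l -> w < l ->
  exists y, perturbed_gen y (l *: y - f).
Proof.
move=> l0 wl; have lr := res_linear nX hS l0.
have [|x y|y yE] := @contraction_fixed_point _ X
  (fun y => res S l f - (mu / l) *: BL l y) (w / l).
- by rewrite ltr_pdivrMr// mul1r wl andbT divr_ge0// ?growth_ge0// ltW.
- rewrite opprB addrC addrA subrK -scalerBr -(real_linearB _ _ (yosida_input_linear l0)).
  rewrite normrZ ger0_norm ?divr_ge0// ?(ltW l0)// [`|x - y|]distrC.
  apply: le_trans (ler_wpM2l _ (yosida_input_le _ l0)) _; first by rewrite divr_ge0// ltW.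
  by rewrite /w mulrA [mu / l * _]mulrAC.
exists y; rewrite /perturbed_gen.
have pE : y + mu *: b y = res S l (f - mu *: d y + (l * mu) *: b y).
  rewrite (real_linearD _ _ lr) (real_linearB _ _ lr) !(real_linearZ _ _ lr).
  rewrite {1}yE /BL !scalerBr !scalerA divfK ?gt_eqF//.
  by rewrite [mu * l]mulrC opprB !addrA [LHS](ACl (1*4*2*5*3))/= addrK.
rewrite pE; have := @resP _ _ nX _ hS l (f - mu *: d y + (l * mu) *: b y) l0.
rewrite -pE; congr gen; rewrite scalerDr scalerA opprD addrACA subrr addr0.
by rewrite opprB addrA addrAC.
Qed.

(** The generator of the flow extends the perturbed operator, and l minus the
   former is injective while l minus the latter is surjective. *)
Lemma perturbed_genP y z : gen T y z <-> perturbed_gen y z.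
Proof.
split; last exact: perturbed_flow.
move=> yz; pose l := w + 1.
have wl : w < l by rewrite ltrDl.
have l0 : 0 < l by apply: le_lt_trans wl; exact: growth_ge0.
have [y' hy'] := perturbed_gen_surj (l *: y - z) l0 wl.
have lT t : 0 <= t -> real_linear (T t).
  exact: (flow_linear growth_ge0 euler_linear euler_le euler_double_le euler_lipschitz).
have := @gen_linear _ _ T (-1) _ _ _ _ lT (perturbed_flow hy') yz.
rewrite !scaleN1r.
have -> : - (l *: y' - (l *: y - z)) + z = l *: (- y' + y).
  by rewrite opprB addrAC subrK scalerDr scalerN addrC.
set v := - y' + y => hv.
suff v0 : v = 0.
  have yy : y' = y by apply/esym/eqP; rewrite -subr_eq0 addrC -/v v0.
  by move: hy'; rewrite yy opprB addrC subrK.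
apply/eqP; rewrite -normr_le0.
have [psi hpsi psiv] := nX v.
have H1 : psi (h^-1 *: (T h v - v)) @[h --> 0^'+] --> psi (l *: v).
  exact: functional_cvg.
have H2 : h^-1 * (expR (w * h) - 1) * `|v| @[h --> 0^'+] --> w * `|v|.
  by apply: cvgM; [exact: cvg_expR_slope|exact: cvg_cst].
have : psi (l *: v) <= w * `|v|.
  apply: ler_cvg_to H1 H2 _; exists 1 => //= h _ h0.
  rewrite functionalZ// functionalB// psiv -mulrA ler_wpM2l ?invr_ge0 ?(ltW h0)//.
  rewrite mulrBl mul1r lerB//; apply: le_trans (functional_le hpsi _) _.
  exact: (flow_le growth_ge0 euler_linear euler_le euler_double_le euler_lipschitz _ (ltW h0)).
by rewrite functionalZ// psiv /l mulrDl mul1r -lerBrDl subrr.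
Qed.

(** A Desch--Schappacher theorem: the perturbed operator generates a semigroup
   of type (1, w), close to S for short times.  The last clause, applied to the
   multiplications by scalars, makes that semigroup linear over the complex
   numbers when S, b and d are. *)
Theorem perturbed_semigroup : exists U : R -> X -> X,
  [/\ growth_semigroup w U, forall y z, gen U y z <-> perturbed_gen y z,
    forall t x, 0 <= t -> `|U t x - S t x| <= w * t * expR (w * t) * `|x| &
    forall C : X -> X, real_linear C -> (forall x, `|C x| <= `|x|) ->
      (forall t x, 0 <= t -> C (S t x) = S t (C x)) ->
      (forall x, C (b x) = b (C x)) -> (forall x, C (d x) = d (C x)) ->
      forall t x, 0 <= t -> C (U t x) = U t (C x)].
Proof.
exists T; split; last 3 first.
- exact: perturbed_genP.
- move=> t x t0; exact: (flow_dist growth_ge0 euler_linear euler_le euler_double_le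
    euler_lipschitz _ hS euler_dist).
- move=> C lC cC SC bC dC t x.
  apply: (flow_commute growth_ge0 euler_linear euler_le euler_double_le
    euler_lipschitz) => // h y h0.
  rewrite /E /V !(real_linearB _ _ lC) (real_linearZ _ _ lC) !(real_linearB _ _ lC).
  by rewrite orbit_integral_commute// !SC// dC bC.
- split=> [t t0|t x t0|x|s t x s0 t0|x].
  + exact: (flow_linear growth_ge0 euler_linear euler_le euler_double_le euler_lipschitz).
  + exact: (flow_le growth_ge0 euler_linear euler_le euler_double_le euler_lipschitz).
  + exact: (flow0 growth_ge0 euler_linear euler_le euler_double_le euler_lipschitz).
  + exact: (flowD growth_ge0 euler_linear euler_le euler_double_le euler_lipschitz).
  + exact: (@flow_cvg0 _ _ _ _ growth_ge0 euler_linear euler_le euler_double_le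
      euler_lipschitz x).
Qed.

End perturbation.

(** * Inputs concentrated near the final time *)

Section impulses.
Context (R : realType) (X : completeNormedModType R).
Hypothesis nX : has_norming_functionals X.
Variable S : R -> X -> X.
Hypothesis hS : contraction_semigroup S.
Local Notation W := (orbit_integral hS nX).
Local Notation cmu := (@completed_lebesgue_measure R).
Local Notation cT := (caratheodory_type (wlength (@idfun R))^*%mu).

Lemma reversed_orbit_continuous (psi : X -> R) (T : R) y : unit_functional psi ->
  continuous (fun s : R => psi (S `|T - s| y)).
Proof.
move=> hpsi s; apply: (functional_cvg hpsi).
apply: (@continuous_comp _ _ _ (fun s : R => T - s) (fun r : R => S `|r| y)).
  by apply: cvgB; [exact: cvg_cst|exact: cvg_id].
exact: orbit_continuous.
Qed.

Lemma reversed_orbit_integral (psi : X -> R) (T t : R) y : unit_functional psi ->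
  0 < t < T ->
  (\int[cmu]_(s in `[(T - t)%R, T[) (psi (S `|T - s| y))%:E = (psi (W t y))%:E)%E.
Proof.
move=> hpsi /andP[t0 tT].
have cg := @reversed_orbit_continuous psi T y hpsi.
rewrite completed_integral_co//.
have [G [dG ->]] := continuous_primitive (-1) cg; last 2 first.
- lra.
- by rewrite gerBl ltW.
have [F [dF ->]] := orbit_primitive hS nX y hpsi; last exact: ltW.
congr EFin.
pose H s := G (T - t + s) + F (t - s).
have dH (s : R) : - 1 < s < t + 1 -> is_derive s 1 H 0.
  move=> /andP[s1 st]; have d1 : - 1 < T - t + s by lra.
  have d2 : - 1 < t - s by lra.
  have := @is_deriveD _ _ _ _ _ _ _ _ _
    (is_derive_shiftr (dG _ d1)) (is_derive_reflect (dF _ d2)).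
  have -> : T - (T - t + s) = t - s by ring.
  by rewrite subrr.
have le1 : H t - H 0 <= t * 0.
  by apply: (increment_le_itv (h := cst 0)) => //; exact: ltW.
have le2 : - (H t - H 0) <= t * 0.
  have := @increment_le_itv _ (- H) (cst 0) t 0 (ltW t0) _ (fun _ _ => lexx 0).
  rewrite /= !fctE opprB => h; apply: le_trans (h _); first by rewrite addrC opprK.
  by move=> s st; rewrite -[X in is_derive _ _ _ X]oppr0; apply: is_deriveN; exact: dH.
move: le1 le2; rewrite /H addr0 subr0 !subrr mulr0.
have -> : T - t + t = T by ring.
lra.
Qed.

Variables (T : R) (t : nat -> R) (y : nat -> X) (c : nat -> R) (C : R).
Hypothesis tT : forall n, 0 < t n < T.
Hypothesis yc : forall n, `|y n| <= c n.
Hypothesis cC : forall N, \sum_(n < N) c n <= C.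
Hypothesis t_small : forall s, s < T -> exists N, forall n, (N <= n)%N -> t n < T - s.

(** Inputs that concentrate near the final time T: the n-th one is constant, of
   total mass y n, over the last t n units of time. *)
Definition impulse (n : nat) (s : R) : X :=
  if T - t n <= s then (t n)^-1 *: y n else 0.
Definition impulse_sum N s : X := \sum_(n < N) impulse n s.

Let stable s N M : (forall n, (N <= n)%N -> t n < T - s) -> (N <= M)%N ->
  impulse_sum M s = impulse_sum N s.
Proof.
move=> h; elim: M => [|M ih]; first by rewrite leqn0 => /eqP ->.
rewrite leq_eqVlt ltnS => /predU1P[->//|NM].
rewrite /impulse_sum big_ord_recr/= -/(impulse_sum M s) ih// /impulse.
case: ifP => [hM|_]; last by rewrite addr0.
by exfalso; have := h M NM; lra.
Qed.

Definition impulse_series s : X :=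
  if pselect (s < T) is left sT then impulse_sum (projT1 (cid (t_small sT))) s else 0.

Lemma impulse_seriesE s N : (forall n, (N <= n)%N -> t n < T - s) ->
  impulse_series s = impulse_sum N s.
Proof.
move=> h; rewrite /impulse_series; case: pselect => [sT|]; last first.
  move=> sT; exfalso; apply: sT; have := h N (leqnn _).
  by have /andP[+ _] := tT N; lra.
case: cid => M hM /=; have [MN|NM] := leqP M N.
  by rewrite (stable hM MN).
by rewrite (stable h (ltnW NM)).
Qed.

Let impulse_right n s : exists e, 0 < e /\
  forall r, s <= r < s + e -> impulse n r = impulse n s.
Proof.
rewrite /impulse; have [h|h] := leP (T - t n) s.
  by exists 1; split => // r /andP[sr _]; rewrite (le_trans h sr).
exists (T - t n - s); split => [|r /andP[sr rs]]; first by rewrite subr_gt0.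
by rewrite ifF//; apply/negbTE; rewrite -ltNge; move: rs; rewrite addrC subrK.
Qed.

Let impulse_sum_right N s : exists e, 0 < e /\
  forall r, s <= r < s + e -> impulse_sum N r = impulse_sum N s.
Proof.
elim: N => [|N [e [e0 he]]].
  by exists 1; split => // r _; rewrite /impulse_sum !big_ord0.
have [e' [e'0 he']] := impulse_right N s.
exists (Num.min e e'); split; first by rewrite lt_min e0.
move=> r /andP[sr]; rewrite -ltrBlDl lt_min !ltrBlDl => /andP[r1 r2].
rewrite /impulse_sum !big_ord_recr/= -!/(impulse_sum N _).
by rewrite he ?sr// he' ?sr.
Qed.

Lemma impulse_series_right s : s < T -> exists e, 0 < e /\
  forall r, s <= r < s + e -> impulse_series r = impulse_series s.
Proof.
move=> sT; have [|N hN] := @t_small ((s + T) / 2); first lra.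
have [e [e0 he]] := impulse_sum_right N s.
exists (Num.min e ((T - s) / 2)); split; first by rewrite lt_min e0; lra.
move=> r /andP[sr]; rewrite -ltrBlDl lt_min !ltrBlDl => /andP[r1 r2].
rewrite !(@impulse_seriesE _ N) ?he ?sr// => n /hN; lra.
Qed.

Let D : set cT := `]0, T[%classic.
Let I n : set cT := `[T - t n, T[%classic.
Let mD : measurable D. Proof. by apply: completed_measurable; exact: measurable_itv. Qed.
Let mI n : measurable (I n). Proof. by apply: completed_measurable; exact: measurable_itv. Qed.
Let ID n : I n `<=` D.
Proof.
move=> s; rewrite /I /D /= !in_itv/= => /andP[h1 ->]; rewrite andbT.
by have /andP[_] := tT n; lra.
Qed.
Let mu_I n : cmu (I n) = (t n)%:E.
Proof.
rewrite completed_itv/= lte_fin ifT; last by rewrite gtrBl; have /andP[] := tT n.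
by rewrite -EFinB; congr EFin; ring.
Qed.

Let c0 n : 0 <= c n := le_trans (normr_ge0 _) (yc n).

(* The integral of this majorant is at most the sum of the masses. *)
Let maj (s : cT) : \bar R := (\sum_(n <oo) ((t n)^-1 * c n * \1_(I n) s)%:E)%E.

Let maj_term_ge0 n s : (0 <= ((t n)^-1 * c n * \1_(I n) s)%:E)%E.
Proof.
by rewrite lee_fin !mulr_ge0// invr_ge0 ltW//; have /andP[] := tT n.
Qed.

Let maj_measurable_term n : measurable_fun D (fun s => ((t n)^-1 * c n * \1_(I n) s)%:E).
Proof. by apply/measurable_EFinP; apply: measurable_funM => //; exact: measurable_indic. Qed.

Let int_indic n (f : cT -> R) : measurable_fun D f ->
  (\int[cmu]_(s in D) ((f s) * \1_(I n) s)%:E = \int[cmu]_(s in I n) (f s)%:E)%E.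
Proof.
move=> mf; have {2}-> : I n = D `&` I n by rewrite setIidr//; exact: ID.
rewrite integral_mkcondr; apply: eq_integral => s _.
by rewrite /patch indicE; case: ifP; rewrite ?mulr1 ?mulr0.
Qed.

Lemma maj_integral : (\int[cmu]_(s in D) maj s <= C%:E)%E.
Proof.
rewrite integral_nneseries//.
apply: lime_le; first by apply: is_cvg_nneseries => n _ _; exact: integral_ge0.
apply: nearW => N; rewrite big_mkord; apply: le_trans (_ : (\sum_(n < N) (c n)%:E <= _)%E).
  apply: lee_sum => n _; rewrite (@int_indic n (cst ((t n)^-1 * c n)))//.
  rewrite [leLHS](integral_cst cmu (mI n) ((t n)^-1 * c n)%:E) [X in (_ * X)%E](mu_I n) -EFinM lee_fin mulrAC mulVf ?mul1r//.
  by rewrite gt_eqF//; have /andP[] := tT n.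
by rewrite sumEFin lee_fin.
Qed.

Let maj_measurable : measurable_fun D maj.
Proof. exact: ge0_emeasurable_sum. Qed.

Let maj_integrable : cmu.-integrable D maj.
Proof.
apply/integrableP; split => //.
under eq_integral do rewrite gee0_abs ?nneseries_ge0//.
exact: le_lt_trans maj_integral (ltry _).
Qed.

Let norm_impulse n s : D s -> `|impulse n s| <= (t n)^-1 * c n * \1_(I n) s.
Proof.
rewrite /D/= in_itv/= => /andP[_ sT]; rewrite /impulse indicE mem_setE/= in_itv/= sT andbT.
case: ifP => _; last by rewrite normr0 mulr0.
have ti : 0 <= (t n)^-1 by rewrite invr_ge0 ltW//; have /andP[] := tT n.
by rewrite mulr1 normrZ ger0_norm// ler_wpM2l.
Qed.

Lemma norm_impulse_sum N s : D s -> ((`|impulse_sum N s|)%:E <= maj s)%E.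
Proof.
move=> Ds; apply: le_trans (nneseries_lim_ge N _) => //.
rewrite big_mkord sumEFin lee_fin.
apply: le_trans (ler_norm_sum _ _ _) _; apply: ler_sum => n _.
exact: norm_impulse.
Qed.

Lemma norm_impulse_series s : D s -> ((`|impulse_series s|)%:E <= maj s)%E.
Proof.
move=> Ds; have sT : s < T by move: Ds; rewrite /D/= in_itv/= => /andP[].
have [N hN] := t_small sT; rewrite (impulse_seriesE hN); exact: norm_impulse_sum.
Qed.

Lemma impulse_series_dominated : exists g : cT -> \bar R,
  cmu.-integrable D g /\ forall s, D s -> ((`|impulse_series s|)%:E <= g s)%E.
Proof. by exists maj; split => //; exact: norm_impulse_series. Qed.

Variables (b : X -> X) (Mb : R).
Hypothesis lb : real_linear b.
Hypothesis Mb0 : 0 <= Mb.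
Hypothesis bM : forall x, `|b x| <= Mb * `|x|.
Hypothesis T0 : 0 < T.

Let b_sum (J : Type) (r : seq J) (F : J -> X) :
  b (\sum_(i <- r) F i) = \sum_(i <- r) b (F i).
Proof.
by apply: big_morph; [move=> u v; exact: real_linearD|exact: real_linear0].
Qed.

Let bounded_integrable (f : cT -> R) (m : R) : measurable_fun D f ->
  (forall s, D s -> `|f s| <= m) -> cmu.-integrable D (EFin \o f).
Proof.
move=> mf fm; apply/integrableP; split; first exact/measurable_EFinP.
apply: (@le_lt_trans _ _ (\int[cmu]_(s in D) (cst m%:E s))%E).
  apply: ge0_le_integral => //.
  by apply: measurableT_comp => //; exact/measurable_EFinP.
rewrite [X in (X < _)%E](integral_cst cmu mD m%:E).
rewrite [X in (_ * X)%E](completed_itv `]0, T[)/= lte_fin T0.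
by rewrite -EFinB -EFinM ltry.
Qed.

Let pairing (psi : X -> R) n (s : R) := (t n)^-1 * psi (S `|T - s| (b (y n))).

Let pairing_measurable psi n E : unit_functional psi ->
  measurable_fun (E : set cT) (pairing psi n).
Proof.
move=> hpsi; apply: measurable_funM => //; apply: measurable_funTS.
apply: completed_measurable_fun => //; apply: continuous_measurable_fun.
exact: reversed_orbit_continuous.
Qed.

Let pairing_sum psi N s : unit_functional psi -> D s ->
  psi (S (T - s) (b (impulse_sum N s))) =
  \sum_(n < N) pairing psi n s * \1_(I n) s.
Proof.
move=> hpsi; rewrite /D/= in_itv/= => /andP[_ sT].
have Ts : 0 <= T - s by lra.
rewrite b_sum; have hpsi' := functional_csg hS Ts hpsi.
rewrite -[LHS]/((psi \o S (T - s)) _) (functional_sum hpsi').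
apply: eq_bigr => n _; rewrite /impulse indicE mem_setE/= in_itv/= sT andbT.
case: ifP => _; last by rewrite real_linear0// (real_linear0 (csg_linear hS Ts)) functional0// mulr0.
rewrite real_linearZ// (real_linearZ _ _ (csg_linear hS Ts)) functionalZ// mulr1.
by rewrite /pairing ger0_norm.
Qed.

Lemma impulse_sum_integral (psi : X -> R) N : unit_functional psi ->
  measurable_fun D (fun s => (psi (S (T - s) (b (impulse_sum N s))))%:E) /\
  (\int[cmu]_(s in D) (psi (S (T - s) (b (impulse_sum N s))))%:E =
   (psi (\sum_(n < N) (t n)^-1 *: W (t n) (b (y n))))%:E)%E.
Proof.
move=> hpsi.
have mterm n : measurable_fun D (fun s => pairing psi n s * \1_(I n) s).
  apply: measurable_funM; first exact: pairing_measurable.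
  exact: measurable_indic.
have iterm n : cmu.-integrable D (fun s => (pairing psi n s * \1_(I n) s)%:E).
  apply: (@bounded_integrable _ ((t n)^-1 * `|b (y n)|)) => // s _.
  have ti : 0 <= (t n)^-1 by rewrite invr_ge0 ltW//; have /andP[] := tT n.
  rewrite normrM; apply: le_trans (_ : `|pairing psi n s| * 1 <= _).
    by rewrite ler_wpM2l// indicE; case: (_ \in _); rewrite ?normr1 ?normr0.
  rewrite mulr1 /pairing normrM ger0_norm// ler_wpM2l//.
  by apply: le_trans (hpsi.2 _) _; exact: csg_contr.
split.
  have : measurable_fun D (fun s => (\sum_(n < N) pairing psi n s * \1_(I n) s)%:E).
    by apply/measurable_EFinP; apply: measurable_sum.
  by apply: eq_measurable_fun => s; rewrite inE => Ds; rewrite pairing_sum.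
rewrite (eq_integral (fun s : cT => \sum_(n < N) (pairing psi n s * \1_(I n) s)%:E)%E); last first.
  by move=> s; rewrite inE => Ds; rewrite pairing_sum// sumEFin.
rewrite integral_sum// functional_sum// -sumEFin; apply: eq_bigr => n _.
rewrite (@int_indic n (pairing psi n)); last exact: pairing_measurable.
under eq_integral do rewrite EFinM.
rewrite integralZl//; last first.
  apply: (integrableS mD (mI n) (@ID n)).
  apply: (@bounded_integrable _ `|b (y n)|) => [|s _].
    apply: measurable_funTS; apply: completed_measurable_fun => //.
    by apply: continuous_measurable_fun; exact: reversed_orbit_continuous.
  by apply: le_trans (hpsi.2 _) _; exact: csg_contr.
by rewrite reversed_orbit_integral// functionalZ// EFinM.
Qed.

(** By dominated convergence, the majorant being the series of impulses. *)
Lemma impulse_series_weak (psi : X -> R) xi : unit_functional psi ->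
  (\int[cmu]_(s in D) (psi (S (T - s) (b (impulse_series s))))%:E = (psi xi)%:E)%E ->
  psi (\sum_(n < N) (t n)^-1 *: W (t n) (b (y n))) @[N --> \oo] --> psi xi.
Proof.
move=> hpsi hxi.
pose f N (s : cT) : \bar R := (psi (S (T - s) (b (impulse_sum N s))))%:E.
pose g (s : cT) : \bar R := (psi (S (T - s) (b (impulse_series s))))%:E.
have mf N : measurable_fun D (f N) by have [] := impulse_sum_integral N hpsi.
have fg s : D s -> f n s @[n --> \oo] --> g s.
  rewrite /D/= in_itv/= => /andP[_ sT]; have [N hN] := t_small sT.
  apply: cvg_near_cst; exists N => // n /= Nn.
  by rewrite /f /g (impulse_seriesE hN) (stable hN Nn).
have mg : measurable_fun D g.
  by apply: emeasurable_fun_cvg mf fg.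
have dom s n : D s -> (`|f n s| <= Mb%:E * maj s)%E.
  move=> Ds; have [s0 sT] : 0 < s /\ s < T by move: Ds; rewrite /D/= in_itv/= => /andP[].
  have Ts : 0 <= T - s by rewrite subr_ge0 ltW.
  apply: (@le_trans _ _ (Mb%:E * (`|impulse_sum n s|)%:E)%E); last first.
    by apply: lee_wpmul2l; [rewrite lee_fin|exact: norm_impulse_sum].
  rewrite -EFinM lee_fin; apply: le_trans (hpsi.2 _) _.
  exact: le_trans (csg_contr hS _ Ts) (bM _).
have [] := @dominated_convergence _ _ _ cmu D mD f g (fun s => Mb%:E * maj s)%E.
- by [].
- by [].
- by apply: aeW.
- exact: integrableZl.
- by apply: aeW => s Ds n; exact: dom.
move=> _ _ H; have : (psi (\sum_(n < N) (t n)^-1 *: W (t n) (b (y n))))%:E @[N --> \oo]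
    --> (psi xi)%:E.
  rewrite -hxi.
  have -> : (fun N => (psi (\sum_(n < N) (t n)^-1 *: W (t n) (b (y n))))%:E) =
      (fun N => \int[cmu]_(s in D) f N s)%E.
    by apply/funext => N; have [_ ->] := impulse_sum_integral N hpsi.
  exact: H.
by move=> /fine_cvg.
Qed.

End impulses.

(** * Admissibility implies the Favard estimate *)

Section admissibility.
Context (R : realType) (X : completeNormedModType R).
Hypothesis nX : has_norming_functionals X.
Variable S : R -> X -> X.
Hypothesis hS : contraction_semigroup S.
Local Notation W := (orbit_integral hS nX).
Local Notation cmu := (@completed_lebesgue_measure R).
Local Notation cT := (caratheodory_type (wlength (@idfun R))^*%mu).
Variables (b : X -> X) (Mb T : R).
Hypothesis lb : real_linear b.
Hypothesis Mb0 : 0 <= Mb.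
Hypothesis bM : forall x, `|b x| <= Mb * `|x|.
Hypothesis T0 : 0 < T.
Hypothesis admissible : forall u : R -> X,
  (forall s, s < T -> exists e, 0 < e /\ forall r, s <= r < s + e -> u r = u s) ->
  (exists g : cT -> \bar R, cmu.-integrable (`]0, T[%classic : set cT) g /\
     forall s : cT, (`]0, T[%classic : set cT) s -> ((`|u s|)%:E <= g s)%E) ->
  exists xi z, gen S xi z /\ forall psi : X -> R, unit_functional psi ->
    (\int[cmu]_(s in (`]0%R, T[%classic : set cT)) (psi (S (T - s) (b (u s))))%:E
     = (psi xi)%:E)%E.

Let lS := csg_linear hS.
Let lW (t : R) (t0 : 0 <= t) := orbit_integral_linear hS nX t0.

Let quot h y := h^-1 *: (S h y - y).
Let mean t x := t^-1 *: W t (b x).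

Let quot_linear h : 0 < h -> real_linear (quot h).
Proof.
move=> h0 a x y; rewrite /quot (lS (ltW h0)) opprD addrACA -scalerBr scalerDr.
by rewrite !scalerA mulrC.
Qed.

Let mean_linear t : 0 < t -> real_linear (mean t).
Proof.
move=> t0 a x y; rewrite /mean lb (lW (ltW t0)) scalerDr.
by rewrite !scalerA mulrC.
Qed.

Let mean_le t x : 0 < t -> `|mean t x| <= Mb * `|x|.
Proof.
move=> t0; rewrite normrZ gtr0_norm ?invr_gt0// ler_pdivrMl//.
by apply: le_trans (orbit_integral_le hS nX _ (ltW t0)) _; rewrite ler_wpM2l// ltW.
Qed.

Let quot_le h y : 0 < h -> `|quot h y| <= h^-1 * (2 * `|y|).
Proof.
move=> h0; rewrite normrZ gtr0_norm ?invr_gt0// ler_wpM2l ?invr_ge0 ?(ltW h0)//.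
apply: le_trans (ler_normB _ _) _; have := csg_contr hS y (ltW h0); lra.
Qed.

Let quot_mean h t x : 0 < h -> 0 < t ->
  quot h (mean t x) = (t^-1 * h^-1) *: W h (S t (b x) - b x).
Proof.
move=> h0 t0; rewrite orbit_integral_swap ?ltW// /quot /mean.
by rewrite (real_linearZ _ _ (lS (ltW h0))) -scalerBr !scalerA mulrC.
Qed.

Let diff_le t x : 0 <= t -> `|S t (b x) - b x| <= 2 * Mb * `|x|.
Proof.
move=> t0; apply: le_trans (ler_normB _ _) _.
by have := csg_contr hS (b x) t0; have := bM x; rewrite -mulrA; lra.
Qed.

Let quot_mean_le h t x : 0 < h -> 0 < t ->
  `|quot h (mean t x)| <= t^-1 * `|S t (b x) - b x|.
Proof.
move=> h0 t0; rewrite quot_mean// normrZ normrM !gtr0_norm ?invr_gt0//.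
rewrite -mulrA ler_wpM2l ?invr_ge0 ?(ltW t0)// ler_pdivrMl//.
exact: orbit_integral_le (ltW h0).
Qed.

Section unbounded.
Hypothesis unb : forall K, 0 <= K -> exists t x, 0 <= t /\
  K * t * `|x| < `|S t (b x) - b x|.

Let unb1 K : 0 <= K -> exists t x, [/\ 0 < t < T, `|x| <= 1 &
  K * t < `|S t (b x) - b x|].
Proof.
move=> K0; have K0' : 0 <= K + 2 * Mb / T by rewrite addr_ge0// divr_ge0 ?mulr_ge0// ltW.
have [t [x [t0 hx]]] := unb K0'.
have x0 : 0 < `|x|.
  rewrite lt_def normr_ge0 andbT; apply/negP => /eqP x0.
  by have := diff_le x t0; move: hx; rewrite x0 !mulr0; lra.
have tp : 0 < t.
  rewrite lt_def t0 andbT; apply/negP => /eqP t00.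
  by move: hx; rewrite t00 (csg0 hS) subrr normr0 mulr0 mul0r ltxx.
have d1 := diff_le x t0.
have d2 : K * t * `|x| + 2 * Mb / T * t * `|x| < 2 * Mb * `|x| by lra.
have d3 : (K * t + 2 * Mb / T * t) < 2 * Mb.
  by rewrite -(ltr_pM2r x0) mulrDl.
have tT : t < T.
  rewrite ltNge; apply/negP => Tt.
  have : 2 * Mb <= 2 * Mb / T * t.
    by rewrite -mulrA ler_peMr ?mulr_ge0// ler_pdivlMl// mulr1.
  have : 0 <= K * t by rewrite mulr_ge0.
  lra.
exists t, (`|x|^-1 *: x); split; first by rewrite tp.
  by rewrite normrZ normfV normr_id mulVf ?gt_eqF.
rewrite real_linearZ// (real_linearZ _ _ (lS t0)) -scalerBr normrZ normfV normr_id.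
rewrite ltr_pdivlMl// mulrC; apply: le_lt_trans hx.
by rewrite ler_wpM2r// ler_wpM2r// lerDl divr_ge0 ?mulr_ge0// ltW.
Qed.

(* For each n a step h, a duration t and a vector x of the unit ball for which the
   difference quotient at h of the mean value is at least 16^n and, up to a factor 2, the
   largest possible for that h. *)
Let near_max n : exists p : R * R * X, [/\ 0 < p.1.1, 0 < p.1.2 < T, `|p.2| <= 1,
  16 ^+ n <= `|quot p.1.1 (mean p.1.2 p.2)| &
  forall t x, 0 < t < T -> `|x| <= 1 ->
    `|quot p.1.1 (mean t x)| <= 2 * `|quot p.1.1 (mean p.1.2 p.2)|].
Proof.
have [|t [x [/andP[t0 tT] x1 tx]]] := @unb1 (2 * 16 ^+ n + 1).
  by rewrite addr_ge0// mulr_ge0// exprn_ge0.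
have [h [h0 hq]] : exists h, 0 < h /\ 2 * 16 ^+ n <= `|quot h (mean t x)|.
  have H : t^-1 *: (h^-1 *: W h (S t (b x) - b x)) @[h --> 0^'+] -->
      t^-1 *: (S t (b x) - b x).
    by apply: cvgZ; [exact: cvg_cst|exact: orbit_integral_at0].
  have [d [d0 hd]] := (cvg_at0P _ _).1 H 1 ltr01.
  have d2 : 0 < d / 2 < d by rewrite divr_gt0//= gtr_pMr// invf_lt1// ltr1n.
  exists (d / 2); have d20 : 0 < d / 2 by have /andP[] := d2.
  split => //; have := hd _ d2; rewrite quot_mean// -scalerA.
  set v := _ *: (_ *: _) => hv.
  have : `|t^-1 *: (S t (b x) - b x)| <= `|v| + 1.
    rewrite -[X in `|X|](subrK v) addrC; apply: le_trans (ler_normD _ _) _.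
    by rewrite lerD2l distrC.
  rewrite normrZ gtr0_norm ?invr_gt0// => hle.
  have : 2 * 16 ^+ n + 1 < t^-1 * `|S t (b x) - b x| by rewrite ltr_pdivlMl// mulrC.
  lra.
pose E := [set r | exists t x, [/\ 0 < t < T, `|x| <= 1 & r = `|quot h (mean t x)|]].
have Ex : E `|quot h (mean t x)| by exists t, x; rewrite t0.
have Eub : ubound E (h^-1 * (2 * Mb)).
  move=> _ [t' [x' [/andP[t'0 _] x'1 ->]]].
  apply: le_trans (quot_le _ h0) _; rewrite ler_wpM2l ?invr_ge0 ?(ltW h0)//.
  rewrite ler_wpM2l//; apply: le_trans (mean_le _ t'0) _.
  by rewrite ler_piMr.
have supE : has_sup E by split; [exists (`|quot h (mean t x)|) | exists (h^-1 * (2 * Mb))].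
have p16 : 0 < 16 ^+ n :> R by rewrite exprn_gt0.
have le_sup r : E r -> r <= sup E by move=> Er; apply: ub_le_sup => //; exact: supE.2.
have sE : 2 * 16 ^+ n <= sup E by apply: le_trans hq _; exact: le_sup.
have [|_ [t' [x' [t'T x'1 ->]]] hr] := @sup_adherent _ E (sup E / 2) _ supE.
  by rewrite divr_gt0//; lra.
exists (h, t', x'); split => //=; first lra.
move=> t'' x'' h1 h2; have : `|quot h (mean t'' x'')| <= sup E.
  by apply: le_sup; exists t'', x''.
lra.
Qed.

(* The masses: 8^-n against quotients of size 16^n still diverges, while all the
   masses after the n-th add up to one seventh of it. *)
Let c n : R := 8^-1 ^+ n.
Let cS n : c n.+1 = 8^-1 * c n. Proof. by rewrite /c exprS. Qed.
Let c0 n : 0 < c n. Proof. by rewrite exprn_gt0// invr_gt0. Qed.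

(** A gliding hump.  The input made of impulses of masses 8^-n along the vectors of
   [near_max] is integrable, hence steers 0 to a state xi in the domain of the
   generator, whose difference quotients are bounded by |z|.  But the quotient
   at the n-th step is at least 8^-n a_n >= 2^n on the first n + 1 impulses, and
   the remaining ones change it by 2 / 7 of that at most. *)
Lemma unbounded_false : False.
Proof.
have [p hp] := choice near_max.
pose h n := (p n).1.1; pose t n := (p n).1.2; pose x n := (p n).2.
pose a n := `|quot (h n) (mean (t n) (x n))|.
have h0 n : 0 < h n by have [] := hp n.
have tT n : 0 < t n < T by have [] := hp n.
have t0 n : 0 < t n by have /andP[] := tT n.
have x1 n : `|x n| <= 1 by have [] := hp n.
have a16 n : 16 ^+ n <= a n by have [] := hp n.
have amax n s y : 0 < s < T -> `|y| <= 1 -> `|quot (h n) (mean s y)| <= 2 * a n.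
  by have [_ _ _ _] := hp n; apply.
have a0 n : 0 <= a n by exact: normr_ge0.
pose w n := mean (t n) (x n).
(* The signs prevent cancellation with the impulses already placed. *)
pose sg n (q : X) : R := if c n * a n <= `|quot (h n) (q + c n *: w n)| then 1 else -1.
pose st := fix st n := if n is m.+1 then st m + (sg m (st m) * c m) *: w m else 0.
have sg1 n q : `|sg n q| = 1 by rewrite /sg; case: ifP; rewrite ?normrN normr1.
have st_large n : c n * a n <= `|quot (h n) (st n.+1)|.
  rewrite [st _]/= /sg; case: ifPn => [|hn]; first by rewrite mul1r.
  have lq := quot_linear (h0 n).
  move: hn; rewrite -ltNge mulN1r scaleNr (real_linearD _ _ lq) (real_linearB _ _ lq).
  set v := quot _ (st n); set u := quot _ _ => hn.
  have uE : `|u| = c n * a n.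
    by rewrite /u (real_linearZ _ _ lq) normrZ gtr0_norm.
  have : `|u + u| <= `|v + u| + `|v - u|.
    have -> : u + u = (v + u) - (v - u) by rewrite opprB [u - v]addrC addrA [v + u]addrC addrK.
    exact: ler_normB.
  have -> : u + u = 2 *: u by rewrite scaler_nat mulr2n.
  by rewrite normrZ ger0_norm// uE; lra.
pose y n := (sg n (st n) * c n) *: x n.
have yc n : `|y n| <= c n.
  by rewrite normrZ normrM sg1 mul1r (gtr0_norm (c0 n)) ler_piMr// ltW.
have stE N : \sum_(n < N) (t n)^-1 *: W (t n) (b (y n)) = st N.
  elim: N => [|N ih]; first by rewrite big_ord0.
  by rewrite big_ord_recr/= ih; congr (_ + _); exact: (real_linearZ _ _ (mean_linear (t0 N))).
have cC N : \sum_(n < N) c n <= 2.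
  suff -> : \sum_(n < N) c n = 8 / 7 * (1 - c N) by have := c0 N; lra.
  elim: N => [|N ih]; first by rewrite big_ord0 /c expr0 subrr mulr0.
  by rewrite big_ord_recr/= ih cS; field.
have t_small s : s < T -> exists N, forall n, (N <= n)%N -> t n < T - s.
  move=> sT; have Ts : 0 < T - s by rewrite subr_gt0.
  exists (Num.truncn (2 * Mb / (T - s))).+1 => n Nn.
  have H1 : 2 * Mb / (T - s) < 16 ^+ n.
    apply: lt_le_trans (truncnS_gt _) _; apply: (@le_trans _ _ n%:R); first by rewrite ler_nat.
    by rewrite -natrX ler_nat ltnW// ltn_expl.
  have H2 : 16 ^+ n <= (t n)^-1 * (2 * Mb).
    apply: le_trans (a16 n) _; apply: le_trans (quot_mean_le _ (h0 n) (t0 n)) _.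
    rewrite ler_wpM2l ?invr_ge0 ?(ltW (t0 n))//.
    apply: le_trans (diff_le _ (ltW (t0 n))) _.
    by rewrite ler_piMr ?mulr_ge0.
  have {H1}H2 := lt_le_trans H1 H2.
  move: H2; rewrite ltr_pdivrMr// -mulrA ltr_pdivlMl//.
  apply: contraTT; rewrite -!leNgt => H.
  by rewrite [leRHS]mulrC ler_wpM2l// mulr_ge0.
have [xi [z [xiz hxi]]] := admissible (fun s => @impulse_series_right _ _ _ _ y tT t_small s)
  (impulse_series_dominated tT yc cC t_small).
have weak psi : unit_functional psi -> psi (st N) @[N --> \oo] --> psi xi.
  move=> hpsi; have := @impulse_series_weak _ _ nX _ hS _ _ _ _ _ tT yc cC t_small b Mb lb
    Mb0 bM T0 psi xi hpsi (hxi _ hpsi).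
  by under eq_fun do rewrite stE.
have tail n M : (n < M)%N ->
    `|quot (h n) (st M - st n.+1)| <= 2 / 7 * a n * (c n - 8 * c M).
  have lq := quot_linear (h0 n).
  elim: M => // M ih; rewrite ltnS leq_eqVlt => /predU1P[<-|nM].
    rewrite (subrr (st n.+1)) (real_linear0 lq) normr0 cS mulrA divff// mul1r.
    by rewrite (subrr (c n)) mulr0.
  have -> : st M.+1 - st n.+1 = st M - st n.+1 + (sg M (st M) * c M) *: w M.
    by rewrite [st M.+1]/= addrAC.
  rewrite (real_linearD _ _ lq); apply: le_trans (ler_normD _ _) _.
  apply: le_trans (lerD (ih nM) (lexx _)) _.
  rewrite (real_linearZ _ _ lq) normrZ normrM sg1 mul1r (gtr0_norm (c0 M)).
  have := ler_wpM2l (ltW (c0 M)) (amax n (t M) (x M) (tT M) (x1 M)).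
  rewrite -/(w M) cS; lra.
(* 1 - 2 / 7 = 5 / 7 of the hump survives. *)
have large n : 5 / 7 * (c n * a n) <= `|z|.
  have lq := quot_linear (h0 n).
  have H1 : `|quot (h n) (xi - st n.+1)| <= 2 / 7 * a n * c n.
    apply: norming_le => // psi hpsi.
    have L : psi (quot (h n) (st N - st n.+1)) @[N --> \oo] -->
        psi (quot (h n) (xi - st n.+1)).
      have E v : psi (quot (h n) v) = (h n)^-1 * ((psi \o S (h n)) v - psi v).
        by rewrite /quot functionalZ// functionalB.
      rewrite E; under eq_fun do rewrite E.
      have hpsi' := functional_csg hS (ltW (h0 n)) hpsi.
      apply: cvgM; first exact: cvg_cst.
      apply: cvgB; rewrite functionalB//; under eq_fun do rewrite functionalB//;
        by apply: cvgB; [exact: weak|exact: cvg_cst].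
    apply: (cvgr_to_le L); exists n.+1 => // M /= nM.
    apply: le_trans (functional_le hpsi _) _; apply: le_trans (tail n M nM) _.
    rewrite ler_wpM2l ?mulr_ge0// gerBl mulr_ge0//; exact: ltW.
  have H2 : `|quot (h n) xi| <= `|z|.
    rewrite /quot (gen_increment nX hS xiz (ltW (h0 n))) normrZ gtr0_norm ?invr_gt0//.
    by rewrite ler_pdivrMl//; exact: orbit_integral_le (ltW (h0 n)).
  have H3 := st_large n.
  have H4 : `|quot (h n) (st n.+1)| <= `|quot (h n) xi| + `|quot (h n) (xi - st n.+1)|.
    by rewrite (real_linearB _ _ lq) -[X in `|X| <= _](subKr (quot (h n) xi)) ler_normB.
  by lra.
have two n : 2 ^+ n <= c n * a n.
  apply: le_trans (ler_wpM2l (ltW (c0 n)) (a16 n)).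
  by rewrite /c -exprMn (_ : 8^-1 * 16 = 2)//; field.
pose n := (Num.truncn (2 * `|z|)).+1.
have : n%:R <= 2 ^+ n :> R by rewrite -natrX ler_nat ltnW// ltn_expl.
have := truncnS_gt (2 * `|z|); have := large n; have := two n.
have := normr_ge0 z; rewrite -/n; lra.
Qed.

End unbounded.

(** The range of B is contained in the extrapolated Favard class of S; the bound is
   uniform because it is the failure of a common bound that is refuted. *)
Theorem admissible_favard : exists K, 0 <= K /\
  forall t x, 0 <= t -> `|S t (b x) - b x| <= K * t * `|x|.
Proof.
apply: contrapT => h; apply: unbounded_false => K K0.
apply: contrapT => h'; apply: h; exists K; split => // t x t0.
by rewrite leNgt; apply/negP => h''; apply: h'; exists t, x.
Qed.

End admissibility.

(** * Duality map and dissipation *)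

Section upper_integrals.
Context (R : realType) d (T : measurableType d)
  (mu : {measure set T -> \bar R}).

(** For a nonmeasurable f this is the definition of the upper integral; for a
   measurable one, which need not be integrable, positive and negative parts are
   compared. *)
Lemma integral_or_upper_le (D : set T) (f g : T -> \bar R) : measurable D ->
  mu.-integrable D g -> (forall t, D t -> (f t <= g t)%E) ->
  (integral_or_upper mu D f <= \int[mu]_(t in D) g t)%E.
Proof.
move=> mD ig fg; rewrite /integral_or_upper; case: (pselect (measurable_fun D f)) => [mf|nmf]; last first.
  by apply: ereal_inf_lbound; exists g => //; split => //; exact: aeW.
have /integrableP[mg _] := ig.
rewrite integralE [leRHS]integralE; apply: leeB.
- apply: ge0_le_integral => //; [exact: measurable_funepos| |].
    exact: measurable_funepos.
  by move=> t Dt; rewrite !funeposE le_max2//; exact: fg.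
- apply: ge0_le_integral => //; last 2 first.
  + exact: measurable_funeneg.
  + by move=> t Dt; rewrite !funenegE le_max2// leeN2; exact: fg.
  + exact: measurable_funeneg.
Qed.

End upper_integrals.

Section energy.
Context (R : realType) (X : completeNormedModType R).
Variable S : R -> X -> X.
Hypothesis hS : contraction_semigroup S.
Local Notation cmu := (@completed_lebesgue_measure R).

(** The properties of the real part of an element of the duality map. *)
Definition dual_element (y : X) (phi : X -> R) : Prop :=
  [/\ forall a x z, phi (a *: x + z) = a * phi x + phi z,
      forall x, `|phi x| <= `|y| * `|x| & phi y = `|y| ^+ 2].

Lemma dual_element_norming : (forall y, exists phi, dual_element y phi) ->
  has_norming_functionals X.
Proof.
move=> h x; have [x0|x0] := eqVneq x 0.
  exists (fun=> 0); last by rewrite x0 normr0.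
  by split => [a u v|u]; rewrite ?mulr0 ?addr0 ?normr0.
have n0 : `|x| != 0 by rewrite normr_eq0.
have [phi [lphi phile phix]] := h x; exists (fun u => `|x|^-1 * phi u).
  split=> [a u v|u]; first by rewrite lphi mulrDr mulrCA.
  by rewrite normrM normfV normr_id ler_pdivrMl// normr_gt0.
by rewrite phix expr2 mulrA mulVf// mul1r.
Qed.

Section dual_element_theory.
Variables (y : X) (phi : X -> R).
Hypothesis hphi : dual_element y phi.
Let lphi : forall a x z, phi (a *: x + z) = a * phi x + phi z.
Proof. by case: hphi. Qed.
Lemma dual_le x : phi x <= `|y| * `|x|.
Proof. by case: hphi => _ h _; exact: le_trans (ler_norm _) (h x). Qed.
Lemma dual0 : phi 0 = 0.
Proof.
by apply/eqP; rewrite -normr_le0; case: hphi => _ h _; have := h 0; rewrite normr0 mulr0.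
Qed.
Lemma dualZ a x : phi (a *: x) = a * phi x.
Proof. by rewrite -[a *: x]addr0 lphi dual0 addr0. Qed.
Lemma dualB x z : phi (x - z) = phi x - phi z.
Proof. by rewrite addrC -scaleN1r lphi mulN1r addrC. Qed.

(** Half the square of the norm is convex, with subgradient phi at y. *)
Lemma dual_subgradient x : (`|y| ^+ 2 - `|x| ^+ 2) / 2 <= phi (y - x).
Proof.
rewrite dualB; case: hphi => _ _ ->; have := dual_le x.
have : 0 <= (`|y| - `|x|) ^+ 2 by exact: sqr_ge0.
rewrite sqrrB; lra.
Qed.
End dual_element_theory.

Hypothesis nX : has_norming_functionals X.
Variables (b d : X -> X) (mu : R).
Hypothesis mu0 : 0 < mu.

(** Applying l R(l) to the perturbed equation gives
   l R(l) z = l (l R(l) y - y) - mu B_l y.  The first term on the right pairs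
   nonpositively with phi, and l R(l) z tends to z. *)
Lemma perturbed_energy y z phi e : perturbed_gen S b d mu y z ->
  dual_element y phi -> 0 < e ->
  \forall l \near +oo, phi (yosida_input S b d l y) <= (- phi z + e) / mu.
Proof.
move=> yz hphi e0.
have e1 : 0 < e / (`|y| + 1) by rewrite divr_gt0// ltr_wpDl.
have [L [L0 hL]] := res_cvg nX hS z e1.
exists L; split => [|l Ll]; first exact: num_real.
have l0 : 0 < l := lt_trans L0 Ll.
have lr := res_linear nX hS l0.
have E : l *: res S l z = l *: (l *: res S l y - y) - mu *: yosida_input S b d l y.
  have H := res_gen nX hS l0 yz.
  have -> : res S l z = l *: res S l (y + mu *: b y) - (y + mu *: b y) - mu *: res S l (d y).
    by rewrite H (real_linearD _ _ lr) (real_linearZ _ _ lr) addrK.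
  rewrite (real_linearD _ _ lr) (real_linearZ _ _ lr) /yosida_input.
  set A := res S l y; set B := res S l (b y); set D := res S l (d y).
  have -> : mu *: (l *: D - l *: (l *: B - b y)) = l *: (mu *: (D - (l *: B - b y))).
    by rewrite -scalerBr !scalerA mulrC.
  rewrite -scalerBr; congr (_ *: _).
  have sw : l *: (mu *: B) = mu *: (l *: B) by rewrite !scalerA mulrC.
  rewrite scalerDr sw !scalerBr opprD opprB !addrA.
  by rewrite [LHS](ACl (1*3*2*4*5)).
have H1 : phi (l *: (l *: res S l y - y)) <= 0.
  rewrite (dualZ hphi) pmulr_rle0// (dualB hphi) (dualZ hphi).
  have := dual_le hphi (l *: res S l y); rewrite (dualZ hphi).
  have : `|y| * `|l *: res S l y| <= `|y| * `|y|.
    by rewrite ler_wpM2l// normrZ gtr0_norm//; exact: res_le.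
  by case: hphi => _ _ ->; rewrite expr2; lra.
have H2 : phi z - phi (l *: res S l z) <= e.
  rewrite -(dualB hphi); apply: le_trans (dual_le hphi _) _; rewrite distrC.
  have := hL l (ltW Ll); rewrite ler_pdivlMr ?ltr_wpDl// => hle.
  apply: le_trans hle; rewrite mulrC ler_wpM2l// lerDl//.
move: H2; rewrite E (dualB hphi) (dualZ hphi mu) => H2.
by rewrite ler_pdivlMr//; lra.
Qed.

End energy.

(** * Energy along closed-loop trajectories *)

Lemma ereal_dist_le (R : realType) (x y : \bar R) (a c : R) :
  (`|x - y| <= c%:E)%E -> (x <= a%:E)%E -> (y <= (a + c)%:E)%E.
Proof.
case: x => [x| |]; case: y => [y| |] //=; rewrite !lee_fin distrC => h1 h2.
by have := ler_norm (y - x); lra.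
Qed.

Section decay.
Context (R : realType) (X : completeNormedModType R) (U : R -> X -> X) (w : R).
Hypothesis hU : growth_semigroup w U.
Hypothesis w0 : 0 <= w.

Lemma gsg_continuous t (u : nat -> X) l : 0 <= t -> u n @[n --> \oo] --> l ->
  U t (u n) @[n --> \oo] --> U t l.
Proof.
move=> t0 ul; apply/cvgrPdist_le => e e0.
have c0 : 0 < expR (w * t) := expR_gt0 _.
have /cvgrPdist_le /(_ _ (divr_gt0 e0 c0)) := ul; apply: filterS => n.
rewrite ler_pdivlMr// mulrC -(real_linearB _ _ (gsg_linear hU t0)).
exact/le_trans/(gsg_le hU _ t0).
Qed.

(** The factor is iterated over whole periods, and the growth bound takes care of
   the remaining fraction of a period. *)
Lemma exponential_decay tau q : 0 < tau -> 0 < q < 1 ->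
  (forall x, `|U tau x| ^+ 2 <= q * `|x| ^+ 2) ->
  exists M sigma, [/\ 0 < M, 0 < sigma &
    forall t x, 0 <= t -> `|U t x| <= M * expR (- sigma * t) * `|x|].
Proof.
move=> tp /andP[q0 q1] hq; pose sigma := - ln q / (2 * tau).
have s0 : 0 < sigma by rewrite divr_gt0 ?mulr_gt0// oppr_gt0 ln_lt0// q0.
have qE : q = expR (- sigma * tau) ^+ 2.
  rewrite -expRM_natl -[LHS](lnK (_ : q \in Num.pos)) ?posrE//; congr expR.
  by rewrite /sigma; field; rewrite gt_eqF.
have U1 x : `|U tau x| <= expR (- sigma * tau) * `|x|.
  rewrite -(ler_pXn2r (_ : 0 < 2)%N) ?nnegrE ?mulr_ge0 ?expR_ge0//.
  by rewrite exprMn -qE.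
have Un n x : `|U (n%:R * tau) x| <= expR (- sigma * (n%:R * tau)) * `|x|.
  elim: n => [|n IH]; first by rewrite mul0r mulr0 expR0 mul1r (gsg0 hU).
  rewrite -natr1 mulrDl mul1r addrC (gsgD hU) ?mulr_ge0 ?(ltW tp)//.
  apply: le_trans (U1 _) _; rewrite mulrDr expRD -mulrA.
  by rewrite ler_wpM2l ?expR_ge0.
exists (expR ((w + sigma) * tau)), sigma; split=> //; first exact: expR_gt0.
move=> t x t0; pose n := Num.truncn (t / tau).
have := truncn_itv (_ : 0 <= t / tau); rewrite divr_ge0 ?(ltW tp)// => /(_ isT).
rewrite -/n ler_pdivlMr// ltr_pdivrMr// -natr1 mulrDl mul1r => /andP[n1 n2].
have nt0 : 0 <= n%:R * tau by rewrite mulr_ge0 ?(ltW tp).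
have -> : t = (t - n%:R * tau) + n%:R * tau by rewrite subrK.
have st0 : 0 <= t - n%:R * tau by rewrite subr_ge0.
rewrite (gsgD hU)//; apply: le_trans (gsg_le hU _ st0) _.
apply: le_trans (ler_wpM2l (expR_ge0 _) (Un _ _)) _.
rewrite mulrA ler_wpM2r// -!expRD ler_expR subrK.
have : w * (t - n%:R * tau) <= w * tau by rewrite ler_wpM2l//; lra.
have : sigma * (t - n%:R * tau) <= sigma * tau by rewrite ler_wpM2l ?(ltW s0)//; lra.
lra.
Qed.
End decay.

Section stabilization.
Context (R : realType) (X : completeNormedModType R).
Variable S : R -> X -> X.
Hypothesis hS : contraction_semigroup S.
Local Notation cmu := (@completed_lebesgue_measure R).
Local Notation cT := (caratheodory_type (wlength (@idfun R))^*%mu).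
Hypothesis nX : has_norming_functionals X.
Variables b d : X -> X.

(* The limit superior L of the pairings enters only through its upper bounds,
   which keeps the argument independent of the scalar field. *)
Variables (Phi : Type) (ev : Phi -> X -> R) (J : X -> Phi -> Prop)
  (L : X -> Phi -> \bar R).
Hypothesis hJ : forall y phi, J y phi -> dual_element y (ev phi).
Hypothesis hL : forall y phi c,
  (\forall l \near +oo, ev phi (yosida_input S b d l y) <= c) -> (L y phi <= c%:E)%E.
Variables (tau delta c : R).
Hypothesis tau0 : 0 < tau.
Hypothesis c0 : 0 <= c.
Hypothesis observability : forall (y : X) (phi : R -> Phi),
  (forall t, 0 <= t <= tau -> J (S t y) (phi t)) ->
  ((delta * `|S tau y| ^+ 2)%:E <=
   integral_or_upper cmu `[0%R, tau] (fun t => L (S t y) (phi t)))%E.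
Hypothesis continuity : forall y z, exists ystar zstar, [/\ J y ystar, J z zstar &
  (`|L y ystar - L z zstar| <= (c * (`|y| + `|z|) * `|y - z|)%:E)%E].

Section closed_loop.
Variables (w mu : R) (U : R -> X -> X).
Hypothesis mu0 : 0 < mu.
Hypothesis w0 : 0 <= w.
Hypothesis hU : growth_semigroup w U.
Hypothesis genU : forall y z, gen U y z <-> perturbed_gen S b d mu y z.
Hypothesis distU : forall t x, 0 <= t ->
  `|U t x - S t x| <= w * t * expR (w * t) * `|x|.

(** Along smooth solutions the energy decays at least at the rate given by the
   pairings with B. *)
Lemma energy_rate y z phi : gen U y z -> J y phi ->
  (L y phi <= (- ev phi z / mu)%:E)%E.
Proof.
move=> /genU yz hphi; apply/lee_addgt0Pr => e e0; rewrite -EFinD; apply: hL.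
have e1 : 0 < mu * e by rewrite mulr_gt0.
have := perturbed_energy hS nX mu0 yz (hJ hphi) e1.
by apply: filterS => l /le_trans; apply; rewrite mulrDl mulrAC divff ?mul1r// gt_eqF.
Qed.

Let G := expR (w * (tau + 1)).
Let G0 : 0 < G := expR_gt0 _.
Let leG t x : 0 <= t <= tau + 1 -> `|U t x| <= G * `|x|.
Proof.
move=> /andP[t0 t1]; apply: le_trans (gsg_le hU x t0) _.
by rewrite ler_wpM2r// ler_expR ler_wpM2l.
Qed.

(* The trajectory is started at time h0 so that backward differences make
   sense down to t = 0. *)
Section one_trajectory.
Variables (x0 z0 : X) (h0 : R).
Hypothesis xz0 : gen U x0 z0.
Hypothesis h01 : 0 < h0 <= 1.
Let traj t := U (t + h0) x0.
Let E (t : R) := `|traj t| ^+ 2 / 2.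

Let traj_le t : 0 <= t + h0 -> t <= tau -> `|traj t| <= G * `|x0|.
Proof. by move=> t1 t2; apply: leG; have /andP[_] := h01; lra. Qed.

(** Convexity of the energy bounds a backward difference by the pairing of the
   derivative with an element of the duality map at the later time, whichever
   it is; e bounds the errors of the first order expansion over a step h. *)
Lemma backward_energy t h e phi : 0 <= t <= tau -> 0 < h < h0 ->
  `|U h x0 - x0 - h *: z0| <= h * e -> `|U h z0 - z0| <= e ->
  J (traj t) phi ->
  (L (traj t) phi <=
    (mu^-1 * (2 * G ^+ 2 * `|x0| * e - h^-1 * (E t - E (t - h))))%:E)%E.
Proof.
move=> /andP[t0 tt] /andP[hp hh0] he1 he2 hphi.
have /andP[h0p h01'] := h01.
have s0 : 0 <= t + h0 - h by lra.
have th0 : 0 <= t + h0 by lra.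
apply: le_trans (energy_rate (gsg_gen hU th0 xz0) hphi) _.
rewrite lee_fin mulrC ler_wpM2l ?invr_ge0 ?(ltW mu0)//.
have dphi := hJ hphi.
have lU := gsg_linear hU s0.
set v := U (t + h0 - h) ((U h x0 - x0 - h *: z0) - h *: (U h z0 - z0)).
have split_time x : U (t + h0) x = U (t + h0 - h) (U h x).
  by rewrite -(gsgD hU)// ?(ltW hp)// subrK.
have vE : v = (traj t - traj (t - h)) - h *: U (t + h0) z0.
  rewrite /traj (split_time x0) (split_time z0) [t - h + h0]addrAC.
  rewrite -(real_linearB _ _ lU) -(real_linearZ _ _ lU) -(real_linearB _ _ lU) /v.
  congr (U _ _); rewrite scalerBr opprB.
  by rewrite addrA subrK.
have vle : `|v| <= G * (2 * h * e).
  apply: le_trans (leG _ _) _; first by lra.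
  rewrite ler_wpM2l// ?(ltW G0)//; apply: le_trans (ler_normB _ _) _.
  rewrite normrZ (gtr0_norm hp); have := ler_wpM2l (ltW hp) he2; lra.
have H1 := dual_subgradient dphi (traj (t - h)).
have H2 : ev phi (traj t - traj (t - h)) - h * ev phi (U (t + h0) z0) <=
    h * (2 * G ^+ 2 * `|x0| * e).
  rewrite -(dualZ dphi) -(dualB dphi) -vE; apply: le_trans (dual_le dphi _) _.
  have -> : h * (2 * G ^+ 2 * `|x0| * e) = (G * `|x0|) * (G * (2 * h * e)) by ring.
  by apply: ler_pM => //; exact: traj_le.
have H3 : E t - E (t - h) <= h * (ev phi (U (t + h0) z0) + 2 * G ^+ 2 * `|x0| * e).
  by rewrite /E; lra.
have : h^-1 * (E t - E (t - h)) <= ev phi (U (t + h0) z0) + 2 * G ^+ 2 * `|x0| * e.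
  by rewrite ler_pdivrMl.
lra.
Qed.

(* The energy, extended continuously to negative times. *)
Let Ec (t : R) := `|U `|t + h0| x0| ^+ 2 / 2.
Let EcE t : - h0 <= t -> Ec t = E t.
Proof. by move=> th; rewrite /Ec /E /traj ger0_norm//; lra. Qed.

Let Ec_continuous : continuous Ec.
Proof.
move=> t; have H : `|U `|s + h0| x0| @[s --> t] --> `|U `|t + h0| x0|.
  apply: cvg_norm; apply: (@continuous_comp _ _ _ (fun s : R => s + h0)
    (fun s : R => U `|s| x0)); last exact: gsg_orbit_continuous hU x0 _.
  by apply: cvgD; [exact: cvg_id|exact: cvg_cst].
by have := cvgM (cvgM H H) (cvg_cst (2^-1 : R)); apply.
Qed.

Let kappa := tau * (c * (G + 1) * (w * tau * G)).

(** The observability inequality is applied to the free orbit of the initial state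
   y0, with selections compared to those along the closed-loop trajectory by
   the continuity hypothesis; both orbits are within O(mu) of each other.  The
   backward differences of the energy, integrated over [0, tau], telescope up to
   the averages of E over [- h, 0] and [tau - h, tau]. *)
Lemma observed_energy :
  delta * `|S tau (traj 0)| ^+ 2 <=
  mu^-1 * (E 0 - E tau) + kappa * `|traj 0| ^+ 2.
Proof.
have /andP[h0p h01'] := h01.
have tp := tau0.
have traj0 : traj 0 = U h0 x0 by rewrite /traj add0r.
set y0 := traj 0.
have trajD t : 0 <= t -> traj t = U t y0.
  by move=> t0; rewrite /y0 traj0 /traj (gsgD hU)// ltW.
set A := mu^-1 * (2 + tau * (2 * G ^+ 2 * `|x0|)).
have A0 : 0 <= A.
  by rewrite mulr_ge0 ?invr_ge0 ?(ltW mu0)// addr_ge0// !mulr_ge0// ?exprn_ge0// ltW.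
apply: (ler_eps A0) => e e0.
(* One step h for which all the discretization errors are at most e. *)
have [d1 [d10 hd1]] := (cvg_at0P _ _).1 xz0 e e0.
have [d2 [d20 hd2]] := (cvg_at0P _ _).1 (@gsg_cvg0 _ _ _ _ hU z0) e e0.
have near_cont (r : R) : exists d3, 0 < d3 /\
    forall s, `|r - s| < d3 -> `|Ec r - Ec s| <= e.
  have /cvgrPdist_le /(_ _ e0) [d3 /= d30 hd3] := Ec_continuous (x := r).
  by exists d3.
have [d3 [d30 hd3]] := near_cont tau.
have [d4 [d40 hd4]] := near_cont 0.
pose h := Num.min (Num.min (d1 / 2) (d2 / 2)) (Num.min (Num.min (d3 / 2) (d4 / 2)) (h0 / 2)).
have hp : 0 < h by rewrite !lt_min !divr_gt0.
have [hh1 hh2 hh3 hh4 hh0] : [/\ h < d1, h < d2, h < d3, h < d4 & h < h0].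
  have : h <= d1 / 2 by rewrite /h !ge_min lexx.
  have : h <= d2 / 2 by rewrite /h !ge_min lexx orbT.
  have : h <= d3 / 2 by rewrite /h !ge_min lexx !orbT.
  have : h <= d4 / 2 by rewrite /h !ge_min lexx !orbT.
  have : h <= h0 / 2 by rewrite /h !ge_min lexx !orbT.
  by split; lra.
have h1 : h < 1 by apply: lt_le_trans hh0 _.
clearbody h.
have hh : 0 < h < h0 by rewrite hp.
have he1 : `|U h x0 - x0 - h *: z0| <= h * e.
  have := hd1 h; rewrite hp hh1 => /(_ isT).
  rewrite -(ler_pM2l hp) -{1}(gtr0_norm hp) -normrZ scalerBr scalerA divff ?gt_eqF//.
  by rewrite scale1r.
have he2 : `|U h z0 - z0| <= e by apply: hd2; rewrite hp.
have pair t : exists p : Phi * Phi, [/\ J (traj t) p.1, J (S t y0) p.2 &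
    (`|L (traj t) p.1 - L (S t y0) p.2| <=
     (c * (`|traj t| + `|S t y0|) * `|traj t - S t y0|)%:E)%E].
  by have [ys [zs H]] := continuity (traj t) (S t y0); exists (ys, zs).
have {pair} [st hst] := choice pair.
pose B := c * (G + 1) * (w * tau * G) * `|y0| ^+ 2.
pose g t := mu^-1 * (2 * G ^+ 2 * `|x0| * e - h^-1 * (Ec t - Ec (t - h))) + B.
have cg : continuous g.
  move=> t; apply: cvgD; last exact: cvg_cst.
  apply: cvgM; first exact: cvg_cst.
  apply: cvgB; first exact: cvg_cst.
  apply: cvgM; first exact: cvg_cst.
  apply: cvgB; first exact: Ec_continuous.
  apply: (@continuous_comp _ _ _ (fun s : R => s - h) Ec); last exact: Ec_continuous.
  by apply: cvgB; [exact: cvg_id|exact: cvg_cst].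
have Lg t : 0 <= t <= tau -> (L (S t y0) (st t).2 <= (g t)%:E)%E.
  move=> /[dup] tt /andP[t0 t1]; have [j1 j2 j3] := hst t.
  apply: le_trans (ereal_dist_le j3 (backward_energy tt hh he1 he2 j1)) _.
  rewrite lee_fin /g !EcE//; [|lra|lra].
  rewrite lerD2l /B -!mulrA; apply: ler_wpM2l => //.
  have n1 : `|traj t| + `|S t y0| <= (G + 1) * `|y0|.
    rewrite mulrDl mul1r; apply: lerD; last exact: csg_contr.
    by rewrite trajD//; apply: leG; lra.
  have n2 : `|traj t - S t y0| <= w * tau * G * `|y0|.
    rewrite trajD//; apply: le_trans (distU _ t0) _; rewrite ler_wpM2r//.
    apply: ler_pM; rewrite ?mulr_ge0 ?expR_ge0// ?ler_wpM2l//.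
    by rewrite ler_expR ler_wpM2l//; lra.
  apply: le_trans (ler_pM _ _ n1 n2) _; rewrite ?addr_ge0//.
  by rewrite expr2 le_eqVlt; apply/orP; left; apply/eqP; ring.
have mI : measurable (`[0, tau]%classic : set cT).
  by apply: completed_measurable; exact: measurable_itv.
have ig : cmu.-integrable (`[0, tau]%classic : set cT) (EFin \o g).
  have itg : lebesgue_measure.-integrable `[0, tau] (EFin \o g).
    by apply: continuous_compact_integrable;
      [exact: segment_compact|exact: continuous_subspaceT].
  exact: completed_integrable.
have := observability (y := y0) (phi := fun t => (st t).2).
have jj t : 0 <= t <= tau -> J (S t y0) (st t).2 by move=> _; have [] := hst t.
move=> /(_ jj) obs.
have {}obs := le_trans obs (integral_or_upper_le mI ig _).
have {obs} : ((delta * `|S tau y0| ^+ 2)%:E <= \int[cmu]_(t in `[0%R, tau]) (g t)%:E)%E.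
  by apply: obs => t /=; rewrite in_itv/= => /Lg.
have [F [dF ->]] := continuous_primitive (-2) cg; [|lra|exact: ltW].
rewrite lee_fin => obs; apply: le_trans obs _.
have [P [dP _]] := continuous_primitive (-2) Ec_continuous.
pose Q (t : R) := mu^-1 * (2 * G ^+ 2 * `|x0| * e * t - h^-1 * (P t - P (- h + t))) + B * t.
have dQ (t : R) : - 1 < t -> is_derive t 1 Q (g t).
  move=> t1.
  have d1t : is_derive t 1 P (Ec t) by apply: dP; lra.
  have d2t : is_derive t 1 (fun s => P (- h + s)) (Ec (- h + t)).
    by apply: is_derive_shiftr; apply: dP; lra.
  have -> : Q = mu^-1 \*: ((2 * G ^+ 2 * `|x0| * e) \*: id -
      h^-1 \*: (P - (fun s => P (- h + s)))) + B \*: id by [].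
  have -> : g t = mu^-1 *: ((2 * G ^+ 2 * `|x0| * e) *: 1 -
      h^-1 *: (Ec t - Ec (- h + t))) + B *: 1.
    by rewrite /g addrC [t - h]addrC ![_ *: 1]mulr1 addrC.
  by apply: is_deriveD; apply: is_deriveZ; apply: is_deriveB; apply: is_deriveZ;
    apply: is_deriveB.
have dF' (s : R) : - 1 < s -> is_derive s 1 F (g s) by move=> s1; apply: dF; lra.
rewrite (increment_eq (ltW tp) dF' dQ)//.
have lower : h * (Ec tau - e) <= P tau - P (- h + tau).
  pose H s := P (tau - h + s).
  have : (- H) h - (- H) 0 <= h * (e - Ec tau).
    apply: (increment_le (h := fun s => - Ec (tau - h + s))); first exact: ltW.
      move=> s s1; apply: is_deriveN; apply: is_derive_shiftr; apply: dP; lra.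
    move=> s /andP[s0 sh].
    have : `|Ec tau - Ec (tau - h + s)| <= e by apply: hd3; rewrite ger0_norm; lra.
    by rewrite ler_norml => /andP[_]; lra.
  by rewrite !fctE /H subrK addr0 [- h + tau]addrC; lra.
have upper : P 0 - P (- h + 0) <= h * (Ec 0 + e).
  pose H s := P (- h + s).
  have : H h - H 0 <= h * (Ec 0 + e).
    apply: (increment_le (h := fun s => Ec (- h + s))); first exact: ltW.
      move=> s s1; apply: is_derive_shiftr; apply: dP; lra.
    move=> s /andP[s0 sh].
    have : `|Ec 0 - Ec (- h + s)| <= e by apply: hd4; rewrite ger0_norm; lra.
    by rewrite ler_norml => /andP[+ _]; lra.
  by rewrite /H addNr.
rewrite /Q mulr0 mulr0.
have : h^-1 * ((P tau - P (- h + tau)) - (P 0 - P (- h + 0))) >= Ec tau - Ec 0 - 2 * e.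
  by rewrite ler_pdivlMl//; lra.
rewrite !EcE; [|lra|lra]; set q := h^-1 * _ => hq.
have H := ler_wpM2l (ltW (_ : 0 < mu^-1)) hq.
rewrite invr_gt0 in H; move: {H}(H mu0) => hq'.
rewrite [leLHS](_ : _ = mu^-1 * (2 * G ^+ 2 * `|x0| * e * tau) - mu^-1 * q + B * tau).
  by rewrite /A /kappa /B; lra.
by rewrite /q; ring.
Qed.

End one_trajectory.
End closed_loop.

(** * Exponential stability for small gains *)

Variables K M : R.
Hypothesis lb : real_linear b.
Hypothesis ld : real_linear d.
Hypotheses (K0 : 0 <= K) (M0 : 0 <= M).
Hypothesis bK : forall t x, 0 <= t -> `|S t (b x) - b x| <= K * t * `|x|.
Hypothesis dM : forall x, `|d x| <= M * `|x|.
Hypothesis delta0 : 0 < delta.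

Section one_gain.
Variables (mu : R) (U : R -> X -> X).
Hypothesis mu01 : 0 < mu <= 1.
Let w := growth K M mu.
Hypothesis hU : growth_semigroup w U.
Hypothesis genU : forall y z, gen U y z <-> perturbed_gen S b d mu y z.
Hypothesis distU : forall t x, 0 <= t ->
  `|U t x - S t x| <= w * t * expR (w * t) * `|x|.

(** Smooth trajectories started at a positive time are dense, and every term of
   the energy balance is continuous in the initial state. *)
Lemma energy_balance x :
  delta * `|S tau x| ^+ 2 <= mu^-1 * (`|x| ^+ 2 / 2 - `|U tau x| ^+ 2 / 2) +
    tau * (c * (expR (w * (tau + 1)) + 1) * (w * tau * expR (w * (tau + 1)))) * `|x| ^+ 2.
Proof.
set kappa := tau * _.
have /andP[mu0 mu1] := mu01.
have w0 : 0 <= w by apply: growth_ge0 => //; exact: ltW.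
have t0 : 0 <= tau := ltW tau0.
have near_good e : 0 < e -> exists y, `|y - x| <= e /\
    delta * `|S tau y| ^+ 2 - (mu^-1 * (`|y| ^+ 2 / 2 - `|U tau y| ^+ 2 / 2) +
      kappa * `|y| ^+ 2) <= 0.
  move=> e0; have e2 : 0 < e / 2 by rewrite divr_gt0.
  have [x0 [z0 [xz0 hx0]]] := gsg_dense nX hU x e2.
  have [r [r0 hr]] := (cvg_at0P _ _).1 (@gsg_cvg0 _ _ _ _ hU x0) _ e2.
  pose h0 := Num.min (r / 2) 1.
  have h0p : 0 < h0 by rewrite lt_min ltr01 divr_gt0.
  have h01 : 0 < h0 <= 1 by rewrite h0p ge_min lexx orbT.
  have h0r : h0 < r by rewrite gt_min; apply/orP; left; lra.
  exists (U h0 x0); split.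
    have -> : U h0 x0 - x = (U h0 x0 - x0) + (x0 - x) by rewrite addrA subrK.
    apply: le_trans (ler_normD _ _) _.
    by have := hr h0; rewrite h0p h0r => /(_ isT); lra.
  rewrite subr_le0.
  have := observed_energy mu0 w0 hU genU distU xz0 h01.
  rewrite add0r (gsgD hU)//; last exact: ltW.
have pos n : 0 < n.+1%:R^-1 :> R by rewrite invr_gt0.
have [y hy] := choice (fun n => near_good _ (pos n)).
have yx : y n @[n --> \oo] --> x.
  apply/cvgrPdist_le => e e0.
  have := near_infty_natSinv_lt (PosNum e0); apply: filterS => n /= hn.
  by rewrite distrC; apply: le_trans (ltW hn); have [] := hy n.
have sq (u : nat -> X) l : u n @[n --> \oo] --> l ->
    `|u n| ^+ 2 @[n --> \oo] --> `|l| ^+ 2.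
  by move=> ul; have := cvgM (cvg_norm ul) (cvg_norm ul); apply.
have Sy := sq _ _ (@csg_continuous _ _ _ hS _ _ _ t0 yx).
have Uy := sq _ _ (gsg_continuous hU t0 yx).
have y2 := sq _ _ yx.
have FF : Filter \oo := _.
have limit := cvgB (cvgM (cvg_cst (delta : R)) Sy) (cvgD (cvgM (cvg_cst (mu^-1 : R))
  (cvgB (cvgM y2 (cvg_cst (2^-1 : R))) (cvgM Uy (cvg_cst (2^-1 : R)))))
  (cvgM (cvg_cst (kappa : R)) y2)).
rewrite -subr_le0; apply: (cvgr_to_le (limit _ _ _ _ _ _ _ _ _ _ _ _ _)).
by apply: nearW => n; have [] := hy n.
Qed.

(** In the energy balance the error kappa is O(mu), and |S tau x| may be replaced
   by |U tau x| at the cost of O(mu ^ 2) after multiplication by mu. *)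
Lemma contraction_factor x (G := expR ((M + K) * (tau + 1))) (p := (M + K) * tau * G)
    (Z := 2 * (tau * (c * (G + 1) * p)) + 2 * delta * p ^+ 2) :
  `|U tau x| ^+ 2 <= (1 + mu ^+ 2 * Z) / (1 + mu * delta) * `|x| ^+ 2.
Proof.
have /andP[mu0 mu1] := mu01.
have C0 : 0 <= M + K by rewrite addr_ge0.
have w0 : 0 <= w by apply: growth_ge0 => //; exact: ltW.
have t0 : 0 <= tau := ltW tau0.
have wC : w <= M + K by rewrite /w /growth -[leRHS]mul1r ler_wpM2r.
have G0 : 0 <= G := expR_ge0 _.
have p0 : 0 <= p by rewrite !mulr_ge0.
set Gw := expR (w * (tau + 1)).
have GwG : Gw <= G by rewrite /Gw /G ler_expR ler_wpM2r//; lra.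
have n0 : 0 <= `|x| := normr_ge0 x.
have B1 : w * tau * Gw <= mu * p.
  have -> : mu * p = w * tau * G by rewrite /p /w /growth; ring.
  by rewrite ler_wpM2l// mulr_ge0.
have B2 : `|U tau x| <= `|S tau x| + mu * p * `|x|.
  rewrite -lerBlDl; apply: le_trans (lerB_dist _ _) _.
  apply: le_trans (distU _ t0) _; rewrite ler_wpM2r//.
  apply: le_trans B1; apply: ler_wpM2l; first exact: mulr_ge0.
  by rewrite /Gw ler_expR ler_wpM2l//; lra.
have B3 : `|U tau x| ^+ 2 <= 2 * `|S tau x| ^+ 2 + 2 * (mu * p * `|x|) ^+ 2.
  apply: (@le_trans _ _ ((`|S tau x| + mu * p * `|x|) ^+ 2)).
    rewrite ler_pXn2r ?nnegrE// addr_ge0 ?mulr_ge0 ?(ltW mu0)//.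
  have : 0 <= (`|S tau x| - mu * p * `|x|) ^+ 2 by exact: sqr_ge0.
  by rewrite sqrrB sqrrD; lra.
have kle : tau * (c * (Gw + 1) * (w * tau * Gw)) <= mu * (tau * (c * (G + 1) * p)).
  have -> : mu * (tau * (c * (G + 1) * p)) = tau * (c * (G + 1) * (mu * p)) by ring.
  have Gw0 : 0 <= Gw := expR_ge0 _.
  have wt0 : 0 <= w * tau by exact: mulr_ge0.
  rewrite ler_wpM2l//; apply: ler_pM => //.
  - by rewrite mulr_ge0// addr_ge0.
  - exact: mulr_ge0.
  - by rewrite ler_wpM2l// lerD2r.
have n20 : 0 <= `|x| ^+ 2 by rewrite exprn_ge0.
have := energy_balance x; rewrite -/Gw => eb.
have eb' := le_trans eb (lerD (lexx _) (ler_wpM2r n20 kle)).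
have d0 : 0 < 1 + mu * delta by rewrite ltr_wpDr ?mulr_gt0// ?mulr_ge0 ?ltW.
rewrite mulrAC ler_pdivlMr//.
have eb2 : 2 * mu * delta * `|S tau x| ^+ 2 <= `|x| ^+ 2 - `|U tau x| ^+ 2 +
    2 * mu ^+ 2 * (tau * (c * (G + 1) * p)) * `|x| ^+ 2.
  have m2 : 0 <= 2 * mu by rewrite mulr_ge0// ltW.
  have := ler_wpM2l m2 eb'.
  rewrite [2 * mu * (delta * _)]mulrA => /le_trans; apply.
  by rewrite le_eqVlt; apply/orP; left; apply/eqP; field; rewrite gt_eqF.
have eb3 : mu * delta * `|U tau x| ^+ 2 <=
    mu * delta * (2 * `|S tau x| ^+ 2 + 2 * (mu * p * `|x|) ^+ 2).
  by rewrite ler_wpM2l// mulr_ge0 ?ltW.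
have eb4 : mu * (2 * mu ^+ 2 * delta * p ^+ 2 * `|x| ^+ 2) <=
    1 * (2 * mu ^+ 2 * delta * p ^+ 2 * `|x| ^+ 2).
  by rewrite ler_wpM2r// !mulr_ge0 ?exprn_ge0 ?(ltW delta0) ?(ltW mu0).
rewrite /Z; move: eb2 eb3 eb4; lra.
Qed.
End one_gain.

(** For small gains the dissipation, of order mu, dominates the errors of order
   mu ^ 2 made in replacing the closed-loop trajectory by the free one. *)
Theorem small_gain_stability : exists alpha, 0 < alpha /\
  forall mu, 0 < mu < alpha -> exists U : R -> X -> X,
  [/\ growth_semigroup (growth K M mu) U,
    forall y z, gen U y z <-> perturbed_gen S b d mu y z,
    exists Mu sigma, [/\ 0 < Mu, 0 < sigma &
      forall t x, 0 <= t -> `|U t x| <= Mu * expR (- sigma * t) * `|x|] &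
    forall C : X -> X, real_linear C -> (forall x, `|C x| <= `|x|) ->
      (forall t x, 0 <= t -> C (S t x) = S t (C x)) ->
      (forall x, C (b x) = b (C x)) -> (forall x, C (d x) = d (C x)) ->
      forall t x, 0 <= t -> C (U t x) = U t (C x)].
Proof.
pose G := expR ((M + K) * (tau + 1)); pose p := (M + K) * tau * G.
pose Z := 2 * (tau * (c * (G + 1) * p)) + 2 * delta * p ^+ 2.
have t0 : 0 <= tau := ltW tau0.
have C0 : 0 <= M + K by rewrite addr_ge0.
have G0 : 0 <= G := expR_ge0 _.
have p0 : 0 <= p by rewrite !mulr_ge0.
have Z0 : 0 <= Z.
  by rewrite addr_ge0 ?mulr_ge0 ?addr_ge0 ?exprn_ge0 ?(ltW delta0).
have Z1 : 0 < Z + 1 by lra.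
exists (Num.min 1 (delta / (Z + 1))); split.
  by rewrite lt_min ltr01 divr_gt0.
move=> mu; rewrite lt_min => /and3P[mu0 mu1 mu2].
have [U [hU genU distU symU]] := perturbed_semigroup nX hS lb ld K0 M0 (ltW mu0) bK dM.
exists U; split=> //.
have mu01 : 0 < mu <= 1 by rewrite mu0 ltW.
have md0 : 0 < mu * delta by rewrite mulr_gt0.
have mZ0 : 0 <= mu ^+ 2 * Z by rewrite mulr_ge0// exprn_ge0// ltW.
have w0 : 0 <= growth K M mu by apply: growth_ge0 => //; exact: ltW.
apply: (exponential_decay hU w0 tau0 (q := (1 + mu ^+ 2 * Z) / (1 + mu * delta))).
- rewrite divr_gt0 ?ltr_pdivrMr//=; [|lra|lra|lra].
  have : mu * (mu * (Z + 1)) < mu * delta.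
    by rewrite ltr_pM2l// -ltr_pdivlMr.
  have : 0 < mu ^+ 2 by rewrite exprn_gt0.
  lra.
- exact: contraction_factor mu01 hU genU distU.
Qed.

End stabilization.

(** * From complex to real Banach spaces *)

Section complex_scalars.
Context (R : realType) (k : scalar_kind).
Notation K := (scalars R k).

Lemma continuous_linear_nrm (V W : normedModType K) (f : {linear V -> W}) :
  continuous f -> exists M, 0 <= M /\ forall x, nrm (f x) <= M * nrm x.
Proof.
move=> /linear_bounded_continuous/linear_boundedP/pinfty_ex_gt0 [r r0 hr].
have rE := ofR_re (ltW r0); exists (re r); split.
  by rewrite -(ler_ofR k) ofR0 rE ltW.
by move=> x; rewrite -(ler_ofR k) ofRM !ofR_nrm rE.
Qed.

Lemma nrm_linear_continuous (V : normedModType K) (f : V -> V) M :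
  linear f -> (forall x, nrm (f x) <= M * nrm x) -> continuous f.
Proof.
move=> lf fM.
pose f' := GRing.isLinear.Build _ _ _ _ f lf.
pose g : {linear V -> V} := HB.pack f f'.
apply: (@bounded_linear_continuous _ _ _ g); apply/linear_boundedP.
exists (ofR k `|M|); split=> [|r Mr x]; first by rewrite ger0_real// -ofR0 ler_ofR.
rewrite -(ofR_nrm (f x)) -ofR_nrm; apply: le_trans (ler_wpM2r _ (ltW Mr)); last first.
  by rewrite -ofR0 ler_ofR -(ler_ofR k) ofR0 ofR_nrm.
rewrite -ofRM ler_ofR; apply: le_trans (fM x) _; rewrite ler_wpM2r ?ler_norm//.
by rewrite -(ler_ofR k) ofR0 ofR_nrm.
Qed.

Context (X : completeNormedModType K).

Lemma contraction_realify (S : R -> X -> X) : C0_semigroup S -> contractive S ->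
  contraction_semigroup (S : R -> realify X -> realify X).
Proof.
move=> [lS S0 SD S1] cS; split=> //.
- by move=> t t0 a x y; have [lt _] := lS t t0; exact: lt.
- by move=> s t x s0 t0; exact: SD.
Qed.

Lemma generator_linear (S : R -> X -> X) a y z y' z' : C0_semigroup S ->
  generator S (y, z) -> generator S (y', z') ->
  generator S (a *: y + y', a *: z + z').
Proof.
move=> [lS _ _ _] yz yz'; apply: (@cvg_trans _ ((a *: (ofR k h^-1 *: (S h y - y)) +
  ofR k h^-1 *: (S h y' - y')) @[h --> 0^'+])).
  2: exact: (cvgD (cvgZ (cvg_cst a) yz) yz').
apply: near_eq_cvg; exists 1 => //= h _ h0 /=.
have [lh _] := lS h (ltW h0).
rewrite scalerA [a * _]mulrC -scalerA -scalerDr lh; congr (_ *: _).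
by rewrite scalerBr opprD addrACA.
Qed.

Let dual_norm_ub (phi : {linear X -> K^o}) : continuous phi ->
  has_ubound [set re `|phi y| | y in [set y : X | nrm y <= 1]].
Proof.
move=> /continuous_linear_nrm[M [M0 hM]].
exists M => _ [y y1 <-]; apply: le_trans (hM y) _.
by rewrite -[leRHS]mulr1 ler_wpM2l.
Qed.

Lemma dual_norm_le (phi : {linear X -> K^o}) x : continuous phi ->
  re `|phi x| <= dual_norm phi * nrm x.
Proof.
move=> cphi; have [->|x0] := eqVneq x 0; first by rewrite linear0 /nrm !normr0 -(ofR0 R k) !reK mulr0.
have n0 : 0 < nrm x by rewrite -(ltr_ofR k) ofR0 ofR_nrm normr_gt0.
have -> : `|phi x| = ofR k (nrm x) * `|phi (ofR k (nrm x)^-1 *: x)|.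
  rewrite -{1}[nrm x]gtr0_norm// -normr_ofR -normrM.
  have -> : ofR k (nrm x) * phi (ofR k (nrm x)^-1 *: x) =
      ofR k (nrm x) *: phi (ofR k (nrm x)^-1 *: x) by [].
  by rewrite -linearZ/= scalerA -ofRM divff ?gt_eqF// ofR1 scale1r.
rewrite re_ofRM mulrC ler_wpM2r ?(ltW n0)//.
apply: ub_le_sup; first exact: dual_norm_ub.
exists (ofR k (nrm x)^-1 *: x) => //=.
by rewrite nrmZ normr_ofR reK gtr0_norm ?invr_gt0// mulVf ?gt_eqF.
Qed.

Lemma duality_map_dual_element y (phi : {linear X -> K^o}) : duality_map y phi ->
  @dual_element R (realify X) y (fun x => re (phi x)).
Proof.
move=> [cphi phiy dn]; split=> [a x z|x|].
- by rewrite [X in re X](linearP phi) reD -re_ofRM.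
- apply: le_trans (re_norm _) _.
  suff <- : dual_norm phi = `|y : realify X| by exact: dual_norm_le.
  have dn0 : 0 <= dual_norm phi.
    apply: le_trans (_ : re `|phi 0| <= _); first by rewrite linear0 normr0 -(ofR0 R k) reK.
    apply: ub_le_sup; first exact: dual_norm_ub.
    by exists 0 => //=; rewrite /nrm normr0 -(ofR0 R k) reK ler01.
  by apply/eqP; rewrite -(@eqrXn2 _ 2)// -dn.
- by rewrite phiy reK.
Qed.

End complex_scalars.

(** * The extrapolation space *)

Section linear_maps.
Context (K : pzRingType) (V W : lmodType K) (f : V -> W).
Hypothesis lf : linear f.

Lemma linear_fun0 : f 0 = 0.
Proof. by have := lf (-1) 0 0; rewrite !scaleN1r !addNr. Qed.
Lemma linear_funZ a x : f (a *: x) = a *: f x.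
Proof. by rewrite -[a *: x]addr0 lf linear_fun0 addr0. Qed.
Lemma linear_funB x y : f (x - y) = f x - f y.
Proof. by rewrite addrC -scaleN1r lf scaleN1r addrC. Qed.

End linear_maps.

Section extrapolation.
Context (R : realType) (k : scalar_kind).
Notation K := (scalars R k).
Context (X : completeNormedModType K) (S : R -> X -> X).
Hypothesis hS : C0_semigroup S.
Hypothesis hSc : contractive S.
Local Notation A := (generator S).
Variable eta : K.
Hypothesis heta : resolvent_set A eta.
Local Notation Rs := (resolvent A eta).

Lemma resolvent_gen f : A (Rs f, eta *: Rs f - f).
Proof.
by rewrite /resolvent; case: xgetP => [y -> //|H]; have [y [/H]] := heta.1 f.
Qed.

Lemma resolvent_unique f y : A (y, eta *: y - f) -> y = Rs f.
Proof.
by move=> hy; have [z [_ zu]] := heta.1 f; rewrite -(zu _ hy) (zu _ (@resolvent_gen f)).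
Qed.

Lemma resolvent_linear : linear Rs.
Proof.
move=> a x y; apply/esym/resolvent_unique.
have := @generator_linear _ _ _ _ a _ _ _ _ hS (@resolvent_gen x) (@resolvent_gen y).
by rewrite scalerBr scalerDr opprD addrACA !scalerA mulrC.
Qed.

Let RsB x y : Rs (x - y) = Rs x - Rs y.
Proof. exact: linear_funB resolvent_linear _ _. Qed.

Lemma resolvent_semigroup t f : 0 <= t -> Rs (S t f) = S t (Rs f).
Proof.
move=> t0; apply/esym/resolvent_unique.
have cS := contraction_realify hS hSc.
have gS : growth_semigroup 0 (S : R -> realify X -> realify X).
  split; [exact: csg_linear cS| |exact: csg0 cS|exact: csgD cS|].
  - by move=> s x s0; rewrite mul0r expR0 mul1r; exact: (csg_contr cS x s0).
  - by move=> x U; exact: (@csg_cvg0 _ _ _ cS x U).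
have := gsg_gen gS t0 (@resolvent_gen f).
have [lS _] := (let: And4 h _ _ _ := hS in h) t t0.
by rewrite (linear_funB lS) (linear_funZ lS).
Qed.

Context (Xm1 : completeNormedModType K) (j : {linear X -> Xm1}).
Hypothesis hj : is_extrapolation_space A eta j.

Let nrmj x : nrm (j x) = nrm (Rs x).
Proof. by rewrite hj.1 /nrm normrN. Qed.

(** The extension by density of the resolvent to the completion: an isometry
   from X_{-1} to X, through which everything is transported to X. *)
Let ext_rel (z : Xm1) (l : X) := exists u : nat -> X,
  (j (u n) @[n --> \oo] --> z) /\ (Rs (u n) @[n --> \oo] --> l).

(* Equality of norms is the very definition of the norm of X_{-1} on X. *)
Let ext_rel_norm z l : ext_rel z l -> nrm z = nrm l.
Proof.
move=> [u [uz ul]].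
have h1 : `|(j (u n) : realify Xm1)| @[n --> \oo] --> `|z : realify Xm1|.
  exact: (@cvg_norm _ (realify Xm1)).
have h2 : `|(Rs (u n) : realify X)| @[n --> \oo] --> `|l : realify X|.
  exact: (@cvg_norm _ (realify X)).
rewrite (_ : (fun n => `|(j (u n) : realify Xm1)|) = (fun n => `|(Rs (u n) : realify X)|)) in h1.
  exact: cvg_unique h1 h2.
by apply/funext => n; exact: nrmj.
Qed.

Let ext_rel_linear a z l z' l' : ext_rel z l -> ext_rel z' l' ->
  ext_rel (a *: z + z') (a *: l + l').
Proof.
move=> [u [uz ul]] [v [vz vl]]; exists (fun n => a *: u n + v n); split.
  under eq_fun do rewrite linearP.
  by apply: cvgD => //; apply: cvgZ => //; exact: cvg_cst.
under eq_fun do rewrite resolvent_linear.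
by apply: cvgD => //; apply: cvgZ => //; exact: cvg_cst.
Qed.

Let ext_rel_unique z l l' : ext_rel z l -> ext_rel z l' -> l = l'.
Proof.
move=> h h'; have := ext_rel_norm (ext_rel_linear (-1) h' h).
rewrite !scaleN1r addNr addrC => /(congr1 (ofR k)) /esym/eqP.
by rewrite !ofR_nrm normr0 normr_eq0 subr_eq0 => /eqP.
Qed.

Let ext_rel_ex z : exists l, ext_rel z l.
Proof.
have dense n : exists x, `|(j x : realify Xm1) - z| <= n.+1%:R^-1.
  have : closure (range j) z by rewrite hj.2.
  have e0 : 0 < n.+1%:R^-1 :> R by rewrite invr_gt0.
  move=> /(_ _ (@nbhsx_ballx _ (realify Xm1) (z : realify Xm1) _ e0)) [_ [[x _ <-]]].
  by rewrite -ball_normE /ball_/= distrC => /ltW h; exists x.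
have [u hu] := choice dense.
have uz : j (u n) @[n --> \oo] --> z.
  suff : (j (u n) : realify Xm1) @[n --> \oo] --> (z : realify Xm1) by [].
  apply/cvgrPdist_le => e e0.
  have := near_infty_natSinv_lt (PosNum e0); apply: filterS => n /= hn.
  by rewrite distrC; exact/(le_trans (hu n))/ltW.
have [|l ul] := @cauchy_seq_cvg _ (realify X) (fun n => Rs (u n)); last by exists l, u.
move=> e e0; have e2 : 0 < e / 2 by rewrite divr_gt0.
have [N _ hN] := near_infty_natSinv_lt (PosNum e2).
exists N => m n /hN /= /ltW hm /hN /= /ltW hn.
have -> : `|(Rs (u m) : realify X) - Rs (u n)| = `|(j (u m) : realify Xm1) - j (u n)|.
  by rewrite -(linearB j) -RsB; exact: esym (nrmj _).
have -> : (j (u m) : realify Xm1) - j (u n) = (j (u m) - z) - ((j (u n) : realify Xm1) - z).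
  by rewrite opprB addrA subrK.
apply: le_trans (ler_normB _ _) _.
by rewrite [e]splitr; apply: lerD; [exact: le_trans (hu m) hm|exact: le_trans (hu n) hn].
Qed.

Definition ext_res (z : Xm1) : X := projT1 (cid (ext_rel_ex z)).
Local Notation P := ext_res.

Let ext_resP z : ext_rel z (P z).
Proof. by rewrite /ext_res; case: cid. Qed.

Lemma ext_resE x : P (j x) = Rs x.
Proof.
apply: (ext_rel_unique (ext_resP _)); exists (fun=> x).
by split; exact: cvg_cst.
Qed.

Lemma ext_res_linear : linear P.
Proof.
move=> a z z'; apply: (ext_rel_unique (ext_resP _)).
exact: ext_rel_linear.
Qed.

Lemma ext_res_norm z : nrm (P z) = nrm z.
Proof. by rewrite (ext_rel_norm (ext_resP z)). Qed.

Let PB x y : P (x - y) = P x - P y.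
Proof. exact: linear_funB ext_res_linear _ _. Qed.

Lemma ext_res_inj : injective P.
Proof.
move=> x y xy; apply/eqP; rewrite -subr_eq0 -normr_eq0 -ofR_nrm -ext_res_norm PB xy.
by rewrite subrr ofR_nrm normr0.
Qed.

Lemma embedding_inj : injective j.
Proof.
move=> x y xy; have Rxy : Rs x = Rs y by rewrite -!ext_resE xy.
have H : A (Rs x, eta *: Rs x - y) by rewrite Rxy; exact: resolvent_gen.
have /eqP := @gen_unique R (realify X) _ _ _ _ (@resolvent_gen x) H.
by rewrite (inj_eq (addrI _)) eqr_opp => /eqP.
Qed.

Variables (Sm1 : R -> Xm1 -> Xm1).
Hypothesis hSm1 : C0_semigroup Sm1.
Hypothesis hSm1S : extends_semigroup j S Sm1.

Lemma ext_res_semigroup t z : 0 <= t -> P (Sm1 t z) = S t (P z).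
Proof.
move=> t0; apply: (ext_rel_unique (ext_resP _)).
have [u [uz ul]] := ext_resP z; exists (fun n => S t (u n)); split.
  rewrite (_ : (fun n => j (S t (u n))) = (fun n => Sm1 t (j (u n)))); last first.
    by apply/funext => n; rewrite hSm1S.
  have [_ cSm1] := (let: And4 h _ _ _ := hSm1 in h) t t0.
  exact: (continuous_cvg _ (cSm1 z) uz).
rewrite (_ : (fun n => Rs (S t (u n))) = (fun n => S t (Rs (u n)))); last first.
  by apply/funext => n; rewrite resolvent_semigroup.
have [_ cSt] := (let: And4 h _ _ _ := hS in h) t t0.
exact: (continuous_cvg _ (cSt _) ul).
Qed.

(** As P is an isometry intertwining the two semigroups, it carries difference
   quotients to difference quotients without changing their convergence. *)
Lemma ext_res_generator p q : generator Sm1 (p, q) <-> A (P p, P q).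
Proof.
have E h : 0 < h -> P (ofR k h^-1 *: (Sm1 h p - p) - q) =
    ofR k h^-1 *: (S h (P p) - P p) - P q.
  by move=> h0; rewrite PB (linear_funZ ext_res_linear) PB ext_res_semigroup// ltW.
have En h : 0 < h -> `|(ofR k h^-1 *: (S h (P p) - P p) : realify X) - P q| =
    `|(ofR k h^-1 *: (Sm1 h p - p) : realify Xm1) - q|.
  by move=> h0; have := ext_res_norm (ofR k h^-1 *: (Sm1 h p - p) - q); rewrite E.
split=> [/(@cvg_at0P _ (realify Xm1)) H|/(@cvg_at0P _ (realify X)) H].
  apply/(@cvg_at0P _ (realify X)) => e /H [r [r0 hr]]; exists r; split=> // h hh.
  by rewrite En; [exact: hr|have /andP[] := hh].
apply/(@cvg_at0P _ (realify Xm1)) => e /H [r [r0 hr]]; exists r; split=> // h hh.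
by rewrite -En; [exact: hr|have /andP[] := hh].
Qed.

End extrapolation.

(** * Control operator in the extrapolation space *)

Section domination.
Context (R : realType) d (T : measurableType d)
  (mu : {measure set T -> \bar R}).
Context (k : scalar_kind) (Y : normedModType (scalars R k)).

Lemma approx_dominated (D : set T) (f : T -> Y) (s : nat -> simple_fun mu Y)
    (g : T -> \bar R) : measurable D -> simple_approx s D f ->
  mu.-integrable D g -> (forall t, D t -> ((nrm (f t))%:E <= g t)%E) ->
  (\int[mu]_(t in D) (nrm (f t))%:E < +oo)%E.
Proof.
move=> mD fs /integrableP[mg goo] fg; apply: le_lt_trans goo.
have n0 t : 0 <= nrm (f t) by rewrite -(ler_ofR k) ofR0 ofR_nrm.
apply: ge0_le_integral => //.
- by move=> t _; rewrite lee_fin.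
- exact/measurable_EFinP/(approx_measurable_nrm fs).
- exact: measurableT_comp.
- by move=> t Dt; apply: le_trans (fg t Dt) (lee_abs _).
Qed.

End domination.

Section transfer.
Context (R : realType) (k : scalar_kind).
Notation K := (scalars R k).
Context (X : completeNormedModType K) (S : R -> X -> X).
Hypothesis hS : C0_semigroup S.
Hypothesis hSc : contractive S.
Local Notation A := (generator S).
Variable eta : K.
Hypothesis heta : resolvent_set A eta.
Local Notation Rs := (resolvent A eta).
Context (Xm1 : completeNormedModType K) (j : {linear X -> Xm1}).
Hypothesis hj : is_extrapolation_space A eta j.
Variables (Sm1 : R -> Xm1 -> Xm1).
Hypothesis hSm1 : C0_semigroup Sm1.
Hypothesis hSm1S : extends_semigroup j S Sm1.
Local Notation P := (ext_res hS heta hj).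
Variable B : {linear X -> Xm1}.
Local Notation Xr := (realify X).
Local Notation Zr := (realify Xm1).

(** b = (eta - A_{-1})^-1 B and d = eta b are bounded on X, and B = d - A_{-1} b:
   the unbounded operator B is handled through these two. *)
Definition input (x : Xr) : Xr := P (B x).
Definition input_eta (x : Xr) : Xr := eta *: (input x : X).
Local Notation b := input.
Local Notation d := input_eta.

Lemma input_scaleD (a : K) (x y : X) :
  b (a *: x + y) = a *: (b x : X) + b y.
Proof. by rewrite /b linearP (ext_res_linear hS heta hj). Qed.

Lemma input_real_linear : @real_linear R Xr Xr b.
Proof. by move=> a x y; exact: input_scaleD. Qed.

Lemma input_eta_real_linear : @real_linear R Xr Xr d.
Proof.
move=> a x y; rewrite /d input_real_linear.
by rewrite (_ : eta *: _ = eta *: (ofR k a *: (b x : X) + b y))// scalerDr !scalerA mulrC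
  -scalerA.
Qed.

(** Apply (eta - A_{-1})^-1 to A_{-1} y - mu B y = z and use that its image on X is
   the domain of A. *)
Lemma perturbed_part mu y z :
  part_in_X j (perturbed j (generator Sm1) B mu) (y, z) <->
  @perturbed_gen R Xr S b d mu y z.
Proof.
have lR := resolvent_linear hS heta.
set m := ofR k mu; set f : X := eta *: y - z.
have E1 : part_in_X j (perturbed j (generator Sm1) B mu) (y, z) <->
    A (Rs y, m *: (b y : X) + Rs z).
  apply: (iff_trans (ext_res_generator hS hSc heta hj hSm1 hSm1S _ _)).
  by rewrite /= addrC (ext_res_linear hS heta hj) !ext_resE.
have fE : Rs f = eta *: Rs y - Rs z.
  by rewrite (linear_funB lR) (linear_funZ lR).
have E2 : eta *: ((y : X) + m *: (b y : X)) - f = (z : X) + m *: (d y : X).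
  rewrite scalerDr opprB [eta *: y + _]addrC -addrA [eta *: y + _]addrC subrK addrC.
  by rewrite !scalerA mulrC.
split=> [/E1 H|H].
  have e1 : (y : X) + m *: (b y : X) = Rs f.
    have e : m *: (b y : X) + Rs z = eta *: Rs y - y.
      exact: @gen_unique R Xr _ _ _ _ H (@resolvent_gen _ _ _ _ _ heta y).
    by apply/eqP; rewrite fE eq_sym subr_eq -addrA e addrC subrK.
  have := @resolvent_gen _ _ _ _ _ heta f.
  by rewrite -e1 E2; apply.
apply/E1.
have e1 : (y : X) + m *: (b y : X) = Rs f.
  by apply: (resolvent_unique heta); rewrite E2.
have -> : m *: (b y : X) + Rs z = eta *: Rs y - y.
  by apply/eqP; rewrite eq_sym subr_eq [_ + y]addrC addrA e1 fE subrK.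
exact: resolvent_gen.
Qed.

Hypothesis nX : has_norming_functionals Xr.
Let cS := contraction_realify hS hSc.

(** (l - A_{-1})^-1 B y = x, where x = eta r - (l r - b y) and r = R(l, A) (b y): the
   element of X whose image under (eta - A)^-1 is r. *)
Lemma approximate_input lam y : 0 < lam ->
  B_ j (generator Sm1) B lam y = @yosida_input R Xr S b d lam y.
Proof.
move=> l0; set l := ofR k lam; set r : X := @res R Xr S lam (b y).
have Ar : A (r, l *: r - (b y : X)) := @resP _ _ nX _ cS _ (b y) l0.
pose x : X := eta *: r - (l *: r - (b y : X)).
have Rx : Rs x = r.
  by apply/esym/(resolvent_unique heta); rewrite /x opprB addrC subrK.
have inv z : generator Sm1 (z, l *: z - B y) <-> z = j x.
  split=> [/(ext_res_generator hS hSc heta hj hSm1 hSm1S)|->].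
    have lP := ext_res_linear hS heta hj.
    rewrite (linear_funB lP) (linear_funZ lP) => /(@res_unique _ _ nX _ cS _ _ _ l0) zr.
    by apply: (ext_res_inj (hS := hS) (heta := heta) (hj := hj)); rewrite ext_resE Rx.
  apply/(ext_res_generator hS hSc heta hj hSm1 hSm1S).
  have lP := ext_res_linear hS heta hj.
  by rewrite (linear_funB lP) (linear_funZ lP) !ext_resE Rx.
have resE : resolvent (generator Sm1) l (B y) = j x.
  by rewrite /resolvent; case: xgetP => [z _ /inv//|/(_ (j x))]; case; apply/inv.
have preimE : preim_X j (j x) = x.
  rewrite /preim_X; case: xgetP => [z _ /(embedding_inj hS heta hj)//|/(_ x)].
  by case.
rewrite /B_ -/l resE preimE /yosida_input.
have -> : @res R Xr S lam (d y) = eta *: r.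
  apply/esym/(res_unique nX cS l0).
  have := @generator_linear _ _ _ _ eta _ _ _ _ hS Ar (gen0 nX cS).
  by rewrite !addr0 scalerBr !scalerA mulrC -scalerA; apply.
by rewrite -scalerBr.
Qed.

(* The limit superior is an infimum over neighbourhoods of +oo; the positive
   numbers where the bound holds form one. *)
Lemma limsup_pairing_le y (phi : {linear X -> K^o}) c :
  (\forall l \near +oo, re (phi (@yosida_input R Xr S b d l y)) <= c) ->
  (limsup_pairing j (generator Sm1) B y phi <= c%:E)%E.
Proof.
move=> hl; rewrite /limsup_pairing limf_esupE.
apply: le_trans (ereal_inf_lbound _) _.
  exists [set l : R | 0 < l /\ re (phi (@yosida_input R Xr S b d l y)) <= c]; last by reflexivity.
  by near=> l; split; near: l => //; exact: nbhs_pinfty_gt.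
apply: ge_ereal_sup => _ [l [l0 hlc] <-].
by rewrite lee_fin approximate_input.
Unshelve. all: by end_near. Qed.

Hypothesis hB : continuous B.

Lemma input_bounded : exists M, 0 <= M /\ forall x : Xr, `|b x| <= M * `|x|.
Proof.
have [M [M0 hM]] := continuous_linear_nrm hB.
by exists M; split=> // x; have := hM x; rewrite -(ext_res_norm hS heta hj).
Qed.

Local Notation cmu := (@completed_lebesgue_measure R).
Local Notation cT := (caratheodory_type (wlength (@idfun R))^*%mu).
Variable T : R.
Hypothesis T0 : 0 < T.
Hypothesis ds2 : forall u : R -> X, bochner_L1 cmu `]0, T[ u ->
    range j (bochner_integral cmu `]0, T[ (fun s => Sm1 (T - s) (B (u s)))).

(** For a right continuous and dominated input, the state reached at time T is
   a Bochner integral in X_{-1}; that it lies in X means that its image in X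
   lies in the domain of A. *)
Lemma admissible_domain (u : R -> Xr) :
  (forall s, s < T -> exists e, 0 < e /\ forall r, s <= r < s + e -> u r = u s) ->
  (exists g : cT -> \bar R, cmu.-integrable (`]0, T[%classic : set cT) g /\
     forall s : cT, (`]0, T[%classic : set cT) s -> ((`|u s|)%:E <= g s)%E) ->
  exists xi z, @gen R Xr S xi z /\ forall psi : Xr -> R, unit_functional psi ->
    (\int[cmu]_(s in (`]0%R, T[%classic : set cT)) (psi (S (T - s) (b (u s))))%:E
     = (psi xi)%:E)%E.
Proof.
move=> ur [g [ig gu]].
have [M [M0 hM]] := input_bounded.
have mD : measurable (`]0, T[%classic : set cT).
  by apply: completed_measurable; exact: measurable_itv.
have [s us] : exists s : nat -> simple_fun cmu X, simple_approx s `]0, T[%classic u.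
  apply: right_continuous_approx => // t /andP[t0 tT].
  have [e [e0 he]] := ur t tT.
  apply: (@cvg_trans _ ((fun=> u t) @ t^'+)); last exact: cvg_cst.
  apply: near_eq_cvg; near=> r; rewrite he//.
  by apply/andP; split; [exact: ltW|]; near: r; apply: nbhs_right_lt; rewrite ltrDl.
have uL1 : bochner_L1 cmu `]0, T[ u.
  split; last exact: approx_dominated mD us ig gu.
  by exists s; apply: aeW => t /us.
pose G (r : R) : Xm1 := Sm1 (T - r) (B (u r)).
have PG r : r < T -> P (G r) = S (T - r) (b (u r)).
  by move=> rT; rewrite (ext_res_semigroup hS hSc heta hj hSm1 hSm1S)// subr_ge0 ltW.
have [s' Gs'] : exists s : nat -> simple_fun cmu Xm1, simple_approx s `]0, T[%classic G.
  apply: right_continuous_approx => // t /andP[t0 tT].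
  have [e [e0 he]] := ur t tT.
  suff H : (G r : Zr) @[r --> t^'+] --> (G t : Zr) by [].
  apply/cvgrPdist_le => eps eps0.
  have C : (S `|T - r| (b (u t)) : Xr) @[r --> t] --> (S `|T - t| (b (u t)) : Xr).
    apply: (@continuous_comp _ _ _ (fun r : R => T - r)
      (fun r : R => S `|r| (b (u t)) : Xr)); last exact: (@orbit_continuous _ _ _ cS).
    by apply: cvgB; [exact: cvg_cst|exact: cvg_id].
  have /cvgrPdist_le /(_ _ eps0) C' := cvg_at_right_filter C.
  near=> r.
  have rT : r < T by near: r; exact: nbhs_right_lt.
  have -> : `|(G t : Zr) - G r| = `|(S `|T - t| (b (u t)) : Xr) - S `|T - r| (b (u t))|.
    rewrite !ger0_norm ?subr_ge0 ?(ltW tT) ?(ltW rT)//.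
    have E : u r = u t.
      rewrite he//; apply/andP; split; [exact: ltW|].
      by near: r; apply: nbhs_right_lt; rewrite ltrDl.
    have := ext_res_norm hS heta hj (G t - G r).
    by rewrite (linear_funB (ext_res_linear hS heta hj)) !PG// E => en; exact: esym en.
  by near: r.
have Goo : (\int[cmu]_(r in (`]0%R, T[%classic : set cT)) (nrm (G r))%:E < +oo)%E.
  apply: (approx_dominated mD Gs' (integrableZl mD M ig)) => t Dt.
  move: (Dt) => /=; rewrite in_itv/= => /andP[t0 tT].
  apply: le_trans (_ : (M%:E * (`|u t|)%:E <= _)%E); last by apply: lee_wpmul2l => //; exact: gu.
  rewrite -EFinM lee_fin -(ext_res_norm hS heta hj) PG//.
  apply: le_trans (hM _); apply: (csg_contr cS); first by rewrite subr_ge0 ltW.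
have unitP (psi : Xr -> R) : unit_functional psi -> unit_functional (fun z : Zr => psi (P z)).
  move=> [lpsi psi1]; split=> [a z z'|z].
    by rewrite -lpsi; congr psi; exact: ext_res_linear.
  by apply: le_trans (psi1 _) _; rewrite [leLHS](ext_res_norm hS heta hj).
have nZ : has_norming_functionals Zr.
  move=> z; have [psi hpsi psiz] := nX (P z); exists (fun z => psi (P z)).
    exact: unitP.
  by rewrite psiz; exact: ext_res_norm.
have := ds2 uL1 => -[x _ xE].
have isb := bochner_integralP (bochner_exists nZ mD Gs' Goo).
exists (Rs x), (eta *: Rs x - x); split; first exact: resolvent_gen.
move=> psi hpsi.
have [_] := is_bochner_functional mD Gs' Goo isb (unitP _ hpsi).
rewrite -xE ext_resE => <-.
by apply: eq_integral => t /[!inE]/=; rewrite in_itv/= => /andP[t0 tT]; rewrite PG.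
Unshelve. all: by end_near. Qed.

End transfer.

(** * Stabilization *)

Section closed_loop_semigroup.
Context (R : realType) (k : scalar_kind) (X : completeNormedModType (scalars R k)).
Local Notation Xr := (realify X).

(** A scalar is a positive real multiple of a scalar of modulus at most 1, so that
   real linearity and the symmetries give linearity over the scalar field. *)
Lemma growth_semigroup_C0 w (U : R -> X -> X) :
  growth_semigroup w (U : R -> Xr -> Xr) ->
  (forall (a : scalars R k), `|a| <= 1 -> forall t x, 0 <= t -> a *: U t x = U t (a *: x)) ->
  C0_semigroup U.
Proof.
move=> hU commU.
have lin t : 0 <= t -> linear (U t).
  move=> t0; have lU := gsg_linear hU t0.
  have UZ (a : scalars R k) x : U t (a *: x) = a *: U t x.
    pose r := re `|a| + 1.
    have a0 : 0 <= re `|a| by rewrite -(ler_ofR k) ofR0 ofR_re.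
    have r0 : 0 < r by rewrite ltr_wpDl.
    have aE : a = ofR k r * (ofR k r^-1 * a).
      by rewrite mulrA -ofRM divff ?gt_eqF// ofR1 mul1r.
    rewrite {1}aE -scalerA.
    have H := real_linearZ r ((ofR k r^-1 * a) *: x : Xr) lU.
    rewrite [LHS]H [LHS](_ : _ = ofR k r *: (U t ((ofR k r^-1 * a) *: x)))//.
    rewrite -commU//; first by rewrite scalerA -aE.
    rewrite normrM normr_ofR [`|r^-1|]gtr0_norm ?invr_gt0// -[`|a|]ofR_re// -ofRM -(ofR1 R k) ler_ofR.
    by rewrite mulrC ler_pdivrMr// mul1r /r lerDl.
  move=> a x y; have := real_linearD (a *: x : Xr) (y : Xr) lU.
  by rewrite UZ.
split.
- move=> t t0; split; first exact: lin.
  apply: (@nrm_linear_continuous _ _ _ _ (expR (w * t))); first exact: lin.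
  by move=> x; exact: (gsg_le hU x t0).
- exact: gsg0 hU.
- by move=> s t s0 t0 y; exact: (gsgD hU).
- by move=> y V; exact: (@gsg_cvg0 _ _ _ _ hU y V).
Qed.

End closed_loop_semigroup.

Theorem corollary3 (R : realType) (k : scalar_kind)
  (X : completeNormedModType (scalars R k))
  (A : operator X X) (S : R -> X -> X)
  (hS : generates A S) (hSc : contractive S)
  (eta : scalars R k) (heta : resolvent_set A eta)
  (Xm1 : completeNormedModType (scalars R k)) (j : {linear X -> Xm1})
  (hXm1 : is_extrapolation_space A eta j)
  (Am1 : operator Xm1 Xm1) (Sm1 : R -> Xm1 -> Xm1)
  (hSm1 : generates Am1 Sm1) (hSm1S : extends_semigroup j S Sm1)
  (B : {linear X -> Xm1}) (hB : continuous B)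
  (mu1 T : R) (hmu1 : 0 < mu1) (hT : 0 < T)
  (ds1 : forall mu mu' : R, 0 < mu < mu1 -> 0 < mu' < mu1 ->
    dom (part_in_X j (perturbed j Am1 B mu)) =
    dom (part_in_X j (perturbed j Am1 B mu')))
  (ds2 : forall u : R -> X,
    bochner_L1 completed_lebesgue_measure `]0, T[ u ->
    range j (bochner_integral completed_lebesgue_measure `]0, T[
               (fun s => Sm1 (T - s) (B (u s)))))
  (ds3 : exists delta : R, 0 < delta /\
    forall (y : X) (phi : R -> {linear X -> (scalars R k)^o}),
      (forall t, 0 <= t <= T -> duality_map (S t y) (phi t)) ->
      ((delta * nrm (S T y) ^+ 2)%:E <=
        integral_or_upper completed_lebesgue_measure `[0%R, T]
          (fun t => limsup_pairing j Am1 B (S t y) (phi t)))%E)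
  (ds4 : exists c : R, 0 <= c /\
    forall y z : X, exists ystar zstar : {linear X -> (scalars R k)^o},
      [/\ duality_map y ystar, duality_map z zstar &
        (`| limsup_pairing j Am1 B y ystar - limsup_pairing j Am1 B z zstar |
          <= (c * (nrm y + nrm z) * nrm (y - z))%:E)%E]) :
  exists alpha : R, 0 < alpha /\
    forall mu : R, 0 < mu < alpha ->
      exponentially_stabilizes j Am1 B (feedback B mu).
Proof.
have [hS0 AE] := hS; have [hSm10 Am1E] := hSm1; subst A Am1.
have [delta [delta0 obs]] := ds3; have [c [c0 cont]] := ds4.
pose Xr := realify X; pose Phi := {linear X -> (scalars R k)^o}.
pose ev (phi : Phi) (x : Xr) : R := re (phi x).
pose J (y : Xr) (phi : Phi) : Prop := duality_map (y : X) phi.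
have hJ (y : Xr) phi : J y phi -> dual_element y (ev phi).
  exact: duality_map_dual_element.
have cS := contraction_realify hS0 hSc.
have nX : has_norming_functionals Xr.
  apply: dual_element_norming => y; have [ys [zs [h _ _]]] := cont y y.
  by exists (ev ys); exact: hJ.
pose b : Xr -> Xr := input hS0 heta hXm1 B.
pose d : Xr -> Xr := input_eta hS0 heta hXm1 B.
have lb : real_linear b by exact: input_real_linear.
have ld : real_linear d by exact: input_eta_real_linear.
have [Mb [Mb0 bM]] := input_bounded hS0 heta hXm1 hB.
have [Kf [Kf0 bK]] := admissible_favard nX cS lb Mb0 bM hT
  (admissible_domain hS0 hSc heta hXm1 hSm10 hSm1S nX hB hT ds2).
have e0 : 0 <= re `|eta| by rewrite -(ler_ofR k) ofR0 ofR_re.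
have dM x : `|d x| <= re `|eta| * Mb * `|x|.
  have -> : `|d x| = re `|eta| * `|b x| by exact: nrmZ.
  by rewrite -mulrA ler_wpM2l.
have hL (y : Xr) (phi : Phi) (r : R) :
    (\forall l \near +oo, ev phi (yosida_input (S : R -> Xr -> Xr) b d l y) <= r) ->
    (limsup_pairing j (generator Sm1) B y phi <= r%:E)%E.
  exact: limsup_pairing_le.
have [alpha [alpha0 stab]] := small_gain_stability cS nX hJ hL hT c0 obs cont
  lb ld Kf0 (mulr_ge0 e0 Mb0) bK dM delta0.
exists alpha; split=> // mu hmu; have [U [hU genU [M [sigma [M0 s0 decay]]] commU]] := stab mu hmu.
exists (U : R -> X -> X); rewrite closed_loop_feedback; split; last by exists M, sigma.
split; last first.
  apply/seteqP; split=> -[y z].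
    by move=> /(perturbed_part hS0 hSc heta hXm1 hSm10 hSm1S) /genU.
  by move=> /genU/(perturbed_part hS0 hSc heta hXm1 hSm10 hSm1S).
(* The multiplications by scalars of modulus at most 1 are symmetries of the
   closed-loop equation, hence of its semigroup. *)
have lin : linear (b : X -> X) by exact: input_scaleD.
apply: (growth_semigroup_C0 hU) => a a1 t x t0.
have scale_le (y : Xr) : `|(a *: (y : X) : Xr)| <= `|y|.
  have -> : `|(a *: (y : X) : Xr)| = re `|a| * `|y| by exact: nrmZ.
  by rewrite ler_piMl// -(ler_ofR k) ofR_re// ofR1.
apply: (commU (fun y : Xr => a *: (y : X) : Xr)) => //.
- move=> r y z; rewrite (_ : r *: y + z = ofR k r *: (y : X) + z :> X)//.
  by rewrite scalerDr !scalerA mulrC -scalerA.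
- move=> s y s0'; have [ls _] := (let: And4 h _ _ _ := hS0 in h) s s0'.
  by rewrite (linear_funZ ls).
- by move=> y; rewrite (linear_funZ lin).
- move=> y; change (a *: (eta *: (b y : X)) = eta *: (b (a *: (y : X)) : X)).
  by rewrite (linear_funZ lin) !scalerA mulrC.
Qed.
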